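(* Let $\Phi$ be a nearest-neighbour interaction on $\mathbb{Z}^d$ with finite alphabet $\mathcal{A}$, let $\mu$ be an equilibrium state for $\Phi$, and let $\nu$ be a shift-invariant Borel probability measure on $\mathcal{A}^{\mathbb{Z}^d}$ with $\operatorname{supp}(\nu)\subseteq\operatorname{supp}(\mu)$, such that: (A1) $\operatorname{supp}(\mu)$ satisfies the D-condition; (A2) $\lim_{S\to\mathcal{P}}p_{\mu,S}(x)=p_\mu(x)$ uniformly over $x\in\operatorname{supp}(\nu)$; (A3) $\mathrm{c}_\mu^-(\nu)>0$, where $\mathrm{c}_\mu^-(\nu)=\inf\{p_{\mu,S}(x):x\in\operatorname{supp}(\nu),\ S\subset\mathcal{P}\text{ finite}\}$. Then $P(\Phi)=\int (I_\mu+A_\Phi)\,d\nu$.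
   Context: Configurations: for $S\subseteq\mathbb{Z}^d$ a configuration on $S$ is $u\in\mathcal{A}^S$; $x(S)$ denotes restriction. The shift is $(\sigma_px)(q)=x(p+q)$; $\mathbb{Z}^d$ is a graph with edges $\{p,q\}$, $\sum_i|p_i-q_i|=1$; $e_1,\dots,e_d$ is the canonical basis. A shift space is a closed shift-invariant $X\subseteq\mathcal{A}^{\mathbb{Z}^d}$; $[u]_X=\{x\in X:x(S)=u\}$ for $u\in\mathcal{A}^S$; $\mathcal{L}_S(X)=\{x(S):x\in X\}$. $\mathrm{B}_n=\{p\in\mathbb{Z}^d:|p_i|\le n\ \forall i\}$. For a measure $\mu$ and $u\in\mathcal{A}^S$ with $S$ finite, $\mu(u)$ is the measure of the cylinder $\{x:x(S)=u\}$; $\operatorname{supp}(\mu)=\{x:\mu(x(S))>0\ \forall\text{ finite }S\}$. Interaction: a nearest-neighbour (n.n.) interaction $\Phi$ is a shift-invariant function from configurations on single vertices and on edges of $\mathbb{Z}^d$ to $\mathbb{R}\cup\{\infty\}$, with finite values on vertices. $\mathsf{X}(\Phi)=\{x\in\mathcal{A}^{\mathbb{Z}^d}:\Phi(x(\{p,p+e_i\}))\ne\infty\ \forall p,i\}$. For finite $S$ and $w\in\mathcal{A}^S$, $U^\Phi_S(w)=\sum_{p\in S}\Phi(w(p))+\sum_{e\subseteq S}\Phi(w(e))$ (sum over edges $e$ contained in $S$), and $Z_S^\Phi=\sum_{w\in\mathcal{A}^S}e^{-U_S^\Phi(w)}$ (with $e^{-\infty}=0$). The pressure is $P(\Phi)=\lim_{n}\frac{1}{|\mathrm{B}_n|}\log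 Z^\Phi_{\mathrm{B}_n}$. For $x\in\mathsf{X}(\Phi)$, $A_\Phi(x)=-\Phi(x(0))-\sum_{i=1}^d\Phi(x(\{0,e_i\}))$. Equilibrium state for $\Phi$: a shift-invariant Borel probability measure $\mu$ with $\operatorname{supp}(\mu)\subseteq\mathsf{X}(\Phi)$ that maximizes $h(\mu)+\int A_\Phi\,d\mu$ among all such measures, where $h(\mu)=\lim_n\frac{-1}{|\mathrm{B}_n|}\sum_{w\in\mathcal{A}^{\mathrm{B}_n}}\mu(w)\log\mu(w)$ ($0\log0=0$). (One has $P(\Phi)=\max_\mu(h(\mu)+\int A_\Phi d\mu)$.) D-condition for a shift space $X$: there exist sequences of finite subsets $S_n\subseteq T_n$ of $\mathbb{Z}^d$ such that $|S_n|\to\infty$, $|S_n\triangle(p+S_n)|/|S_n|\to0$ for each $p\in\mathbb{Z}^d$, $|T_n|/|S_n|\to1$, and for every $n$, every finite $U\subset\mathbb{Z}^d\setminus T_n$, every $u\in\mathcal{L}_U(X)$ and $v\in\mathcal{L}_{S_n}(X)$: $[u]_X\cap[v]_X\ne\emptyset$. Conditional probabilities: lexicographic order: $q\prec p$ iff $q\ne p$ and $q_i<p_i$ for the smallest $i$ with $q_i\ne p_i$. $\mathcal{P}=\{p\in\mathbb{Z}^d:p\prec0\}$, $\mathcal{P}_n=\mathcal{P}\cap\mathrm{B}_n$. For finite $S\subset\mathbb{Z}^d\setminus\{0\}$ and $x\in\operatorname{supp}(\mu)$, $p_{\mu,S}(x)=\mu(x(0)\mid x(S))$. $p_\mu(x)=\lim_n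 p_{\mu,\mathcal{P}_n}(x)$ (exists $\mu$-a.e.; under (A2) it exists for every $x\in\operatorname{supp}(\nu)$), and $I_\mu(x)=-\log p_\mu(x)$. $\lim_{S\to\mathcal{P}}p_{\mu,S}(x)=L$ means: for every $\epsilon>0$ there is $n$ such that $|p_{\mu,S}(x)-L|<\epsilon$ for all finite $S$ with $\mathcal{P}_n\subseteq S\subset\mathcal{P}$; it is uniform over $x\in\operatorname{supp}(\nu)$ if $n$ can be chosen independently of $x\in\operatorname{supp}(\nu)$. *)

(* Defs.v *)
From HB Require Import structures.
From mathcomp Require Import all_boot all_order all_algebra finmap.
From mathcomp Require Import all_classical all_reals all_analysis.

Set Implicit Arguments.
Unset Strict Implicit.
Unset Printing Implicit Defensive.

Import Order.TTheory GRing.Theory Num.Theory.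
Import numFieldNormedType.Exports.

Local Open Scope classical_set_scope.
Local Open Scope ring_scope.

(* Measurable types are pointed in the library, so the alphabet must be
   nonempty; this loses nothing, since otherwise (Z^d -> A) is empty and carries
   no probability measure. *)
#[short(type="alphabetType")]
HB.structure Definition Alphabet := {A of Finite A & Pointed A}.

Notation Zd d := 'rV[int]_d.

Section Lattice.
Variable d : nat.
Implicit Types (p q : Zd d) (S T : {fset Zd d}).

Definition basis (i : 'I_d) : Zd d := delta_mx 0 i.

Definition adjacent p q : bool := \sum_(i < d) `|p 0 i - q 0 i| == 1.

Definition is_vertex S : bool := [exists p : S, S == [fset val p]%fset].

Definition is_edge S : bool :=
  [exists p : S, [exists q : S,
    adjacent (val p) (val q) && (S == [fset val p; val q]%fset)]].

Definition translate p S : {fset Zd d} := [fset (p + q)%R | q in S]%fset.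

Definition symdiff S T : {fset Zd d} := ((S `\` T) `|` (T `\` S))%fset.

Definition box_point (n : nat) (f : {ffun 'I_d -> 'I_(n.*2.+1)}) : Zd d :=
  \row_i ((f i)%:Z - n%:Z).

Definition box (n : nat) : {fset Zd d} :=
  [fset box_point f | f in {: {ffun 'I_d -> 'I_(n.*2.+1)}}]%fset.

Lemma in_box n p : (p \in box n) = [forall i, `|p 0 i| <= n%:Z].
Proof.
apply/imfsetP/forallP => [[f _ ->] i|pn].
  rewrite mxE ler_norml; apply/andP; split; first by rewrite lerBrDr addNr.
  by rewrite lerBlDr -PoszD lez_nat addnn -ltnS ltn_ord.
have h i : (absz (p 0 i + n%:Z)%R < n.*2.+1)%N.
  have := pn i; rewrite ler_norml => /andP[h1 h2].
  rewrite ltnS -lez_nat gez0_abs; last by rewrite -lerBlDr sub0r.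
  by rewrite -addnn PoszD lerD2r.
exists [ffun i => Ordinal (h i)] => //.
apply/rowP => i; rewrite mxE ffunE /= gez0_abs ?addrK//.
by have := pn i; rewrite ler_norml -lerBlDr sub0r => /andP[].
Qed.

(* lex q p is q < p in the strict lexicographic order. *)
Definition lex q p : bool :=
  [exists i : 'I_d, (q 0 i < p 0 i) &&
    [forall j : 'I_d, (j < i)%N ==> (q 0 j == p 0 j)]].

Definition past : set (Zd d) := [set p | lex p 0].

Definition past_box (n : nat) : {fset Zd d} := [fset p in box n | lex p 0]%fset.

End Lattice.

Arguments box d n : clear implicits.
Arguments past d : clear implicits.
Arguments past_box d n : clear implicits.

Section Configurations.
Variables (d : nat) (A : alphabetType).

(* A^(Z^d) with the Borel sigma-algebra of the product of discrete topologies. *)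
Definition product_space := prod_topology (fun _ : Zd d => discrete_topology A).
Definition config := g_sigma_algebraType (@open product_space).

(* A configuration on a finite set S is a finite map with domain S. *)
Definition pattern := {fmap Zd d -> A}.

Definition shift_config (p : Zd d) (x : config) : config := fun q => x (p + q).

Definition restr (x : config) (S : {fset Zd d}) : pattern :=
  [fmap p : S => x (val p)].

Definition cylinder (w : pattern) : set config :=
  [set x | restr x (domf w) = w].

Definition language (X : set config) (S : {fset Zd d}) : set pattern :=
  [set restr x S | x in X].

End Configurations.

Section Measures.
Variables (R : realType) (d : nat) (A : alphabetType).
Implicit Types (mu nu : probability (config d A) R) (x : config d A).
Implicit Types (S : {fset Zd d}) (X : set (config d A)).

Definition shift_invariant mu : Prop :=
  forall (p : Zd d) (B : set (config d A)), measurable B ->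
    mu (shift_config p @^-1` B) = mu B.

Definition mu_pattern mu (w : pattern d A) : R := fine (mu (cylinder w)).

Definition msupport mu : set (config d A) :=
  [set x | forall S, 0 < mu_pattern mu (restr x S)].

Definition entropy mu : R :=
  limn (fun n => - (#|` box d n|%:R)^-1 *
    \sum_(w : {ffun box d n -> A})
      mu_pattern mu (FinMap w) * ln (mu_pattern mu (FinMap w))).

(* mu(x(0) | x(S)), meant for S not containing 0 and x in the support of mu. *)
Definition cond_prob mu S x : R :=
  mu_pattern mu (restr x (0 |` S)%fset) / mu_pattern mu (restr x S).

Definition cond_prob_past mu x : R :=
  limn (fun n => cond_prob mu (past_box d n) x).

(* Equal to +oo where the conditional probability vanishes. *)
Definition information mu x : \bar R := (- lne (cond_prob_past mu x)%:E)%E.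

Definition cond_prob_cvg_uniform mu X : Prop :=
  forall eps : R, 0 < eps -> exists n : nat, forall x, X x ->
    forall S, (past_box d n `<=` S)%fset -> [set` S] `<=` past d ->
      `|cond_prob mu S x - cond_prob_past mu x| < eps.

Definition c_minus mu nu : R :=
  inf [set r | exists x S,
    [/\ msupport nu x, [set` S] `<=` past d & r = cond_prob mu S x]].

Definition D_condition X : Prop :=
  exists S T : nat -> {fset Zd d},
    [/\ forall n, (S n `<=` T n)%fset,
        (fun n => #|` S n|%:R : R) @ \oo --> +oo,
        forall p : Zd d,
          (fun n => #|` symdiff (S n) (translate p (S n))|%:R / #|` S n|%:R : R)
            @ \oo --> (0 : R),
        (fun n => #|` T n|%:R / #|` S n|%:R : R) @ \oo --> (1 : R) &
        forall n (U : {fset Zd d}), [disjoint U & T n]%fset ->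
          forall u v : pattern d A, language X U u -> language X (S n) v ->
            (X `&` cylinder u) `&` (X `&` cylinder v) !=set0].

End Measures.

Section Interactions.
Variables (R : realType) (d : nat) (A : alphabetType).
Local Open Scope ereal_scope.

(* Only the values on patterns whose domain is a vertex or an edge matter. *)
Record nn_interaction := NNInteraction {
  interaction_fun :> pattern d A -> \bar R;
  interaction_vertex : forall w : pattern d A,
    is_vertex (domf w) -> interaction_fun w \is a fin_num;
  interaction_edge : forall w : pattern d A,
    is_edge (domf w) -> interaction_fun w != -oo;
  interaction_shift : forall (x : config d A) (p : Zd d) (S : {fset Zd d}),
    is_vertex S || is_edge S ->
    interaction_fun (restr (shift_config p x) S) =
    interaction_fun (restr x (translate p S)) }.

Variable Phi : nn_interaction.

Definition allowed : set (config d A) :=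
  [set x | forall (p : Zd d) (i : 'I_d),
    Phi (restr x [fset p; (p + basis i)%R]%fset) != +oo].

(* This is the energy of w on S, where S is the domain of w. *)
Definition energy (w : pattern d A) : \bar R :=
  \sum_(p <- domf w) Phi w.[& [fset p]%fset]%fmap +
  \sum_(e <- fpowerset (domf w) | is_edge e) Phi w.[& e]%fmap.

Definition partition_function (S : {fset Zd d}) : \bar R :=
  \sum_(w : {ffun S -> A}) expeR (- energy (FinMap w)).

Definition pressure : \bar R :=
  limn (fun n => (#|` box d n|%:R^-1)%:E * lne (partition_function (box d n))).

Definition A_Phi (x : config d A) : \bar R :=
  - Phi (restr x [fset 0%R]%fset) -
  \sum_(i < d) Phi (restr x [fset 0%R; basis i]%fset).

Definition free_energy (mu : probability (config d A) R) : \bar R :=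
  (entropy mu)%:E + \int[mu]_x A_Phi x.

Definition equilibrium_state (mu : probability (config d A) R) : Prop :=
  [/\ shift_invariant mu,
      msupport mu `<=` allowed &
      forall mu' : probability (config d A) R,
        shift_invariant mu' -> msupport mu' `<=` allowed ->
        free_energy mu' <= free_energy mu].

End Interactions.

(* Main.v *)
(** Write X for the support of mu, U for the energy and P for the pressure.

    Variational principle: averaging the Gibbs distributions of boxes over
    translations and taking a limit along an ultrafilter gives a consistent
    shift-invariant family of marginals, hence by compactness a measure, whose
    free energy is at least limsup (log Z_n) / |B_n|; the entropy of the averages
    is controlled by Shearer's inequality.  The Gibbs inequality bounds the free
    energy of any admissible invariant measure by the liminf.  So P exists and is
    the free energy of mu.

    Gibbs property: if a and b differ only in the interior of V, the observable
    e^{U(a)} 1_a - e^{U(b)} 1_b has conditional Gibbs mean zero given the outside.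
    If its mu-mean were nonzero, inserting a small multiple of it in each tile of
    a tiling of a large box into the Gibbs inequality would make log Z_n exceed
    the free energy by an amount proportional to the volume.  Hence
    mu(a) e^{U(a)} = mu(b) e^{U(b)}.

    With the D-condition, this makes - log mu(x(S_n)) - U(x(S_n)) equal to
    |S_n| P + o(|S_n|), uniformly over x in X.  Integrate over nu: the
    lexicographic chain rule writes - log mu(x(S_n)) as a sum of |S_n| conditional
    informations, all but o(|S_n|) of which are close to I_mu by (A2), the others
    being bounded by (A3). *)

From HB Require Import structures.
Require Import Defs.
From mathcomp Require Import all_boot all_order all_algebra finmap.
From mathcomp Require Import all_classical all_reals all_analysis.
From mathcomp Require Import measurable_realfun.
From mathcomp Require Import ring lra zify.

Set Implicit Arguments.
Unset Strict Implicit.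
Unset Printing Implicit Defensive.

Import Order.TTheory GRing.Theory Num.Theory.
Import numFieldNormedType.Exports.

Local Open Scope classical_set_scope.
Local Open Scope ring_scope.

(* [basis] and [adjacent] are the lattice notions, not those of MathComp-Analysis. *)
Import Defs.

(** * Entropy of consistent families of marginals *)

(** The estimates are made on [state]s, consistent families of finite marginals: finite-volume Gibbs
    distributions, their averages and their limits live there without any topology on measures, and
    a new measure is built only to be compared with the maximizer [mu]. An ultrafilter makes all
    marginals converge at once and can be chosen to contain the indices where log Z_n is too large.

    Shearer's inequality stands in for subadditivity over disjoint tiles: it treats boxes, Folner
    sets and the non-invariant Gibbs distributions alike, at the price of boundary terms.

    The obstacle is that energies may be infinite. Real energies are kept apart from admissibility,
    and the Gibbs relation compares only two patterns admissible on the same window. The D-condition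
    supplies the second pattern, so that any two points of X can be compared on S_n up to o(|S_n|).
    The nearly constant value of log mu(x(S_n)) + U(x(S_n)) is then identified by averaging over mu:
    it is the mean of U minus the entropy on S_n, hence -|S_n| P to first order.

    In the perturbation argument the gain per tile is of first order in the size of the perturbation
    and the loss of second order, so that one fixed small size wins on every tile. *)

Lemma gibbs_inequality (R : realType) (T : finType) (p g : T -> R) :
  (forall t, 0 <= p t) -> \sum_t p t = 1 -> (forall t, 0 <= g t) ->
  (forall t, 0 < p t -> 0 < g t) ->
  \sum_t p t * (ln (g t) - ln (p t)) <= ln (\sum_t g t).
Proof.
move=> p0 p1 g0 pg.
have G0 : 0 < \sum_t g t.
  rewrite lt_def sumr_ge0// andbT; apply/eqP => G0.
  have g00 t : g t = 0.
    by move/psumr_eq0P : G0 => ->.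
  suff : \sum_t p t = 0 by rewrite p1 => /eqP; rewrite oner_eq0.
  apply: big1 => t _; apply/eqP; rewrite eq_le p0 andbT leNgt.
  by apply/negP => /pg; rewrite g00 ltxx.
set G := \sum_t g t in G0 *.
rewrite -subr_le0.
have -> : \sum_t p t * (ln (g t) - ln (p t)) - ln G =
          \sum_t p t * (ln (g t) - ln (p t) - ln G).
  rewrite -[ln G in LHS]mul1r -p1 mulr_suml -sumrB.
  by apply: eq_bigr => t _; rewrite [in RHS]mulrBr.
(* Zero is the difference of two total masses, which reduces the claim to the termwise bound ln z <=
   z - 1 at z = g t / (p t * G). *)
rewrite [leRHS](_ : 0 = \sum_t (g t / G - p t)); last first.
  by rewrite sumrB p1 -mulr_suml divff ?subrr// gt_eqF.
apply: ler_sum => t _.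
have [pt|pt] := ltP 0 (p t); last first.
  have -> : p t = 0 by apply/eqP; rewrite eq_le pt p0.
  by rewrite mul0r subr0 divr_ge0// ltW.
have gt := pg _ pt.
have -> : ln (g t) - ln (p t) - ln G = ln (g t / (p t * G)).
  by rewrite ln_div ?posrE ?mulr_gt0// lnM ?posrE// opprD addrA.
have h : ln (g t / (p t * G)) <= g t / (p t * G) - 1.
  have := @le_ln1Dx R (g t / (p t * G) - 1); rewrite addrCA subrr addr0; apply.
  by rewrite ltrBrDl subrr divr_gt0// mulr_gt0.
apply: le_trans (ler_wpM2l (p0 t) h) _.
rewrite mulrBr mulr1 le_eqVlt; apply/orP; left; apply/eqP; congr (_ - _).
by field; rewrite !gt_eqF.
Qed.

Section Patterns.
Variables (I : choiceType) (A : alphabetType).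
Implicit Types (S T : {fset I}) (x y : I -> A).

(* The default symbol is used outside of [S]. *)
Definition extend S (w : {ffun S -> A}) : I -> A :=
  fun i => if insub i is Some j then w j else point.

Definition splice S x y : I -> A := fun i => if i \in S then x i else y i.

Definition agree S x y := forall i, i \in S -> x i = y i.

Definition agreeb S x y : bool := [forall i : S, x (val i) == y (val i)].

Lemma agreeP S x y : reflect (agree S x y) (agreeb S x y).
Proof.
apply: (iffP forallP) => [h i iS|h i]; first exact/eqP/(h [` iS]%fset).
exact/eqP/h/valP.
Qed.

Lemma agree_refl S x : agree S x x. Proof. by []. Qed.

Lemma agree_sym S x y : agree S x y -> agree S y x.
Proof. by move=> h i /h. Qed.

Lemma agree_trans S y x z : agree S x y -> agree S y z -> agree S x z.
Proof. by move=> h k i iS; rewrite h// k. Qed.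

Lemma agree_sub S T x y : (S `<=` T)%fset -> agree T x y -> agree S x y.
Proof. by move=> /fsubsetP ST h i /ST/h. Qed.

Lemma splice_agree S x y : agree S (splice S x y) x.
Proof. by move=> i iS; rewrite /splice iS. Qed.
Arguments splice_agree : clear implicits.

Lemma extendE S (w : {ffun S -> A}) i (iS : i \in S) :
  extend w i = w [` iS]%fset.
Proof. by rewrite /extend insubT. Qed.

Lemma extend_out S (w : {ffun S -> A}) i : i \notin S -> extend w i = point.
Proof. by move=> iS; rewrite /extend insubF//; apply/negbTE. Qed.

Definition window S x : {ffun S -> A} := [ffun i => x (val i)].

Lemma extendK S : cancel (@extend S) (@window S).
Proof.
by move=> w; apply/ffunP => -[i iS]; rewrite ffunE /= extendE.
Qed.

Lemma window_agree S x y : agree S x y -> window S x = window S y.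
Proof. by move=> h; apply/ffunP => i; rewrite !ffunE h ?fsvalP. Qed.

Lemma extend_window S x : agree S (extend (window S x)) x.
Proof. by move=> i iS; rewrite extendE ffunE. Qed.

Lemma agree_extend S x (w : {ffun S -> A}) :
  agreeb S x (extend w) = (w == window S x).
Proof.
apply/agreeP/eqP => [h|->]; last exact/agree_sym/extend_window.
by rewrite (window_agree h) extendK.
Qed.

Section Sums.
Variable R : realType.
Implicit Types (f g : (I -> A) -> R).

(** Summands take total configurations, so that windows of different sizes share one type. Sites
    outside [S] carry the default symbol, which is harmless when [f] is local on [S]. *)
Definition psum S f : R := \sum_(w : {ffun S -> A}) f (extend w).

Definition localf S f := forall x y, agree S x y -> f x = f y.

Lemma psum0 f : psum fset0 f = f (fun=> point).
Proof.
rewrite /psum (bigD1 [ffun i => point])//= [X in _ + X]big1 ?addr0.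
  by congr f; apply/funext => i; rewrite extend_out ?inE.
by move=> w /eqP; case; apply/ffunP => -[].
Qed.

Lemma eq_psum S f g : (forall x, f x = g x) -> psum S f = psum S g.
Proof. by move=> h; apply: eq_bigr. Qed.

Lemma le_psum S f g : (forall x, f x <= g x) -> psum S f <= psum S g.
Proof. by move=> h; apply: ler_sum. Qed.

Lemma psum_ge0 S f : (forall x, 0 <= f x) -> 0 <= psum S f.
Proof. by move=> h; apply: sumr_ge0. Qed.

Lemma psumD S f g : psum S (fun x => f x + g x) = psum S f + psum S g.
Proof. exact: big_split. Qed.

Lemma psumZl S c f : psum S (fun x => c * f x) = c * psum S f.
Proof. by rewrite /psum mulr_sumr. Qed.

Lemma psumZr S c f : psum S (fun x => f x * c) = psum S f * c.
Proof. by rewrite /psum mulr_suml. Qed.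

Lemma psumN S f : psum S (fun x => - f x) = - psum S f.
Proof. by rewrite /psum sumrN. Qed.

Lemma psum_sum S (J : Type) (r : seq J) (P : pred J) (F : J -> (I -> A) -> R) :
  psum S (fun x => \sum_(j <- r | P j) F j x) =
  \sum_(j <- r | P j) psum S (F j).
Proof. exact: exchange_big. Qed.

Lemma psum_const S c : psum S (fun=> c) = (#|A| ^ #|` S|)%:R * c.
Proof.
by rewrite /psum sumr_const card_ffun cardfE mulr_natl.
Qed.

(** Valid for every [f]: both sides fill the sites outside [T] with the same default symbol. *)
Lemma psumU S T f : (S `<=` T)%fset ->
  psum T f = psum S (fun x => psum (T `\` S)%fset (fun y => f (splice S x y))).
Proof.
move=> /fsubsetP ST; rewrite /psum pair_bigA /=.
pose m (u : {ffun S -> A} * {ffun (T `\` S)%fset -> A}) : {ffun T -> A} :=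
  window T (splice S (extend u.1) (extend u.2)).
pose m' (w : {ffun T -> A}) := (window S (extend w),
  window (T `\` S)%fset (extend w)).
have mK : cancel m m'.
  move=> [u v]; rewrite /m' /m; congr pair; apply/ffunP => i; rewrite !ffunE /=.
    rewrite extend_window ?ST ?fsvalP// /splice fsvalP.
    by rewrite (extendE _ (fsvalP i)); congr (u _); apply: val_inj.
  have := fsvalP i; rewrite inE => /andP[iS iT].
  rewrite extend_window// /splice (negbTE iS) (extendE _ (fsvalP i)).
  by congr (v _); apply: val_inj.
have m'K : cancel m' m.
  move=> w; rewrite /m /m' /=; apply/ffunP => i; rewrite !ffunE /splice.
  case: ifPn => iS.
    by rewrite extend_window// (extendE w (fsvalP i)); congr (w _); apply: val_inj.
  rewrite extend_window ?inE ?iS ?fsvalP//.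
  by rewrite (extendE w (fsvalP i)); congr (w _); apply: val_inj.
rewrite (reindex m) /=; last by exists m' => u _.
apply: eq_bigr => -[u v] _ /=; congr f; apply/funext => i.
have [iT|iT] := boolP (i \in T); first by rewrite extend_window.
rewrite extend_out// /splice; case: ifPn => iS; first by rewrite ST in iT.
by rewrite extend_out// inE (negbTE iT) andbF.
Qed.

Lemma psum_indic S x f : localf S f -> psum S (fun y => (agreeb S x y)%:R * f y) = f x.
Proof.
move=> lf; rewrite /psum (bigD1 (window S x))//= agree_extend eqxx mul1r.
rewrite big1 ?addr0; first exact/lf/extend_window.
by move=> w /negbTE wx; rewrite agree_extend wx mul0r.
Qed.

End Sums.
End Patterns.

Arguments splice_agree {I A}.

Section States.
Variables (R : realType) (I : choiceType) (A : alphabetType).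
Implicit Types (S T : {fset I}) (x y : I -> A).

(* [state_fun S x] is the probability of agreeing with [x] on [S]; both measures on
   configurations and their limits are handled through these marginals. *)
Record state := State {
  state_fun :> {fset I} -> (I -> A) -> R;
  state_ge0 : forall S x, 0 <= state_fun S x;
  state_local : forall S, localf S (state_fun S);
  state0 : forall x, state_fun fset0 x = 1;
  state_marg : forall S T x, (S `<=` T)%fset ->
    state_fun S x = psum (T `\` S)%fset (fun y => state_fun T (splice S x y)) }.

Implicit Types q : state.

(* Meaningful when [f] depends on the coordinates in [S] only. *)
Definition expect q S (f : (I -> A) -> R) := psum S (fun x => q S x * f x).

Definition entropyS q S := expect q S (fun x => - ln (q S x)).

Lemma state_sum1 q S : psum S (q S) = 1.
Proof.
rewrite -(state0 q (fun=> point)) (state_marg _ _ (fsub0set S)) fsetD0.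
by apply: eq_psum => x; congr (q S _); apply/funext => i; rewrite /splice inE.
Qed.

Lemma expect_sub q S T f : (S `<=` T)%fset -> localf S f ->
  expect q T f = expect q S f.
Proof.
move=> ST lf; rewrite /expect (psumU _ ST); apply: eq_psum => x.
rewrite (state_marg _ _ ST) -psumZr; apply: eq_psum => y.
by rewrite (lf _ x)//; exact: splice_agree.
Qed.

Lemma state_le q S T x : (S `<=` T)%fset -> q T x <= q S x.
Proof.
move=> ST; rewrite (state_marg q x ST) /psum.
rewrite (bigD1 (window (T `\` S)%fset x))//= [leLHS](_ : _ = q T
  (splice S x (extend (window (T `\` S)%fset x)))).
  by rewrite lerDl sumr_ge0// => ? _; exact: state_ge0.
apply: state_local => i iT; rewrite /splice; case: ifPn => // iS.
by rewrite extend_window// inE iS.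
Qed.

Lemma state_le1 q S x : q S x <= 1.
Proof. by rewrite -(state0 q x) state_le// fsub0set. Qed.

Lemma state_gt0_sub q S T x : (S `<=` T)%fset -> 0 < q T x -> 0 < q S x.
Proof. by move=> ST /lt_le_trans; apply; exact: state_le. Qed.

Lemma expectD q S f g :
  expect q S (fun x => f x + g x) = expect q S f + expect q S g.
Proof. by rewrite /expect -psumD; apply: eq_psum => x; rewrite mulrDr. Qed.

Lemma expectN q S f : expect q S (fun x => - f x) = - expect q S f.
Proof. by rewrite /expect -psumN; apply: eq_psum => x; rewrite mulrN. Qed.

Lemma expectB q S f g :
  expect q S (fun x => f x - g x) = expect q S f - expect q S g.
Proof. by rewrite expectD expectN. Qed.

Lemma expect_sum q S (J : Type) (r : seq J) (P : pred J) F :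
  expect q S (fun x => \sum_(j <- r | P j) F j x) =
  \sum_(j <- r | P j) expect q S (F j).
Proof.
by rewrite -psum_sum; apply: eq_psum => x; rewrite mulr_sumr.
Qed.

Lemma expect_cst q S c : expect q S (fun=> c) = c.
Proof. by rewrite /expect psumZr state_sum1 mul1r. Qed.

Lemma expectZ q S c f : expect q S (fun x => c * f x) = c * expect q S f.
Proof. by rewrite -psumZl; apply: eq_psum => x; rewrite mulrCA. Qed.

Lemma le_expect q S f g : (forall x, 0 < q S x -> f x <= g x) ->
  expect q S f <= expect q S g.
Proof.
move=> fg; apply: le_psum => x; have := state_ge0 q S x.
rewrite le_eqVlt => /predU1P[<-|q0]; first by rewrite !mul0r.
by rewrite ler_pM2l// fg.
Qed.

Lemma eq_expect q S f g : (forall x, 0 < q S x -> f x = g x) ->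
  expect q S f = expect q S g.
Proof.
by move=> fg; apply/eqP; rewrite eq_le !le_expect// => x /fg ->.
Qed.

Lemma expect_gibbs q S g : (forall x, 0 <= g x) ->
  (forall x, 0 < q S x -> 0 < g x) ->
  expect q S (fun x => ln (g x)) + entropyS q S <= ln (psum S g).
Proof.
move=> g0 qg; rewrite /entropyS -expectD.
by apply: gibbs_inequality => [t||//|t]; [exact: state_ge0|exact: state_sum1|exact: qg].
Qed.

Lemma entropyS0 q : entropyS q fset0 = 0.
Proof. by rewrite /entropyS /expect psum0 state0 ln1 oppr0 mulr0. Qed.

Lemma entropyS_sub q S T : (S `<=` T)%fset ->
  entropyS q S = expect q T (fun x => - ln (q S x)).
Proof.
move=> ST; rewrite (expect_sub _ ST)// => x y /(state_local q).
by move=> ->.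
Qed.

Lemma entropyS_mono q S T : (S `<=` T)%fset -> entropyS q S <= entropyS q T.
Proof.
move=> ST; rewrite (entropyS_sub _ ST); apply: le_expect => x qx.
by rewrite lerN2 ler_ln ?posrE ?state_le// (state_gt0_sub ST).
Qed.

Lemma entropyS_ge0 q S : 0 <= entropyS q S.
Proof. by rewrite -(entropyS0 q) entropyS_mono// fsub0set. Qed.

(* The Gibbs inequality for the conditionally independent coupling
   [q (i |` T) * q S / q T]. *)
Lemma entropyS_submod q S T i : (T `<=` S)%fset -> i \notin S ->
  entropyS q (i |` S)%fset - entropyS q S <=
  entropyS q (i |` T)%fset - entropyS q T.
Proof.
move=> TS iS; set V := (i |` S)%fset.
have SV : (S `<=` V)%fset by exact: fsubsetUr.
have iTV : (i |` T `<=` V)%fset by exact: fsetUS.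
have TV := fsubset_trans TS SV.
have Ti : (T `<=` i |` T)%fset by exact: fsubsetUr.
pose g x := q (i |` T)%fset x * q S x / q T x.
have g0 x : 0 <= g x by rewrite divr_ge0 ?mulr_ge0 ?state_ge0.
have qg x : 0 < q V x -> 0 < g x.
  by move=> qx; rewrite divr_gt0 ?mulr_gt0 ?(state_gt0_sub _ qx).
have := expect_gibbs g0 qg.
have -> : expect q V (fun x => ln (g x)) =
  - entropyS q (i |` T)%fset - entropyS q S + entropyS q T.
  rewrite (entropyS_sub _ iTV) (entropyS_sub _ SV) (entropyS_sub _ TV).
  rewrite -!expectN -!expectD; apply: eq_expect => x qx.
  have ? := state_gt0_sub iTV qx; have ? := state_gt0_sub SV qx.
  have ? := state_gt0_sub TV qx.
  by rewrite ln_div ?posrE ?mulr_gt0// lnM ?posrE// !opprK.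
(* [g] has mass at most 1: summing out the site [i] leaves [q S x / q T x * q T x], which is
   [q S x], or 0 where [q T x] vanishes. *)
suff : ln (psum V g) <= 0 by lra.
rewrite ln_le0// (psumU _ SV) -(state_sum1 q S); apply: le_psum => x.
rewrite [leLHS](_ : _ = q S x / q T x * q T x); last first.
  rewrite [X in _ * X](state_marg q x Ti) -psumZl.
  have -> : (V `\` S = (i |` T) `\` T)%fset.
    apply/fsetP => j; rewrite !inE; have [->|ji] := eqVneq j i.
      by rewrite iS (contra (fsubsetP TS i)).
    by rewrite /= !andNb.
  apply: eq_psum => y; rewrite /g.
  rewrite (state_local (S:=S) q (splice_agree S x y)).
  rewrite (state_local (S:=T) q (agree_sub TS (splice_agree S x y))).
  have -> : q (i |` T)%fset (splice S x y) = q (i |` T)%fset (splice T x y).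
    apply: state_local => j; rewrite /splice !inE => /predU1P[->|jT].
      by rewrite (negbTE iS) (negbTE (contra (fsubsetP TS i) iS)).
    by rewrite jT (fsubsetP TS).
  by rewrite -mulrA mulrC.
have := state_ge0 q T x; rewrite le_eqVlt => /predU1P[<-|q0].
  by rewrite mulr0 state_ge0.
by rewrite divfK// gt_eqF.
Qed.

(** Each symbol contributes -t ln t <= 1. The sharper ln of the alphabet size would bring nothing,
    since only a bound linear in the volume matters. *)
Lemma entropyS1 q i : entropyS q [fset i]%fset <= #|A|%:R.
Proof.
rewrite [leRHS](_ : _ = psum [fset i]%fset (fun _ : I -> A => 1)); last first.
  by rewrite psum_const cardfs1 expn1 mulr1.
apply: le_psum => x; have := state_ge0 q [fset i]%fset x.
rewrite le_eqVlt => /predU1P[<-|q0]; first by rewrite mul0r.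
rewrite -lnV ?posrE// -ler_pdivlMl// mulr1.
by apply/ltW/ln_sublinear; rewrite invr_gt0.
Qed.

Lemma entropyS_le q S : entropyS q S <= #|` S|%:R * #|A|%:R.
Proof.
elim/fset1U_rect: S => [|i S iS IH]; first by rewrite entropyS0 cardfs0 mul0r.
rewrite cardfsU1 iS natrD mulrDl mul1r.
have := entropyS_submod q (fsub0set S) iS.
rewrite fsetU0 entropyS0 => h.
have := entropyS1 q i; lra.
Qed.

(** For each [j], this is the Gibbs inequality for [Q j] against the mixture [q], whose total mass
    is 1. *)
Lemma entropyS_concave (J : finType) (c : J -> R) (Q : J -> state) q S :
  (forall j, 0 <= c j) -> (forall x, q S x = \sum_j c j * Q j S x) ->
  \sum_j c j * entropyS (Q j) S <= entropyS q S.
Proof.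
move=> c0 qE.
have -> : entropyS q S = \sum_j c j * expect (Q j) S (fun x => - ln (q S x)).
  rewrite /entropyS /expect; under eq_bigr do rewrite -psumZl.
  rewrite -psum_sum; apply: eq_psum => x; rewrite [in X in X * _]qE mulr_suml.
  by apply: eq_bigr => j _; rewrite mulrA.
apply: ler_sum => j _; have := c0 j.
rewrite le_eqVlt => /predU1P[<-|cj]; first by rewrite !mul0r.
rewrite ler_pM2l//.
have := @expect_gibbs (Q j) S (q S) (state_ge0 q S).
rewrite state_sum1 ln1 expectN; set L := expect _ _ _.
move=> h; suff : L + entropyS (Q j) S <= 0 by lra.
apply: h => x Qx; rewrite qE (bigD1 j)//= ltr_wpDr ?mulr_gt0//.
by rewrite sumr_ge0// => k _; rewrite mulr_ge0// state_ge0.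
Qed.

End States.

(** * Boxes, translations and Shearer's inequality *)

Section Geometry.
Variable d : nat.
Implicit Types (p q : Zd d) (S T B Q : {fset Zd d}).

Lemma in_translate p S i : (i \in translate p S) = (i - p \in S).
Proof.
apply/imfsetP/idP => [[j jS ->]|iS]; first by rewrite addrAC subrr add0r.
by exists (i - p) => //; rewrite addrC subrK.
Qed.

Lemma card_translate p S : #|` translate p S| = #|` S|.
Proof. by rewrite card_imfset//; exact: addrI. Qed.

Lemma translateD p S T : translate p (S `\` T)%fset = (translate p S `\` translate p T)%fset.
Proof. by apply/fsetP => i; rewrite !(in_translate, inE). Qed.

Lemma translate0 S : translate 0 S = S.
Proof. by apply/fsetP => i; rewrite in_translate subr0. Qed.

Lemma translate_translate p q S : translate p (translate q S) = translate (p + q) S.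
Proof. by apply/fsetP => i; rewrite !in_translate opprD addrA. Qed.

Lemma translateS p S T : (S `<=` T)%fset -> (translate p S `<=` translate p T)%fset.
Proof. by move=> /fsubsetP ST; apply/fsubsetP => i; rewrite !in_translate => /ST. Qed.

Lemma card_box n : #|` box d n| = (n.*2.+1 ^ d)%N.
Proof.
rewrite card_imfset/= ?card_ffun ?card_ord// -?cardE ?card_ffun ?card_ord//.
move=> f g /rowP fg; apply/ffunP => i; apply: val_inj.
have := fg i; rewrite !mxE => /addIr; exact: (congr1 absz).
Qed.

Lemma box_gt0 n : (0 < #|` box d n|)%N.
Proof. by rewrite card_box expn_gt0. Qed.

Lemma boxN n p : (- p \in box d n) = (p \in box d n).
Proof. by rewrite !in_box; apply: eq_forallb => i; rewrite mxE normrN. Qed.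

Lemma boxD n m p q : p \in box d n -> q \in box d m -> p + q \in box d (n + m).
Proof.
rewrite !in_box => /forallP pn /forallP qm; apply/forallP => i; rewrite mxE PoszD.
by rewrite (le_trans (ler_normD _ _))// lerD.
Qed.

Lemma boxB n m p q : p \in box d n -> q \in box d m -> p - q \in box d (n + m).
Proof. by move=> pn qm; rewrite boxD// boxN. Qed.

Lemma box_mono n m : (n <= m)%N -> (box d n `<=` box d m)%fset.
Proof.
move=> nm; apply/fsubsetP => p; rewrite !in_box => /forallP pn.
by apply/forallP => i; rewrite (le_trans (pn i)).
Qed.

Lemma box_exists S : exists n, (S `<=` box d n)%fset.
Proof.
elim/fset1U_rect: S => [|p S pS [n Sn]]; first by exists 0%N; rewrite fsub0set.
exists (n + \sum_(i < d) absz (p 0%R i))%N; rewrite fsubUset fsub1set; apply/andP; split.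
  rewrite in_box; apply/forallP => i; rewrite -abszE lez_nat.
  by rewrite (bigD1 i)//= addnCA leq_addr.
by rewrite (fsubset_trans Sn)// box_mono// leq_addr.
Qed.

Lemma card_translate_box_diff p k n : p \in box d k ->
  (#|` (translate p (box d n) `\` box d n)%fset| <= #|` box d (n + k)| - #|` box d n|)%N.
Proof.
move=> pk; have bs : (box d n `<=` box d (n + k))%fset by rewrite box_mono// leq_addr.
rewrite -(cardfsDS bs); apply: fsubset_leq_card; apply: fsetSD.
apply/fsubsetP => i; rewrite in_translate => ip.
by rewrite -(subrK p i) boxD.
Qed.

End Geometry.

Section BoxAsymptotics.
Variables (R : realType) (d : nat).

Lemma cvg_inv_affine (a : R) :
  (fun n => a / (n.*2.+1)%:R : R) @ \oo --> (0 : R).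
Proof.
rewrite -(mulr0 a); apply: cvgMr.
apply: (@squeeze_cvgr _ _ _ _ (fun=> 0) harmonic); last 2 first.
- exact: cvg_cst.
- exact: cvg_harmonic.
near=> n; rewrite invr_ge0 ler0n/= lef_pV2 ?posrE ?ltr0n// ler_nat ltnS.
by rewrite -addnn leq_addr.
Unshelve. all: by end_near. Qed.

Lemma cvg_box_ratio k :
  (fun n => #|` box d (n + k)|%:R / #|` box d n|%:R : R) @ \oo --> (1 : R).
Proof.
have -> : (fun n => #|` box d (n + k)|%:R / #|` box d n|%:R : R) =
    (fun n => (1 + k.*2%:R / (n.*2.+1)%:R) ^+ d).
  apply/funext => n; rewrite !card_box !natrX -expr_div_n; congr (_ ^+ _).
  rewrite doubleD -addSn natrD mulrDl divff// pnatr_eq0//.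
have h : (fun n => 1 + k.*2%:R / (n.*2.+1)%:R : R) @ \oo --> (1 : R).
  have := cvgD (@cvg_cst _ (1 : R) _ \oo _) (cvg_inv_affine k.*2%:R).
  rewrite addr0 => h; exact: h.
by have := cvg_comp _ _ h (@exprn_continuous R d 1); rewrite /= expr1n.
Qed.

Lemma cvg_box_boundary k :
  (fun n => (#|` box d (n + k)| - #|` box d n|)%:R / #|` box d n|%:R : R) @ \oo
    --> (0 : R).
Proof.
have h := cvgB (cvg_box_ratio k) (@cvg_cst _ (1 : R) _ \oo _).
rewrite subrr in h; apply: cvg_trans; last exact: h.
apply: near_eq_cvg; near=> n.
rewrite /= natrB ?fsubset_leq_card ?box_mono ?leq_addr// mulrBl divff//.
by rewrite pnatr_eq0 -lt0n box_gt0.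
Unshelve. all: by end_near. Qed.

End BoxAsymptotics.

Section Shifts.
Variables (R : realType) (d : nat) (A : alphabetType).
Implicit Types (p : Zd d) (S T B Q : {fset Zd d}) (x y : Zd d -> A).

Lemma shift_configD p p' x :
  shift_config p (shift_config p' x) = shift_config (p' + p) x.
Proof. by apply/funext => i; rewrite /shift_config addrA. Qed.

Lemma shift_config0 x : shift_config 0 x = x.
Proof. by apply/funext => i; rewrite /shift_config add0r. Qed.

Lemma shift_configK p x : shift_config (- p) (shift_config p x) = x.
Proof. by rewrite shift_configD subrr shift_config0. Qed.

Lemma shift_configNK p x : shift_config p (shift_config (- p) x) = x.
Proof. by rewrite shift_configD addNr shift_config0. Qed.

Lemma agree_shift p S x y :
  agree S (shift_config p x) (shift_config p y) <-> agree (translate p S) x y.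
Proof.
split=> h i; first by rewrite in_translate => /h; rewrite /shift_config addrC subrK.
by move=> iS; apply: h; rewrite in_translate addrAC subrr add0r.
Qed.

Lemma psum_translate p S (f : (Zd d -> A) -> R) :
  psum (translate p S) f = psum S (fun y => f (shift_config (- p) y)).
Proof.
pose m (w : {ffun S -> A}) : {ffun translate p S -> A} :=
  window (translate p S) (shift_config (- p) (extend w)).
pose m' (w : {ffun translate p S -> A}) := window S (shift_config p (extend w)).
have mK : cancel m m'.
  move=> w; rewrite /m' /m -[RHS]extendK; apply: window_agree => i iS.
  rewrite [LHS]extend_window; first by rewrite /shift_config addKr.
  by rewrite in_translate addrAC subrr add0r.
have m'K : cancel m' m.
  move=> w; rewrite /m' /m -[RHS]extendK; apply: window_agree => i.
  rewrite in_translate => iS.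
  rewrite [LHS]extend_window; last by rewrite addrC.
  by rewrite /shift_config addNKr.
rewrite /psum (reindex m) /=; last by exists m' => w _.
apply: eq_bigr => w _; congr f; apply/funext => i.
have [iS|iS] := boolP (i \in translate p S); first by rewrite extend_window.
rewrite extend_out// /shift_config extend_out//.
by rewrite addrC -in_translate.
Qed.

Section ShiftState.
Variables (p : Zd d) (q : state R (Zd d) A).

(** The law of [shift_config p y] when [y] has law [q]. *)
Definition shift_state_fun S x := q (translate p S) (shift_config (- p) x).

Lemma shift_state_marg S T x : (S `<=` T)%fset ->
  shift_state_fun S x =
  psum (T `\` S)%fset (fun y => shift_state_fun T (splice S x y)).
Proof.
move=> ST; rewrite /shift_state_fun (state_marg _ _ (translateS p ST)).
rewrite -translateD psum_translate; apply: eq_psum => y; congr (q _ _).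
apply/funext => i; rewrite /shift_config /splice in_translate (addrC i).
by [].
Qed.

Definition shift_state : state R (Zd d) A.
Proof.
apply: (@State _ _ _ shift_state_fun _ _ _ shift_state_marg).
- by move=> S x; exact: state_ge0.
- move=> S x y xy; rewrite /shift_state_fun; apply: state_local.
  by apply/agree_shift; rewrite translate_translate addNr translate0.
- move=> x; rewrite /shift_state_fun [translate p _](_ : _ = fset0) ?state0//.
  by apply/fsetP => i; rewrite in_translate !inE.
Defined.

Lemma entropyS_shift S : entropyS shift_state S = entropyS q (translate p S).
Proof. by rewrite [RHS]psum_translate. Qed.

Lemma expect_shift S f :
  expect q (translate p S) f = expect shift_state S (fun x => f (shift_config (- p) x)).
Proof. exact: psum_translate. Qed.

End ShiftState.

Definition sinv (q : state R (Zd d) A) :=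
  forall p S x, q (translate p S) x = q S (shift_config p x).

Lemma sinv_entropyS q p S : sinv q -> entropyS q (translate p S) = entropyS q S.
Proof.
move=> h; rewrite -entropyS_shift; apply: eq_psum => x /=.
by rewrite /shift_state_fun h shift_configNK.
Qed.

Lemma sinv_expect q p S f : sinv q ->
  expect q (translate p S) (fun x => f (shift_config p x)) = expect q S f.
Proof.
move=> h; rewrite expect_shift; apply: eq_psum => x /=.
by rewrite /shift_state_fun h shift_configNK.
Qed.

(* By induction on [S]: a new site [i] raises the left-hand side by [#|B|] times its
   conditional entropy given [S], and each of the [#|B|] terms whose window contains
   [i] by at least that entropy. *)
Lemma shearer (q : state R (Zd d) A) B S Q :
  (forall s b, s \in S -> b \in B -> s - b \in Q) ->
  #|` B|%:R * entropyS q S <=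
  \sum_(p <- Q) entropyS q (S `&` translate p B)%fset.
Proof.
elim/fset1U_rect: S => [_|i S iS IH SBQ].
  by rewrite entropyS0 mulr0 sumr_ge0// => p _; rewrite entropyS_ge0.
have {IH} := IH (fun s b sS => SBQ s b (fset1Ur _ sS)).
set D := entropyS q (i |` S)%fset - entropyS q S.
suff : #|` B|%:R * D <= \sum_(p <- Q) (entropyS q ((i |` S) `&` translate p B)%fset
    - entropyS q (S `&` translate p B)%fset).
  by rewrite sumrB /D mulrBr; lra.
have -> : #|` B|%:R * D = \sum_(p <- Q | i \in translate p B) D.
  rewrite big_const_seq iter_addr addr0 -[RHS]mulr_natl; congr (_%:R * _).
  have <- : #|` [fset i - b | b in B]%fset| = #|` B|.
    by rewrite card_imfset// => b b' /addrI/oppr_inj.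
  rewrite -size_filter.
  have -> : [fset i - b | b in B]%fset = [fset p in Q | i \in translate p B]%fset.
    apply/fsetP => p; rewrite !inE in_translate.
    apply/imfsetP/andP => [[b bB ->]|[pQ iB]].
      by rewrite SBQ ?fset1U1// opprB addrC subrK.
    by exists (i - p); rewrite // opprB addrC subrK.
  apply/perm_size/uniq_perm; rewrite ?filter_uniq ?fset_uniq// => p.
  by rewrite mem_filter !inE andbC.
rewrite big_mkcond; apply: ler_sum => p _; case: ifPn => ip.
  have -> : ((i |` S) `&` translate p B)%fset = (i |` (S `&` translate p B))%fset.
    by apply/fsetP => j; rewrite !inE; case: eqVneq => // ->.
  by apply: entropyS_submod => //; exact: fsubsetIl.
rewrite subr_ge0 entropyS_mono// fsetSI//; exact: fsubsetUr.
Qed.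

(** Serves the finite-volume Gibbs distributions, which are not invariant; hence the sum over
    translates is kept. Windows centred outside [box d N] are charged their largest possible
    entropy. *)
Lemma entropyS_box_le (q : state R (Zd d) A) n N :
  #|` box d n|%:R * entropyS q (box d N) <=
  \sum_(p <- box d N) entropyS q (translate p (box d n)) +
  (#|` box d (N + n)| - #|` box d N|)%:R * (#|` box d n|%:R * #|A|%:R).
Proof.
have bs : (box d N `<=` box d (N + n))%fset by rewrite box_mono// leq_addr.
apply: le_trans (@shearer q (box d n) (box d N) (box d (N + n)) _) _.
  by move=> s b; exact: boxB.
rewrite (big_fsetID _ (fun p => p \in box d N))/=; apply: lerD.
  have -> : [fset x in box d (N + n) | x \in box d N]%fset = box d N.
    by apply/fsetP => p; rewrite !inE/= andb_idl//; exact: (fsubsetP bs).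
  by apply: ler_sum => p _; rewrite entropyS_mono// fsubsetIr.
rewrite -(cardfsDS bs).
have -> : [fset x in box d (N + n) | x \notin box d N]%fset
    = (box d (N + n) `\` box d N)%fset.
  by apply/fsetP => p; rewrite !inE andbC.
rewrite card_fset_sum1 natr_sum mulr_suml; apply: ler_sum => p _.
rewrite mul1r (le_trans (entropyS_le _ _))// ler_wpM2r// ler_nat.
by rewrite -(card_translate p (box d n)) fsubset_leq_card// fsubsetIr.
Qed.

Lemma sinv_shearer q B S Q : sinv q ->
  (forall s b, s \in S -> b \in B -> s - b \in Q) ->
  #|` B|%:R * entropyS q S <= #|` Q|%:R * entropyS q B.
Proof.
move=> hq SBQ; apply: le_trans (shearer q SBQ) _.
rewrite card_fset_sum1 natr_sum mulr_suml; apply: ler_sum => p _.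
by rewrite mul1r -(sinv_entropyS p B hq) entropyS_mono// fsubsetIr.
Qed.

End Shifts.

Lemma mem_bigfsetU (K J : choiceType) (r : seq J) (F : J -> {fset K}) i :
  reflect (exists2 j, j \in r & i \in F j) (i \in \big[fsetU/fset0]_(j <- r) F j).
Proof.
elim: r => [|j r IH]; first by rewrite big_nil inE; constructor => -[].
rewrite big_cons inE; apply: (iffP orP) => [[iF|/IH[k kr iF]]|[k]].
- by exists j; rewrite ?mem_head.
- by exists k; rewrite // inE kr orbT.
- by rewrite inE => /predU1P[->|kr iF]; [left|right; apply/IH; exists k].
Qed.

Lemma card_bigfsetU (K J : choiceType) (r : seq J) (F : J -> {fset K}) :
  (#|` \big[fsetU/fset0]_(j <- r) F j| <= \sum_(j <- r) #|` F j|)%N.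
Proof.
elim: r => [|j r IH]; first by rewrite !big_nil cardfs0.
rewrite !big_cons cardfsU (leq_trans (leq_subr _ _))// leq_add2l.
exact: IH.
Qed.

(** * Folner sequences and the entropy rate *)

Section Folner.
Variables (R : realType) (d : nat).
Implicit Types (p : Zd d) (S B : {fset Zd d}).

Definition boundary p S : nat := #|` (translate p S `\` S)%fset|.

(** Nonemptiness is required separately: division by 0 gives 0, so empty sets would satisfy the
    limit condition. *)
Definition folner (F : nat -> {fset Zd d}) :=
  (\forall n \near \oo, (0 < #|` F n|)%N) /\
  forall p, (fun n => (boundary p (F n))%:R / #|` F n|%:R : R) @ \oo --> (0 : R).

Lemma folner_box : folner (box d).
Proof.
split=> [|p]; first by near=> n; exact: box_gt0.
have [k pk] := box_exists [fset p]%fset.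
rewrite fsub1set in pk.
apply: (@squeeze_cvgr _ _ _ _ (fun=> 0)
  (fun n => (#|` box d (n + k)| - #|` box d n|)%:R / #|` box d n|%:R)).
- near=> n; rewrite divr_ge0//= ler_wpM2r ?invr_ge0// ler_nat.
  exact: card_translate_box_diff.
- exact: cvg_cst.
- exact: cvg_box_boundary.
Unshelve. all: by end_near. Qed.

Lemma folner_sum F (r : seq (Zd d)) : folner F ->
  (fun n => (\sum_(p <- r) boundary p (F n))%:R / #|` F n|%:R : R) @ \oo --> (0 : R).
Proof.
move=> [_ hF]; elim: r => [|p r IH].
  by under eq_fun do rewrite big_nil mul0r; exact: cvg_cst.
under eq_fun do rewrite big_cons natrD mulrDl.
by rewrite -(addr0 0); apply: cvgD.
Qed.

End Folner.

Lemma cvgr_epsP (R : realType) (u : nat -> R) (l : R) :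
  (forall e, 0 < e -> \forall n \near \oo, `|u n - l| <= e) -> u @ \oo --> l.
Proof.
move=> h; apply/cvgrPdist_le => e e0; near=> n; rewrite distrC; near: n.
exact: h.
Unshelve. all: by end_near. Qed.

Section EntropyRate.
Variables (R : realType) (d : nat) (A : alphabetType).
Variables (q : state R (Zd d) A) (hq : sinv q).
Implicit Types (S : {fset Zd d}).

(** The infimum gives the lower bounds at once; Shearer's inequality shows that it is also the
    limit, along boxes and along any Folner sequence. *)
Definition entropy_rate : R :=
  inf [set entropyS q (box d n) / #|` box d n|%:R | n in setT].

Let u n := entropyS q (box d n) / #|` box d n|%:R.

Let has_inf_u : has_inf [set u n | n in setT].
Proof.
split; first by exists (u 0%N), 0%N.
by exists 0 => _ [n _ <-]; rewrite divr_ge0// entropyS_ge0.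
Qed.

Lemma entropy_rate_le_box n : entropy_rate <= u n.
Proof. by apply: inf_lbound; [exact: has_inf_u.2|exists n]. Qed.

(** Shearer with [S] as the window and a large box as the volume: [S] lies in a box of radius [r],
    so only centres in [box d (n + r)] occur, and the ratio of the two box sizes tends to 1. *)
Lemma entropy_rate_le S : #|` S|%:R * entropy_rate <= entropyS q S.
Proof.
have [r Sr] := box_exists S.
rewrite -[leRHS]mul1r; apply: (cvgr_to_ge
  (cvgMl (b := entropyS q S) (@cvg_box_ratio R d r))).

near=> n; rewrite mulrAC ler_pdivlMr ?ltr0n ?box_gt0// -mulrA.
have h : #|` S|%:R * entropyS q (box d n) <= #|` box d (n + r)|%:R * entropyS q S.
  apply: sinv_shearer => // s b sn bS; apply: boxB => //; exact: (fsubsetP Sr).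
apply: le_trans h; rewrite ler_wpM2l// -ler_pdivlMr ?ltr0n ?box_gt0//.
exact: entropy_rate_le_box.
Unshelve. all: by end_near. Qed.

(** The lower bound is [entropy_rate_le]. For the upper bound, Shearer is applied with a box of
    nearly optimal entropy density as the window; the centres needed exceed [F n] by boundary sites
    only. *)
Lemma cvg_entropy_folner F : folner R F ->
  (fun n => entropyS q (F n) / #|` F n|%:R) @ \oo --> entropy_rate.
Proof.
move=> hF; apply: cvgr_epsP => e e0.
have e20 : 0 < e / 2 by rewrite divr_gt0.
have [_ [m _ <-]] := inf_adherent e20 has_inf_u; rewrite -/entropy_rate => hm.
pose r := [seq - b | b <- box d m].
have h0 := folner_sum r hF; have [hF0 _] := hF.
have um0 : 0 <= u m by rewrite divr_ge0// entropyS_ge0.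
(* The excess of centres will be multiplied by [u m]; the [+ 1] keeps the quotient meaningful when
   [u m] is 0. *)
have e1 : 0 < e / 2 / (u m + 1) by rewrite divr_gt0// ltr_wpDl.
near=> n.
have Fn : (0 : R) < #|` F n|%:R by rewrite ltr0n; near: n.
rewrite ler_distl; apply/andP; split.
  rewrite lerBlDr; apply: ler_wpDr; first exact: ltW.
  by rewrite ler_pdivlMr// mulrC entropy_rate_le.
pose Q := (F n `|` \big[fsetU/fset0]_(p <- r) (translate p (F n) `\` F n))%fset.
have : #|` box d m|%:R * entropyS q (F n) <= #|` Q|%:R * entropyS q (box d m).
  apply: sinv_shearer => // s b sF bm; rewrite inE.
  have [//|sbF] := boolP (s - b \in F n).
  apply/mem_bigfsetU; exists (- b); first by apply: map_f.
  by rewrite inE sbF in_translate opprK subrK.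
have Qle : (#|` Q|%:R : R) <= #|` F n|%:R * (1 + e / 2 / (u m + 1)).
  have : #|` Q|%:R <= #|` F n|%:R + (\sum_(p <- r) boundary p (F n))%:R :> R.
    rewrite -natrD ler_nat /Q cardfsU (leq_trans (leq_subr _ _))// leq_add2l.
    exact: card_bigfsetU.
  move=> /le_trans; apply; rewrite mulrDr mulr1 lerD2l mulrC -ler_pdivrMr//.
  rewrite (le_trans (ler_norm _))//.
  rewrite -[X in `|X|]subr0 distrC; near: n.
  by move/cvgrPdist_le : h0; apply.
move=> h; rewrite ler_pdivrMr//.
have : entropyS q (F n) <= #|` Q|%:R * u m.
  by rewrite /u mulrA ler_pdivlMr ?ltr0n ?box_gt0// mulrC.
move=> /le_trans; apply.
apply: le_trans (ler_wpM2r um0 Qle) _.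
rewrite -[leLHS]mulrA [leRHS]mulrC (ler_pM2l Fn) mulrDl mul1r.
have : e / 2 / (u m + 1) * u m <= e / 2.
  by rewrite mulrAC ler_pdivrMr ?ltr_wpDl// ler_wpM2l ?lerDl// ltW.
lra.
Unshelve. all: by end_near. Qed.

End EntropyRate.

(** * From marginals to measures *)

Section Cylinders.
Variables (d : nat) (A : alphabetType).
Implicit Types (x y : config d A) (S : {fset Zd d}).

Local Notation P := (product_space d A).

Definition cyl S x : set (config d A) := [set y | agree S x y].

Lemma cylinderE S x : cylinder (restr x S) = cyl S x.
Proof.
rewrite /cylinder /cyl /restr /=; apply/seteqP; split=> y /=.
  move=> /fmapP yx i iS; have := yx i.
  by rewrite !in_fnd//= !ffunE /= => -[].
move=> xy; apply/fmapP => i; have [iS|iS] := boolP (i \in S).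
  by rewrite !in_fnd//= !ffunE /= xy.
by rewrite !not_fnd.
Qed.

Lemma proj_discrete_open (i : Zd d) (B : set A) :
  open [set y : P | B (y i)].
Proof.
have -> : [set y : P | B (y i)] =
  (@proj _ (fun _ : Zd d => discrete_topology A) i) @^-1` B by [].
apply: open_comp; last exact: discrete_open.
by move=> y _; exact: proj_continuous.
Qed.

Lemma open_cyl S x : open (cyl S x : set P).
Proof.
elim/fset1U_rect: S => [|i S iS IH].
  have -> : (cyl fset0 x : set P) = setT by apply/seteqP; split.
  exact: openT.
have -> : (cyl (i |` S)%fset x : set P) = [set y : P | x i = y i] `&` cyl S x.
  apply/seteqP; split=> [y xy|y [xyi xy] j].
    by split; [apply: xy; rewrite fset1U1|move=> j jS; apply: xy; rewrite fset1Ur].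
  by rewrite !inE => /predU1P[->//|/xy].
by apply: openI => //; exact: (@proj_discrete_open i [set b | x i = b]).
Qed.

(** The filter generated by the cylinders around [x] converges to [x] in every coordinate, hence in
    the product topology. *)
Lemma nbhs_cyl x (O : set P) : nbhs (x : P) O ->
  exists S, cyl S x `<=` O.
Proof.
pose F : set_system P := [set B | exists S, cyl S x `<=` B].
have FF : ProperFilter F.
  apply: Build_ProperFilter_ex; first by move=> B [S SB]; exists x; exact: SB.
  split; first by exists fset0.
  - move=> B C [S SB] [T TC]; exists (S `|` T)%fset => y xy.
    by split; [apply: SB|apply: TC]; apply: agree_sub xy; rewrite ?fsubsetUl ?fsubsetUr.
  - by move=> B C BC [S SB]; exists S; apply: subset_trans BC.
suff : F --> (x : P) by apply.
apply/cvg_sup => i; apply/cvg_image.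
  by rewrite predeqE => a; split=> // _; exists (fun=> a).
move=> B Bx; exists [set y : P | B (y i)].
  exists [fset i]%fset => y xy /=; rewrite -(xy i (fset11 i)).
  exact: nbhs_singleton Bx.
apply/seteqP; split=> [_ [y By <-]//|a Ba].
by exists (fun=> a).
Qed.

Lemma compact_config : compact [set: P].
Proof.
have h : compact [set: discrete_topology A].
  by apply: finite_compact; exact: finite_finset.
have := @tychonoff (Zd d) (fun=> discrete_topology A) (fun=> setT) (fun=> h).
by congr (compact _); apply/seteqP; split.
Qed.

Lemma measurable_cyl S x : measurable (cyl S x).
Proof. by apply: sub_sigma_algebra; exact: open_cyl. Qed.

Definition pattern_config (w : pattern d A) : config d A :=
  fun i => odflt point (fnd w i).

Lemma pattern_config_restr S x : cyl S (pattern_config (restr x S)) = cyl S x.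
Proof.
suff h : agree S (pattern_config (restr x S)) x.
  apply/seteqP; split=> y; first exact: agree_trans (agree_sym h).
  exact: agree_trans.
move=> i iS; rewrite /pattern_config in_fnd//= ffunE //.
Qed.

(* Patterns are countably many, so these enumerate all cylinders; [set0] is a junk
   value for the codes of no pattern. *)
Definition cyl_of (n : nat) : set (config d A) :=
  if (choice.unpickle n : option (pattern d A)) is Some w
  then cyl (domf w) (pattern_config w) else set0.

Lemma cyl_ofE S x : exists n, cyl_of n = cyl S x.
Proof.
by exists (choice.pickle (restr x S)); rewrite /cyl_of choice.pickleK -(pattern_config_restr S x).
Qed.

Lemma measurable_cyl_of n : measurable (cyl_of n).
Proof.
rewrite /cyl_of; case: (choice.unpickle n : option (pattern d A)) => [w|] //.
exact: measurable_cyl.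
Qed.

Lemma open_bigcup_cyl (O : set P) : open O ->
  O = \bigcup_(n in [set n | cyl_of n `<=` O]) cyl_of n.
Proof.
move=> oO; apply/seteqP; split=> [x Ox|x [n nO /nO]//].
have [S SO] : exists S, cyl S x `<=` O by apply: nbhs_cyl; exact: open_nbhs_nbhs.
have [n nS] := cyl_ofE S x; by exists n => /=; rewrite nS.
Qed.

End Cylinders.

Section ClopenAlgebra.
Variables (d : nat) (A : alphabetType).
Implicit Types (S T : {fset Zd d}) (B C : set (Zd d -> A)).

Definition depends_on S B := forall x y, agree S x y -> B x -> B y.

Lemma depends_on_sub S T B : (S `<=` T)%fset -> depends_on S B -> depends_on T B.
Proof. by move=> ST h x y /(agree_sub ST)/h. Qed.

Lemma depends_on_iff S B x y : depends_on S B -> agree S x y -> B x <-> B y.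
Proof. by move=> h xy; split; apply: h => //; exact: agree_sym. Qed.

(** A copy of the configuration space, which carries the algebra of finitely determined sets while
    [config] carries the Borel sigma-algebra. *)
Definition clopen_space := Zd d -> A.

HB.instance Definition _ := Pointed.copy clopen_space (config d A).

Definition clopen_display : measure_display.
Proof. exact: default_measure_display. Qed.

Definition clopen : set (set clopen_space) := [set B | exists S, depends_on S B].

Lemma clopen0 : clopen set0. Proof. by exists fset0. Qed.

Lemma clopenU : setU_closed clopen.
Proof.
move=> B C [S SB] [T TC]; exists (S `|` T)%fset => x y xy [Bx|Cx]; [left|right].
  by apply: SB Bx; apply: agree_sub xy; exact: fsubsetUl.
by apply: TC Cx; apply: agree_sub xy; exact: fsubsetUr.
Qed.

Lemma clopenC : setC_closed clopen.
Proof.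
by move=> B [S SB]; exists S => x y /agree_sym xy nBx By; apply/nBx/(SB y).
Qed.

HB.instance Definition _ := @isAlgebraOfSets.Build clopen_display clopen_space
  clopen clopen0 clopenU clopenC.

Lemma depends_on_open S B : depends_on S B -> open (B : set (product_space d A)).
Proof.
move=> h; rewrite openE => x Bx.
apply: (@filterS _ _ _ (cyl S x)); first by move=> y xy; exact: h Bx.
by apply: open_nbhs_nbhs; split; [exact: open_cyl|exact: agree_refl].
Qed.

(* Compactness: the content on clopen sets is trivially countably additive. *)
Lemma clopen_trivIset_finite (F : nat -> set clopen_space) :
  (forall n, clopen (F n)) -> trivIset setT F -> clopen (\bigcup_n F n) ->
  exists N, forall n, (N <= n)%N -> F n = set0.
Proof.
move=> cF tF [T cT]; apply: contrapT => noN.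
have inf N : exists x, exists2 n, (N <= n)%N & F n x.
  apply: contrapT => h; apply: noN; exists N => n Nn.
  by apply/seteqP; split=> // x Fx; apply: h; exists x, n.
have /choice[x hx] := inf.
(* The points [x N] lie in pieces of index at least [N]. A cluster point [z] belongs to the union,
   whose complement is open, hence to some [F i]; being open, [F i] would meet a piece of larger
   index, against disjointness. *)
have := @compact_config d A (x @ \oo) _ filterT.
move=> [z [_ clz]].
have [i Fiz] : exists i, F i z.
  apply: contrapT => nz.
  have nzU : ~ (\bigcup_n F n) z by move=> [n _ Fn]; apply: nz; exists n.
  have cTC : depends_on T (~` (\bigcup_n F n)).
    by move=> a b /agree_sym ab na Fb; apply/na/(cT b).
  have h : (x @ \oo) (\bigcup_n F n).
    by exists 0%N => // N _ /=; have [n _ Fn] := hx N; exists n.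
  have /(clz _ _ h)[w [[n _ Fn] nw]] : nbhs (z : product_space d A) (~` (\bigcup_n F n)).
    by apply: open_nbhs_nbhs; split=> //; exact: depends_on_open cTC.
  by apply: nw; exists n.
have [S dS] := cF i.
have nF : nbhs (z : product_space d A) (F i).
  by apply: open_nbhs_nbhs; split=> //; exact: depends_on_open dS.
have h : (x @ \oo) (\bigcup_(n in [set n | (i < n)%N]) F n).
  exists i.+1 => // N /= iN; have [n Nn Fn] := hx N; exists n => //=.
  exact: leq_trans Nn.
have [w [[n /= ni Fnw] Fiw]] := clz _ _ h nF.
have ni' : n = i by apply: tF => //; exists w.
by rewrite ni' ltnn in ni.
Qed.

End ClopenAlgebra.

Section Extension.
Variables (R : realType) (d : nat) (A : alphabetType).
Variable q : state R (Zd d) A.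
Implicit Types (S T : {fset Zd d}) (B : set (clopen_space d A)).

Definition indic01 B (x : Zd d -> A) : R := (`[< B x >])%:R.

Lemma localf_indic S B : depends_on S B -> localf S (indic01 B).
Proof.
move=> h x y xy; rewrite /indic01; congr (_%:R); congr nat_of_bool.
by apply: asbool_equiv_eq; exact: depends_on_iff h xy.
Qed.

(** The window is picked by choice; consistency of the marginals makes the value independent of it.
    Sets determined by no finite window get a junk 0. *)
Definition clopen_content B : \bar R :=
  (if pselect (exists S, depends_on S B) is left h then
     expect q (projT1 (cid h)) (indic01 B) else 0)%:E.

Lemma clopen_contentE S B : depends_on S B ->
  clopen_content B = (expect q S (indic01 B))%:E.
Proof.
move=> SB; rewrite /clopen_content; case: pselect => [h|]; last by case; exists S.
case: cid => T TB /=; congr EFin.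
rewrite -(expect_sub q (fsubsetUl S T))//; last exact: localf_indic.
by rewrite -(expect_sub q (fsubsetUr S T))//; exact: localf_indic.
Qed.

Lemma clopen_content0 : clopen_content set0 = 0%E.
Proof.
rewrite (@clopen_contentE fset0)//; congr EFin.
rewrite -[RHS](expect_cst q fset0); apply: eq_psum => x.
by rewrite /indic01 asboolF.
Qed.

Lemma clopen_content_ge0 B : (0 <= clopen_content B)%E.
Proof.
rewrite lee_fin; case: pselect => // h; apply: psum_ge0 => x.
by rewrite mulr_ge0// state_ge0.
Qed.

Lemma clopen_content_sigma_additive : semi_sigma_additive clopen_content.
Proof.
move=> F cF tF cU; have [N FN] := clopen_trivIset_finite cF tF cU.
have [T TU] := cU; have /choice[S SF] := cF.
apply: cvg_near_cst; exists N => // n /= Nn.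
pose V := (T `|` \big[fsetU/fset0]_(i <- iota 0 n) S i)%fset.
have SV i : (i < n)%N -> (S i `<=` V)%fset.
  move=> iN; apply/fsubsetP => j jS; rewrite inE; apply/orP; right.
  by apply/mem_bigfsetU; exists i; rewrite // mem_iota.
rewrite (@clopen_contentE V); last exact: depends_on_sub (fsubsetUl T _) TU.
rewrite big_mkord (eq_bigr (fun i : 'I_n => (expect q V (indic01 (F i)))%:E)).
  rewrite sumEFin -expect_sum; congr EFin; apply: eq_psum => x; congr (_ * _).
  rewrite /indic01; case: asboolP => [[i _ Fix]|nF].
    have iN : (i < n)%N.
      by rewrite ltnNge; apply/negP => ni; move: Fix; rewrite FN// (leq_trans Nn).
    rewrite (bigD1 (Ordinal iN))//= asboolT// big1 ?addr0// => j ji.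
    rewrite asboolF// => Fjx; move/eqP: ji; apply; apply: val_inj => /=.
    by apply: tF => //; exists x.
  by rewrite big1// => j _; rewrite asboolF// => Fj; apply: nF; exists j.
move=> i _; apply: clopen_contentE; apply: depends_on_sub (SF i).
exact: SV.
Qed.

HB.instance Definition _ := isMeasure.Build _ _ _ clopen_content
  clopen_content0 clopen_content_ge0 clopen_content_sigma_additive.

Definition state_measure (B : set (config d A)) : \bar R :=
  measure_extension clopen_content B.

(** An open set is a union of countably many cylinders, so the Caratheodory extension, defined on
    the sigma-algebra generated by the clopen sets, covers all Borel sets. *)
Lemma sub_measurable_config (B : set (config d A)) : measurable B ->
  measurable (B : set (g_sigma_algebraType (@measurable _ (clopen_space d A)))).
Proof.
apply: smallest_sub; first exact: smallest_sigma_algebra.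
move=> O oO; rewrite (open_bigcup_cyl oO).
apply: bigcup_measurable => n _; apply: sub_sigma_algebra.
rewrite /cyl_of; case: choice.unpickle => [w|]; last exact: clopen0.
by exists (domf w) => x y xy; move/agree_trans; apply.
Qed.

Lemma state_measure0 : state_measure set0 = 0%E.
Proof. exact: measure0. Qed.

Lemma state_measure_ge0 B : (0 <= state_measure B)%E.
Proof. exact: measure_ge0. Qed.

Lemma state_measure_sigma_additive : semi_sigma_additive state_measure.
Proof.
move=> F mF tF mU; apply: measure_semi_sigma_additive => //.
  by move=> i; exact: sub_measurable_config.
exact: sub_measurable_config.
Qed.

HB.instance Definition _ := isMeasure.Build _ _ _ state_measure
  state_measure0 state_measure_ge0 state_measure_sigma_additive.

Lemma state_measure_cyl S x : state_measure (cyl S x) = (q S x)%:E.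
Proof.
have dS : depends_on S (cyl S x) by move=> y z yz; move/agree_trans; apply.
rewrite /state_measure /measure_extension measurable_mu_extE; last by exists S.
rewrite /= (clopen_contentE dS); congr EFin.
rewrite -[RHS](psum_indic x (state_local q (S:=S))); apply: eq_psum => y.
rewrite mulrC; congr (_%:R * _); congr nat_of_bool.
by apply/asboolP/agreeP.
Qed.

Lemma state_measureT : state_measure setT = 1%E.
Proof.
have -> : setT = cyl fset0 (fun=> point) :> set (config d A).
  by apply/seteqP; split.
by rewrite state_measure_cyl state0.
Qed.

HB.instance Definition _ := Measure_isProbability.Build _ _ _ state_measure
  state_measureT.

Definition state_prob : probability (config d A) R := state_measure.

Lemma state_prob_pattern S x : mu_pattern state_prob (restr x S) = q S x.
Proof. by rewrite /mu_pattern cylinderE /= state_measure_cyl. Qed.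

End Extension.

Lemma measure_bigcup_finType d (T : measurableType d) (R : realType)
    (mu : {measure set T -> \bar R}) (W : finType) (F : W -> set T) :
  (forall w, measurable (F w)) -> trivIset setT F ->
  mu (\bigcup_w F w) = (\sum_w mu (F w))%E.
Proof.
move=> mF tF; rewrite measure_fin_bigcup//; last exact: finite_finset.
rewrite (@fsbigE _ _ _ W setT (index_enum W))//; last 2 first.
- exact: index_enum_uniq.
- by move=> w _; rewrite mem_index_enum.
by apply: eq_bigl => w; rewrite in_setT.
Qed.

(** * Point masses, mixtures and ultrafilter limits of states *)

Section StateConstructions.
Variables (R : realType) (I : choiceType) (A : alphabetType).
Implicit Types (S T : {fset I}) (x y z : I -> A).

Lemma agreeb_splice S T x y z : (S `<=` T)%fset ->
  agreeb T (splice S x y) z = agreeb S x z && agreeb (T `\` S)%fset z y.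
Proof.
move=> ST; apply/agreeP/andP => [h|[/agreeP xz /agreeP zy] i iT].
  split; apply/agreeP => i; first by move=> iS; rewrite -h ?(fsubsetP ST)// /splice iS.
  by rewrite inE => /andP[iS iT]; rewrite -h// /splice (negbTE iS).
rewrite /splice; case: ifPn => [/xz//|iS].
by rewrite -zy// inE iS.
Qed.

Section Dirac.
Variable z : I -> A.

Definition dirac_fun S x : R := (agreeb S x z)%:R.

Lemma dirac_fun_ge0 S x : 0 <= dirac_fun S x. Proof. by []. Qed.

Lemma dirac_fun_local S : localf S (dirac_fun S).
Proof.
move=> x y xy; congr (_%:R); congr nat_of_bool; apply/agreeP/agreeP => h.
  exact: agree_trans (agree_sym xy) h.
exact: agree_trans xy h.
Qed.

Lemma dirac_fun0 x : dirac_fun fset0 x = 1.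
Proof. by rewrite /dirac_fun (_ : agreeb _ _ _)//; apply/agreeP. Qed.

Lemma dirac_fun_marg S T x : (S `<=` T)%fset ->
  dirac_fun S x = psum (T `\` S)%fset (fun y => dirac_fun T (splice S x y)).
Proof.
move=> ST; rewrite -[LHS](@psum_indic _ _ R (T `\` S)%fset z (fun=> dirac_fun S x))//.
apply: eq_psum => y; rewrite /dirac_fun agreeb_splice//.
by case: agreeb; case: agreeb; rewrite ?mulr0 ?mulr1.
Qed.

Definition dirac_state : state R I A :=
  State dirac_fun_ge0 dirac_fun_local dirac_fun0 dirac_fun_marg.

End Dirac.

Section Combination.
Variables (J : finType) (c : J -> R) (Q : J -> state R I A).
Hypotheses (c0 : forall j, 0 <= c j) (c1 : \sum_j c j = 1).

Definition comb_fun S x : R := \sum_j c j * Q j S x.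

Lemma comb_fun_ge0 S x : 0 <= comb_fun S x.
Proof. by apply: sumr_ge0 => j _; rewrite mulr_ge0// state_ge0. Qed.

Lemma comb_fun_local S : localf S (comb_fun S).
Proof.
by move=> x y xy; apply: eq_bigr => j _; rewrite (state_local (Q j) xy).
Qed.

Lemma comb_fun0 x : comb_fun fset0 x = 1.
Proof. by rewrite -c1; apply: eq_bigr => j _; rewrite state0 mulr1. Qed.

Lemma comb_fun_marg S T x : (S `<=` T)%fset ->
  comb_fun S x = psum (T `\` S)%fset (fun y => comb_fun T (splice S x y)).
Proof.
move=> ST; rewrite psum_sum; apply: eq_bigr => j _.
by rewrite (state_marg _ _ ST) -psumZl.
Qed.

Definition comb_state : state R I A :=
  State comb_fun_ge0 comb_fun_local comb_fun0 comb_fun_marg.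

Lemma expect_comb S f : expect comb_state S f = \sum_j c j * expect (Q j) S f.
Proof.
under eq_bigr do rewrite -psumZl.
rewrite -psum_sum; apply: eq_psum => x /=.
by rewrite mulr_suml; apply: eq_bigr => j _; rewrite mulrA.
Qed.

End Combination.

Section Limit.
Variables (G : set_system nat) (GF : UltraFilter G) (Q : nat -> state R I A).

(** By compactness of [0, 1] there is a cluster point, and along an ultrafilter a cluster point is a
    limit. No diagonal extraction over the cylinders is needed. *)
Lemma is_cvg_state S x : cvg (Q n S x @[n --> G]).
Proof.
have : (Q n S x @[n --> G]) `[0, 1]%classic.
  by apply: nearW => n; rewrite /= in_itv/= state_ge0 state_le1.
move=> /(@segment_compact R 0 1 _ _)[p [_ clp]]; apply/cvg_ex; exists p => B pB.
have [//|nB] := in_ultra_setVsetC ((fun n => Q n S x) @^-1` B) GF.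
by have [r []] := clp (~` B) B nB pB.
Qed.

Definition lim_fun S x : R := lim (Q n S x @[n --> G]).

Lemma lim_fun_ge0 S x : 0 <= lim_fun S x.
Proof.
apply: limr_ge; first exact: is_cvg_state.
by apply: nearW => n; exact: state_ge0.
Qed.

Lemma lim_fun_local S : localf S (lim_fun S).
Proof.
move=> x y xy; rewrite /lim_fun.
have -> // : (fun n => Q n S x) = (fun n => Q n S y).
by apply/funext => n; exact: state_local.
Qed.

Lemma lim_fun0 x : lim_fun fset0 x = 1.
Proof.
rewrite /lim_fun; under eq_fun do rewrite state0.
by apply/cvg_lim => //; exact: cvg_cst.
Qed.

Lemma cvg_psum_state S T f (g : (I -> A) -> I -> A) :
  psum S (fun y => Q n T (g y) * f y) @[n --> G] -->
  psum S (fun y => lim_fun T (g y) * f y).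
Proof.
apply: cvg_big => [|w _]; last by apply: cvgMl; exact: is_cvg_state.
by move=> ?; exact: add_continuous.
Qed.

Lemma lim_fun_marg S T x : (S `<=` T)%fset ->
  lim_fun S x = psum (T `\` S)%fset (fun y => lim_fun T (splice S x y)).
Proof.
move=> ST; apply/cvg_lim => //.
have := @cvg_psum_state (T `\` S)%fset T (fun=> 1) (splice S x).
under [X in _ --> X -> _]eq_psum do rewrite mulr1.
apply: cvg_trans; apply: near_eq_cvg; apply: nearW => n.
by rewrite (state_marg _ _ ST); apply: eq_psum => y; rewrite mulr1.
Qed.

Definition lim_state : state R I A :=
  State lim_fun_ge0 lim_fun_local lim_fun0 lim_fun_marg.

Lemma cvg_lim_state S x : Q n S x @[n --> G] --> lim_state S x.
Proof. exact: is_cvg_state. Qed.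

Lemma cvg_expect_lim S f : expect (Q n) S f @[n --> G] --> expect lim_state S f.
Proof. exact: cvg_psum_state. Qed.

End Limit.
End StateConstructions.

Section FullMeasure.
Local Open Scope ereal_scope.
Context d (T : measurableType d) (R : realType).
Variables (mu : {measure set T -> \bar R}) (D : set T).
Hypotheses (mD : measurable D) (D0 : mu (~` D) = 0).

Import HBNNSimple.

(* [f] is arbitrary: information is only known to be measurable on the support. *)
Lemma ge0_integral_full (f : T -> \bar R) : (forall x, 0 <= f x) ->
  \int[mu]_x f x = \int[mu]_(x in D) f x.
Proof.
move=> f0; have fD0 x : 0 <= (f \_ D) x by rewrite patchE; case: ifP.
rewrite [RHS]integral_mkcond !ge0_integralTE//; apply/eqP.
rewrite eq_le; apply/andP; split; last first.
  apply: le_ereal_sup => _ [h hf <-]; exists h => // x.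
  by apply: le_trans (hf x) _; rewrite patchE; case: ifP.
apply: ge_ereal_sup => _ [h hf <-]; apply: ereal_sup_ubound.
(* A simple function below [f] is cut down to [D]: it stays simple and loses no integral, since the
   complement of [D] is null. *)
exists (proj_nnsfun h mD).
  by move=> x; rewrite -mrestrict !patchE; case: ifPn.
have -> : sintegral mu h = \int[mu]_x (h x)%:E.
  by rewrite integral_nnsfun// patch_setT.
rewrite (ge0_negligible_integral (measurableC mD) measurableT)//=.
  by rewrite setTD setCK integral_nnsfun// mrestrict.
  by apply/measurable_EFinP; exact: measurable_funP.
by move=> x _; rewrite lee_fin; exact: fun_ge0.
Qed.

Lemma integral_full (f : T -> \bar R) :
  \int[mu]_x f x = \int[mu]_(x in D) f x.
Proof. by rewrite integralE [RHS]integralE !ge0_integral_full. Qed.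

End FullMeasure.

Lemma fine_measureT (R : realType) d (T : measurableType d)
  (mu : probability T R) B : measurable B -> (fine (mu B))%:E = mu B.
Proof. by move=> mB; rewrite fineK// fin_num_measure. Qed.

(** * Marginals and supports of probability measures *)

Section MeasureState.
Variables (R : realType) (d : nat) (A : alphabetType).
Variable mu : probability (config d A) R.
Implicit Types (S T : {fset Zd d}) (x y : config d A).

Definition measure_fun S x : R := mu_pattern mu (restr x S).

Lemma measure_funE S x : (measure_fun S x)%:E = mu (cyl S x).
Proof.
rewrite /measure_fun /mu_pattern cylinderE fine_measureT//.
exact: measurable_cyl.
Qed.

Lemma measure_fun_ge0 S x : 0 <= measure_fun S x.
Proof. by rewrite -lee_fin measure_funE. Qed.

Lemma cyl_local S x y : agree S x y -> cyl S x = cyl S y.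
Proof.
move=> xy; apply/seteqP; split => z; first exact: agree_trans (agree_sym xy).
exact: agree_trans xy.
Qed.

Lemma measure_fun_local S : localf S (measure_fun S).
Proof. by move=> x y xy; apply: EFin_inj; rewrite !measure_funE (cyl_local xy). Qed.

Lemma measure_fun0 x : measure_fun fset0 x = 1.
Proof.
apply: EFin_inj; rewrite measure_funE (_ : cyl _ _ = setT) ?probability_setT//.
by apply/seteqP; split.
Qed.

Lemma trivIset_cyl S : trivIset [set: {ffun S -> A}]
  (fun w => cyl S (extend w : config d A)).
Proof.
move=> v w _ _ [x [xv xw]]; rewrite -(extendK v) -(extendK w).
exact: window_agree (agree_trans xv (agree_sym xw)).
Qed.

Lemma measure_fun_marg S T x : (S `<=` T)%fset ->
  measure_fun S x = psum (T `\` S)%fset (fun y => measure_fun T (splice S x y)).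
Proof.
move=> ST; apply: EFin_inj; rewrite measure_funE /psum -sumEFin.
under eq_bigr do rewrite measure_funE.
rewrite -measure_bigcup_finType; first congr (mu _).
- apply/seteqP; split=> [y xy|y [w _] /= h i iS].
    exists (window (T `\` S)%fset y) => // i iT; rewrite /splice.
    case: ifPn => iS; first exact: xy.
    by rewrite extend_window// inE iS.
  by rewrite -h ?(fsubsetP ST)// /splice iS.
- by move=> w; exact: measurable_cyl.
- move=> v w _ _ [y [yv yw]]; apply: (@trivIset_cyl (T `\` S)%fset) => //.
  exists y; split=> i /[dup] iTS; rewrite inE => /andP[iS iT].
    by have := yv i iT; rewrite /splice (negbTE iS).
  by have := yw i iT; rewrite /splice (negbTE iS).
Qed.

Definition measure_state : state R (Zd d) A :=
  State measure_fun_ge0 measure_fun_local measure_fun0 measure_fun_marg.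

Lemma measure_state_cyl S x : (measure_state S x)%:E = mu (cyl S x).
Proof. exact: measure_funE. Qed.

Let piece S (f : config d A -> R) (w : {ffun S -> A}) x : R :=
  f (extend w) * \1_(cyl S (extend w : config d A)) x.

Let local_pieces S (f : config d A -> R) : localf S f ->
  (fun x => (f x)%:E) = (fun x => \sum_(w : {ffun S -> A}) (piece f w x)%:E)%E.
Proof.
move=> lf; apply/funext => x; rewrite sumEFin; congr EFin.
rewrite (bigD1 (window S x))//= big1 ?addr0 => [|w wx].
  rewrite /piece indicE mem_set ?mulr1; first exact/lf/agree_sym/extend_window.
  exact: extend_window.
rewrite /piece indicE memNset ?mulr0// => h; move/eqP: wx; apply.
by rewrite -(extendK w); exact: window_agree h.
Qed.

Let integrable_piece S f (w : {ffun S -> A}) :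
  mu.-integrable setT (fun x => (piece f w x)%:E).
Proof.
have -> : (fun x => (piece f w x)%:E) = (fun x => (f (extend w))%:E *
    (\1_(cyl S (extend w : config d A)) x)%:E)%E by apply/funext.
by apply: integrableZl => //; apply: integrable_indic; exact: measurable_cyl.
Qed.

Lemma integrable_local S (f : config d A -> R) : localf S f ->
  mu.-integrable setT (fun x => (f x)%:E).
Proof.
by move=> lf; rewrite (local_pieces lf); apply: integrable_sum.
Qed.

Lemma integral_local S (f : config d A -> R) : localf S f ->
  (\int[mu]_x (f x)%:E = (expect measure_state S f)%:E)%E.
Proof.
move=> lf; rewrite (local_pieces lf) integral_sum// /expect /psum -sumEFin.
apply: eq_bigr => w _; rewrite mulrC EFinM measure_funE /piece.
under eq_integral do rewrite EFinM.
rewrite integralZl//; last by apply: integrable_indic; exact: measurable_cyl.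
by rewrite integral_indic ?setIT//; exact: measurable_cyl.
Qed.

End MeasureState.

Section Supports.
Variables (R : realType) (d : nat) (A : alphabetType).
Implicit Types (mu : probability (config d A) R).
Implicit Types (S T : {fset Zd d}) (x y : config d A).

(** Two cylinders with a common point meet in the cylinder around that point; with the empty set,
    cylinders thus form a pi-system, and it generates the Borel sets. *)
Lemma probability_cyl_unique (m1 m2 : probability (config d A) R) :
  (forall S x, m1 (cyl S x) = m2 (cyl S x)) ->
  forall B, measurable B -> m1 B = m2 B.
Proof.
move=> h; pose G : set (set (config d A)) :=
  [set B | B = set0 \/ exists S x, B = cyl S x].
apply: (@measure_unique _ _ _ G (fun=> setT)).
- apply/seteqP; split; last first.
    apply: smallest_sub; first exact: (@sigma_algebra_measurable _ (config d A)).
    by move=> _ [->//|[S [x ->]]]; exact: measurable_cyl.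
  apply: smallest_sub; first exact: smallest_sigma_algebra.
  move=> O oO; suff : measurable (O : set (g_sigma_algebraType G)) by [].
  rewrite (open_bigcup_cyl oO); apply: bigcup_measurable => n _.
  apply: sub_sigma_algebra; rewrite /cyl_of.
  case: choice.unpickle => [w|]; [right|by left].
  by exists (domf w), (pattern_config w).
- move=> B C [->|[S [x ->]]]; first by left; rewrite set0I.
  move=> [->|[T [y ->]]]; first by left; rewrite setI0.
  have [[z [xz yz]]|n] := pselect (exists z, cyl S x z /\ cyl T y z); last first.
    by left; apply/seteqP; split=> // z [xz yz]; apply: n; exists z.
  right; exists (S `|` T)%fset, z; apply/seteqP; split=> [w [xw yw] i|w zw].
    by rewrite inE => /orP[iS|iT]; [rewrite -xz// xw|rewrite -yz// yw].
  split=> i iS; first by rewrite xz// zw// inE iS.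
  by rewrite yz// zw// inE iS orbT.
- move=> _; right; exists fset0, (fun=> point).
  by apply/seteqP; split.
- by apply/seteqP; split=> // x _; exists 0%N.
- by move=> _ [->|[S [x ->]]]; [rewrite !measure0|exact: h].
- by move=> _ /=; rewrite probability_setT ltry.
Qed.

Lemma shift_preimage_cyl (p : Zd d) S x :
  shift_config p @^-1` cyl S (shift_config p x) = cyl (translate p S) x.
Proof. by apply/seteqP; split=> y; rewrite /cyl /= agree_shift. Qed.

Lemma measurable_shift (p : Zd d) : measurable_fun setT (@shift_config d A p).
Proof.
apply: (@measurability _ _ _ _ setT (@shift_config d A p) (@open (product_space d A))) => //.
move=> _ [B oB <-]; rewrite setTI (open_bigcup_cyl oB) preimage_bigcup.
apply: bigcup_measurable => n _; rewrite /cyl_of.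
case: choice.unpickle => [w|]; last by rewrite preimage_set0.
rewrite -(shift_configNK p (pattern_config w)) shift_preimage_cyl.
exact: measurable_cyl.
Qed.

Lemma measure_state_sinv mu : shift_invariant mu -> sinv (measure_state mu).
Proof.
move=> h p S x; apply: EFin_inj; rewrite !measure_state_cyl.
rewrite -(shift_preimage_cyl p S x); apply/h; exact: measurable_cyl.
Qed.

Lemma state_prob_state (q : state R (Zd d) A) S x :
  measure_state (state_prob q) S x = q S x.
Proof. exact: state_prob_pattern. Qed.

(** The image of [mu] under the shift agrees with [mu] on cylinders. *)
Lemma sinv_shift_invariant mu : sinv (measure_state mu) -> shift_invariant mu.
Proof.
move=> h p B mB.
pose f : {mfun config d A >-> config d A} := mfun_Sub (mem_set (measurable_shift p)).
pose m2 : probability (config d A) R := distribution mu f.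
apply: (@probability_cyl_unique m2 mu) => // S x.
transitivity (mu (shift_config p @^-1` cyl S x)) => //.
rewrite -(shift_configNK p x) shift_preimage_cyl -!measure_state_cyl h.
by [].
Qed.

Lemma msupportE mu x : msupport mu x <-> forall S, 0 < measure_state mu S x.
Proof. by []. Qed.

(** A countable union of null cylinders: this yields both the measurability of the support and the
    nullity of its complement. *)
Lemma msupport_setC mu : ~` msupport mu =
  \bigcup_(n in [set n | mu (@cyl_of d A n) = 0%E]) @cyl_of d A n.
Proof.
apply/seteqP; split=> [x nx|x [n /= n0 nx] sx].
  have [S S0] : exists S, measure_state mu S x = 0.
    apply: contrapT => h; apply: nx => S.
    rewrite lt_def; apply/andP; split; last exact: (state_ge0 (measure_state mu)).
    by apply/eqP => S0; apply: h; exists S.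
  have [n nS] := @cyl_ofE d A S x; exists n; rewrite /= nS//.
  by rewrite -measure_state_cyl S0.
move: nx n0; rewrite /cyl_of; case: choice.unpickle => [w wx|//].
rewrite (cyl_local wx) -measure_state_cyl => -[] e.
have : 0 < measure_state mu (domf w) x := sx (domf w).
by rewrite /= e ltxx.
Qed.

Lemma measurable_msupport mu : measurable (msupport mu).
Proof.
rewrite -(setCK (msupport mu)) msupport_setC; apply: measurableC.
by apply: bigcup_measurable => n _; exact: measurable_cyl_of.
Qed.

Lemma msupportC0 mu : mu (~` msupport mu) = 0%E.
Proof.
apply: measure_negligible.
  by apply: measurableC; exact: measurable_msupport.
rewrite msupport_setC bigcup_mkcond; apply: negligible_bigcup => n.
case: ifPn => [|_]; last exact: negligible_set0.
rewrite inE /= => n0; apply/negligibleP => //; exact: measurable_cyl_of.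
Qed.

(** Otherwise the cylinder would lie in the null complement of the support. This is the bridge from
    patterns of positive probability to points of the support. *)
Lemma msupport_cyl mu S x : 0 < measure_state mu S x ->
  exists2 y, msupport mu y & agree S x y.
Proof.
move=> q0; apply: contrapT => h.
have : (mu (cyl S x) <= mu (~` msupport mu))%E.
  apply: le_measure; rewrite ?inE; [exact: measurable_cyl| |].
    by apply: measurableC; exact: measurable_msupport.
  by move=> y xy sy; apply: h; exists y.
by rewrite msupportC0 -measure_state_cyl lee_fin leNgt q0.
Qed.

Lemma msupport_nonempty mu : exists x, msupport mu x.
Proof.
have [|x sx _] := @msupport_cyl mu fset0 (fun=> point); last by exists x.
by rewrite state0.
Qed.

Lemma msupport_shift mu p x : shift_invariant mu -> msupport mu x ->
  msupport mu (shift_config p x).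
Proof.
by move=> /measure_state_sinv h sx; apply/msupportE => S; rewrite -h; exact: sx.
Qed.

Lemma entropyE mu : shift_invariant mu -> entropy mu = entropy_rate (measure_state mu).
Proof.
move=> /measure_state_sinv h; rewrite /entropy.
have -> : (fun n => - (#|` box d n|%:R)^-1 * \sum_(w : {ffun box d n -> A})
      mu_pattern mu (FinMap w) * ln (mu_pattern mu (FinMap w))) =
    (fun n => entropyS (measure_state mu) (box d n) / #|` box d n|%:R : R).
  apply/funext => n; rewrite mulNr -mulrN -sumrN mulrC; congr (_ / _).
  apply: eq_bigr => w _; rewrite -mulrN.
  have -> // : FinMap w = restr (extend w : config d A) (box d n).
  apply/fmapP => i; have [iS|iS] := boolP (i \in box d n).
    by rewrite !in_fnd//= ffunE /= extendE.
  by rewrite !not_fnd.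
by apply/cvg_lim => //; apply: cvg_entropy_folner => //; exact: folner_box.
Qed.

End Supports.

(** * Energy and the variational principle *)

Section Edges.
Variable d : nat.
Implicit Types (p q : Zd d) (S e : {fset Zd d}) (i j : 'I_d).

Definition edge p i : {fset Zd d} := [fset p; (p + basis i)%R]%fset.

Lemma basisE i j : (basis i : Zd d) 0 j = (i == j)%:R.
Proof. by rewrite /basis mxE eqxx /= eq_sym. Qed.

Lemma basis_inj : injective (@basis d).
Proof.
by move=> i j /rowP/(_ i); rewrite !basisE eqxx; case: eqVneq.
Qed.

Lemma adjacent_basis p i : adjacent p (p + basis i).
Proof.
rewrite /adjacent (bigD1 i)//= big1 => [|j ji].
  by rewrite mxE basisE eqxx opprD addrA subrr add0r normrN normr1.
by rewrite mxE basisE eq_sym (negbTE ji) addr0 subrr normr0.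
Qed.

Lemma adjacentP p q : adjacent p q -> exists i, q = p + basis i \/ p = q + basis i.
Proof.
move=> /eqP s1; have [i ni] : exists i, p 0 i != q 0 i.
  apply/existsP; apply: contra_eqT s1 => /existsPn h.
  rewrite big1// => i _; have := h i; rewrite negbK => /eqP ->.
  by rewrite subrr normr0.
exists i; move: s1; rewrite (bigD1 i)//=; set r := \sum_(_ | _) _ => s1.
have r0 : 0 <= r by apply: sumr_ge0.
have a1 : 1 <= `|p 0 i - q 0 i| by rewrite -gtz0_ge1 normr_gt0 subr_eq0.
have rE : r = 0 by lia.
have aE : `|p 0 i - q 0 i| = 1 by lia.
have eqj j : j != i -> p 0 j = q 0 j.
  move=> ji; apply/eqP; rewrite -subr_eq0 -normr_eq0.
  by move/psumr_eq0P : rE => -> //.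
have [pq|pq] : q 0 i - p 0 i = 1 \/ p 0 i - q 0 i = 1 by lia.
  left; apply/rowP => j; rewrite mxE basisE; case: eqVneq => [<-|ij].
    by rewrite -pq addrC subrK.
  by rewrite addr0 eqj// eq_sym.
right; apply/rowP => j; rewrite mxE basisE; case: eqVneq => [<-|ij].
  by rewrite -pq addrC subrK.
by rewrite addr0 eqj// eq_sym.
Qed.

Lemma is_vertex1 p : is_vertex [fset p]%fset.
Proof. by apply/existsP; exists [` fset11 p]%fset. Qed.

Lemma is_edgeP e : reflect (exists p i, e = edge p i) (is_edge e).
Proof.
apply: (iffP idP) => [/existsP[p /existsP[q /andP[/adjacentP[i pq] /eqP ->]]]|].
  by case: pq => ->; [exists (val p), i|exists (val q), i; rewrite /edge fsetUC].
move=> [p [i ->]].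
have pe : p \in edge p i by rewrite !inE eqxx.
have qe : p + basis i \in edge p i by rewrite !inE eqxx orbT.
apply/existsP; exists [` pe]%fset; apply/existsP; exists [` qe]%fset => /=.
by rewrite adjacent_basis eqxx.
Qed.

(** An edge determines its lower endpoint and its direction, so a sum over edges becomes a sum over
    such pairs without double counting. *)
Lemma edge_inj p q i j : edge p i = edge q j -> p = q /\ i = j.
Proof.
move=> /fsetP e; have pq : p = q.
  have := e p; rewrite !inE eqxx /= => /esym/orP[/eqP//|/eqP pE].
  have := e q; rewrite !inE eqxx /= => /orP[/eqP//|/eqP qE].
  move: pE; rewrite qE -addrA => /rowP/(_ i); rewrite !mxE !eqxx /=.
  by case: eqVneq => _; lia.
split=> //; subst q; have := e (p + basis i); rewrite !inE eqxx orbT.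
have n0 : p + basis i != p.
  rewrite -subr_eq0 addrAC subrr add0r.
  by apply/eqP => /rowP/(_ i); rewrite basisE eqxx mxE.
by rewrite (negbTE n0) /= => /esym/eqP/addrI/basis_inj.
Qed.

Lemma edge_sub p i S : (edge p i `<=` S)%fset = (p \in S) && (p + basis i \in S).
Proof. by rewrite fsubUset !fsub1set. Qed.

Lemma translate_edge p i : translate p (edge 0 i) = edge p i.
Proof.
apply/fsetP => q; rewrite in_translate !inE subr_eq add0r; congr (_ || _).
by rewrite add0r subr_eq addrC.
Qed.

Lemma big_edges (V : Type) (idx : V) (op : Monoid.com_law idx) S F :
  \big[op/idx]_(e <- fpowerset S | is_edge e) F e =
  \big[op/idx]_(i < d) \big[op/idx]_(p <- S | p + basis i \in S) F (edge p i).
Proof.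
pose pairs := [seq ip <- [seq (i, p) | i <- enum 'I_d, p <- (S : seq (Zd d))]
  | ip.2 + basis ip.1 \in S].
transitivity (\big[op/idx]_(e <- [seq edge ip.2 ip.1 | ip <- pairs]) F e).
  rewrite -big_filter; apply: perm_big; apply: uniq_perm.
  - by rewrite filter_uniq// fset_uniq.
  - rewrite map_inj_uniq; last first.
      by move=> [i p] [j q] /= /edge_inj[-> ->].
    rewrite filter_uniq//; apply: allpairs_uniq; rewrite ?enum_uniq ?fset_uniq//.
    by move=> [? ?] [? ?] _ _ /= [-> ->].
  move=> e; rewrite mem_filter fpowersetE.
  apply/andP/mapP => [[/is_edgeP[p [i ->]]]|[[i p]]].
    rewrite edge_sub => /andP[pS piS]; exists (i, p) => //.
    by rewrite mem_filter /= piS; apply/allpairsP; exists (i, p); rewrite mem_enum.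
  rewrite mem_filter /= => /andP[piS /allpairsP[[j q] /= [_ qS [ij pq]]]] ->.
  subst j q; split; [by apply/is_edgeP; exists p, i|by rewrite edge_sub qS].
rewrite big_map big_filter big_mkcond big_allpairs_dep big_enum /=.
by apply: eq_bigr => i _; rewrite -big_mkcond.
Qed.

End Edges.

Section Energies.
Variables (R : realType) (d : nat) (A : alphabetType).
Variable Phi : nn_interaction R d A.
Implicit Types (S T V : {fset Zd d}) (x y : config d A) (p : Zd d) (i : 'I_d).

Definition site_energy x : R := fine (Phi (restr x [fset 0]%fset)).
(** [fine] reads a forbidden edge as energy 0; the constraint is recorded separately by
    [edge_ok]. *)
Definition edge_energy i x : R := fine (Phi (restr x (edge 0 i))).
Definition edge_ok i x : bool := Phi (restr x (edge 0 i)) != +oo%E.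

Definition energyR S x : R :=
  \sum_(p <- S) site_energy (shift_config p x) +
  \sum_(i < d) \sum_(p <- S | p + basis i \in S) edge_energy i (shift_config p x).

Definition admissible S x : bool :=
  [forall p : S, [forall i : 'I_d,
    (val p + basis i \in S) ==> edge_ok i (shift_config (val p) x)]].

Lemma admissibleP S x : reflect
  (forall p i, p \in S -> p + basis i \in S -> edge_ok i (shift_config p x))
  (admissible S x).
Proof.
apply: (iffP forallP) => [h p i pS piS|h [p pS]].
  by have /forallP/(_ i)/implyP := h [` pS]%fset; apply.
by apply/forallP => i; apply/implyP; exact: h.
Qed.

Lemma restr_agree S x y : agree S x y -> restr x S = restr y S.
Proof.
move=> xy; apply/fmapP => i; have [iS|iS] := boolP (i \in S).
  by rewrite !in_fnd//= !ffunE /= xy.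
by rewrite !not_fnd.
Qed.

Lemma restr_restrictf S T x : (T `<=` S)%fset -> (restr x S).[& T]%fmap = restr x T.
Proof.
move=> /fsubsetP TS; apply/fmapP => i; rewrite fnd_restrict.
have [iT|iT] := boolP (i \in T); last by rewrite not_fnd.
by rewrite !in_fnd//= ?TS// => iS; rewrite !ffunE.
Qed.

Lemma FinMap_restr S (w : {ffun S -> A}) :
  FinMap w = restr (extend w : config d A) S.
Proof.
apply/fmapP => i; have [iS|iS] := boolP (i \in S).
  by rewrite !in_fnd//= ffunE /= extendE.
by rewrite !not_fnd.
Qed.

Lemma Phi_site p x :
  Phi (restr x [fset p]%fset) = (site_energy (shift_config p x))%:E.
Proof.
have -> : [fset p]%fset = translate p [fset 0]%fset.
  by apply/fsetP => q; rewrite in_translate !inE subr_eq0.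
rewrite -(@interaction_shift _ _ _ Phi) ?is_vertex1// fineK//.
by apply: interaction_vertex; exact: is_vertex1.
Qed.

Lemma Phi_shift_edge p i x :
  Phi (restr x (edge p i)) = Phi (restr (shift_config p x) (edge 0 i)).
Proof.
rewrite -translate_edge -(@interaction_shift _ _ _ Phi)//.
by apply/orP; right; apply/is_edgeP; exists 0, i.
Qed.

Lemma Phi_edge p i x : edge_ok i (shift_config p x) ->
  Phi (restr x (edge p i)) = (edge_energy i (shift_config p x))%:E.
Proof.
rewrite Phi_shift_edge => h; rewrite fineK// fin_numE.
apply/andP; split; last exact: h.
by apply: interaction_edge; apply/is_edgeP; exists 0, i.
Qed.

Lemma Phi_edgeNoo p i x : Phi (restr x (edge p i)) != -oo%E.
Proof. by apply: interaction_edge; apply/is_edgeP; exists p, i. Qed.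

Lemma allowedP x : allowed Phi x <-> forall S, admissible S x.
Proof.
split=> [h S|h p i].
  apply/admissibleP => p i _ _; rewrite /edge_ok -Phi_shift_edge; exact: h.
have /admissibleP/(_ p i) := h (edge p i).
by rewrite /edge_ok -Phi_shift_edge; apply; rewrite !inE eqxx ?orbT.
Qed.

Lemma allowed_edge_ok x p i : allowed Phi x -> edge_ok i (shift_config p x).
Proof. by rewrite /edge_ok -Phi_shift_edge; exact. Qed.

(** No term is -oo, so a single forbidden edge forces the whole extended sum to +oo. *)
Lemma energyE S x : energy Phi (restr x S) =
  if admissible S x then (energyR S x)%:E else +oo%E.
Proof.
rewrite /energy /= big_edges.
rewrite (eq_big_seq (fun p => (site_energy (shift_config p x))%:E)); last first.
  by move=> p pS; rewrite restr_restrictf ?fsub1set// Phi_site.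
rewrite sumEFin.
rewrite [X in (_ + X)%E](_ : _ = \sum_(i < d)
    \sum_(p <- S | (p \in S) && (p + basis i \in S)%R) Phi (restr x (edge p i)))%E;
  last first.
  apply: eq_bigr => i _; rewrite big_seq_cond; apply: eq_bigr => p /andP[pS piS].
  by rewrite restr_restrictf// edge_sub pS.
case: ifPn => [/admissibleP h|].
  rewrite EFinD; congr (_ + _)%E; rewrite -sumEFin; apply: eq_bigr => i _.
  rewrite [in RHS]big_seq_cond -sumEFin; apply: eq_bigr => p /andP[pS piS].
  by apply: Phi_edge; exact: h.
move=> nh; have [p [i [pS piS nok]]] : exists p i,
    [/\ p \in S, p + basis i \in S & Phi (restr x (edge p i)) = +oo%E].
  move: nh => /forallPn[p /forallPn[i]]; rewrite negb_imply /edge_ok => /andP[piS].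
  rewrite -Phi_shift_edge negbK => /eqP h; exists (val p), i; split=> //.
  exact: valP.
have Noo j r (P : pred (Zd d)) :
    (\sum_(p <- r | P p) Phi (restr x (edge p j)) != -oo)%E.
  by apply/eqP => /esum_eqNyP[? [_ _ /eqP]]; apply/negP/Phi_edgeNoo.
have -> : (\sum_(i < d) \sum_(p <- S | (p \in S) && (p + basis i \in S)%R)
    Phi (restr x (edge p i)) = +oo)%E.
  apply/esum_eqyP; first by move=> j _; exact: Noo.
  exists i; split; rewrite ?mem_index_enum//.
  apply/esum_eqyP; first by move=> q _; exact: Phi_edgeNoo.
  by exists p; split=> //; rewrite pS.
by rewrite addey.
Qed.

Definition weight S x : R := if admissible S x then expR (- energyR S x) else 0.

Lemma weight_ge0 S x : 0 <= weight S x.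
Proof. by rewrite /weight; case: ifP => // _; exact: expR_ge0. Qed.

Lemma weight_gt0 S x : (0 < weight S x) = admissible S x.
Proof. by rewrite /weight; case: ifP; rewrite ?expR_gt0 ?ltxx. Qed.

Lemma ln_weight S x : admissible S x -> ln (weight S x) = - energyR S x.
Proof. by rewrite /weight => ->; rewrite expRK. Qed.

Lemma partition_functionE S :
  partition_function Phi S = (psum S (weight S))%:E.
Proof.
rewrite /partition_function /psum -sumEFin; apply: eq_bigr => w _.
rewrite FinMap_restr energyE /weight; case: ifP => // _.
Qed.

Definition A_PhiR x : R := - site_energy x - \sum_(i < d) edge_energy i x.

Lemma A_PhiE x : allowed Phi x -> A_Phi Phi x = (A_PhiR x)%:E.
Proof.
move=> ax; rewrite /A_Phi /A_PhiR.
have -> : Phi (restr x [fset 0]%fset) = (site_energy x)%:E.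
  by rewrite Phi_site shift_config0.
rewrite EFinB EFinN; congr (_ - _)%E.
rewrite -sumEFin; apply: eq_bigr => i _.
have := @Phi_edge 0 i x (allowed_edge_ok 0 i ax).
by rewrite shift_config0 /edge add0r.
Qed.

Lemma site_energy_local : localf [fset 0]%fset site_energy.
Proof. by move=> x y /restr_agree xy; rewrite /site_energy xy. Qed.

Lemma edge_energy_local i : localf (edge 0 i) (edge_energy i).
Proof. by move=> x y /restr_agree xy; rewrite /edge_energy xy. Qed.

Lemma edge_ok_local i x y : agree (edge 0 i) x y -> edge_ok i x = edge_ok i y.
Proof. by move=> /restr_agree xy; rewrite /edge_ok xy. Qed.

Lemma site_energy_agree p x y : x p = y p ->
  site_energy (shift_config p x) = site_energy (shift_config p y).
Proof.
move=> xy; apply: site_energy_local; apply/agree_shift => q.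
by rewrite in_translate inE subr_eq0 => /eqP ->.
Qed.

Lemma edge_energy_agree p i x y : agree (edge p i) x y ->
  edge_energy i (shift_config p x) = edge_energy i (shift_config p y).
Proof.
by move=> xy; apply: edge_energy_local; apply/agree_shift; rewrite translate_edge.
Qed.

Lemma edge_ok_agree p i x y : agree (edge p i) x y ->
  edge_ok i (shift_config p x) = edge_ok i (shift_config p y).
Proof.
by move=> xy; apply: edge_ok_local; apply/agree_shift; rewrite translate_edge.
Qed.

Lemma energyR_local S : localf S (energyR S).
Proof.
move=> x y xy; congr (_ + _).
  rewrite big_seq [RHS]big_seq; apply: eq_bigr => p pS.
  by apply: site_energy_agree; exact: xy.
apply: eq_bigr => i _; rewrite big_seq_cond [RHS]big_seq_cond.
apply: eq_bigr => p /andP[pS piS]; apply: edge_energy_agree.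
by apply: agree_sub xy; rewrite edge_sub pS.
Qed.

Lemma admissible_local S x y : agree S x y -> admissible S x = admissible S y.
Proof.
have h u v : agree S u v -> admissible S u -> admissible S v.
  move=> uv /admissibleP a; apply/admissibleP => p i pS piS.
  rewrite -(@edge_ok_agree _ _ u) ?a//; apply: agree_sub uv.
  by rewrite edge_sub pS.
move=> xy; apply/idP/idP; apply: h => //; exact: agree_sym.
Qed.

Lemma weight_local S : localf S (weight S).
Proof.
by move=> x y xy; rewrite /weight (admissible_local xy) (energyR_local xy).
Qed.

(** The origin is added by hand because in dimension 0 there is no edge to contain it. *)
Definition A_range : {fset Zd d} :=
  (0 |` \big[fsetU/fset0]_(i <- enum 'I_d) edge 0 i)%fset.

Lemma A_PhiR_local : localf A_range A_PhiR.
Proof.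
move=> x y xy; rewrite /A_PhiR; congr (- _ - _).
  by apply: site_energy_local => q; rewrite inE => /eqP ->; apply: xy; rewrite fset1U1.
apply: eq_bigr => i _; apply: edge_energy_local => q qi; apply: xy.
by apply/fset1Ur/mem_bigfsetU; exists i; rewrite // mem_enum.
Qed.

(** A local function takes finitely many values, and the sum of its absolute values over all
    patterns bounds it. Forbidden edges count as 0 here. *)
Lemma energy_bound : exists C : R, [/\ 0 <= C,
  forall x, `|site_energy x| <= C & forall i x, `|edge_energy i x| <= C].
Proof.
pose C0 := psum [fset 0]%fset (fun x => `|site_energy x|).
pose C1 i := psum (edge 0 i) (fun x => `|edge_energy i x|).
have b S (f : config d A -> R) x : localf S f -> `|f x| <= psum S (fun x => `|f x|).
  move=> lf; rewrite /psum (bigD1 (window S x))//= (lf _ x).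
    by rewrite lerDl sumr_ge0.
  exact: extend_window.
have C10 i : 0 <= C1 i by apply: psum_ge0.
have C00 : 0 <= C0 by apply: psum_ge0.
exists (C0 + \sum_i C1 i); split.
- by rewrite addr_ge0// sumr_ge0.
- move=> x; rewrite (le_trans (b _ _ _ site_energy_local))// lerDl.
  exact: sumr_ge0.
- move=> i x; rewrite (le_trans (b _ _ _ (@edge_energy_local i)))//.
  by rewrite (bigD1 i)//= addrCA lerDl addr_ge0// sumr_ge0.
Qed.

End Energies.

Lemma ler_norm_sum_const (R : realType) (J : Type) (r : seq J) (P : pred J)
    (f : J -> R) C : (forall j, P j -> `|f j| <= C) ->
  `|\sum_(j <- r | P j) f j| <= (count P r)%:R * C.
Proof.
move=> fC; rewrite (le_trans (ler_norm_sum _ _ _))// (le_trans (ler_sum _ fC))//.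
by rewrite big_const_seq iter_addr addr0 mulr_natl.
Qed.

Section EnergyEstimates.
Variables (R : realType) (d : nat) (A : alphabetType).
Variable Phi : nn_interaction R d A.
Implicit Types (S T V : {fset Zd d}) (x y : config d A) (p : Zd d) (i : 'I_d).
Implicit Types q : state R (Zd d) A.

Lemma count_exit r S : count (fun p => p + r \notin S) S = boundary r S.
Proof.
rewrite -size_filter.
have -> : size [seq p <- S | p + r \notin S] = #|` [fset p in S | (p + r)%R \notin S]%fset|.
  apply/perm_size/uniq_perm; rewrite ?filter_uniq ?fset_uniq// => p.
  by rewrite mem_filter !inE andbC.
rewrite -(card_translate r); congr (#|` _|); apply/fsetP => p.
by rewrite in_translate !inE /= subrK andbC in_translate.
Qed.

(** The number of edges with lower endpoint in [S] and upper endpoint outside, by [count_exit]. *)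
Definition bdS S : nat := \sum_(i < d) boundary (basis i) S.

Lemma cvg_bdS F : folner R F ->
  (fun n => (bdS (F n))%:R / #|` F n|%:R : R) @ \oo --> (0 : R).
Proof.
move=> hF; have := folner_sum [seq basis i | i <- enum 'I_d] hF.
by under eq_fun do rewrite big_map big_enum.
Qed.

Variable C : R.
Hypotheses (C0 : 0 <= C) (site_le : forall x, `|site_energy Phi x| <= C).
Hypothesis edge_le : forall i x, `|edge_energy Phi i x| <= C.

(** [A_PhiR] at [p] collects the vertex [p] and the [d] edges starting there; the sums differ only
    by the edges that leave [S]. *)
Lemma energyR_A S x :
  `|energyR Phi S x + \sum_(p <- S) A_PhiR Phi (shift_config p x)| <= (bdS S)%:R * C.
Proof.
have -> : energyR Phi S x + \sum_(p <- S) A_PhiR Phi (shift_config p x) =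
    - \sum_(i < d) \sum_(p <- S | p + basis i \notin S)
        edge_energy Phi i (shift_config p x).
  rewrite /energyR /A_PhiR sumrB sumrN addrACA subrr add0r exchange_big /=.
  rewrite -sumrB -sumrN; apply: eq_bigr => i _.
  by rewrite (bigID (fun p => p + basis i \in S) predT)/= opprD addrA subrr add0r.
rewrite normrN (le_trans (ler_norm_sum _ _ _))// /bdS natr_sum mulr_suml.
by apply: ler_sum => i _; rewrite -count_exit; exact: ler_norm_sum_const.
Qed.

(** The terms of [V] missing from [S] are one vertex and at most [d] edges for each site of the
    difference, and edges leaving [S]. *)
Lemma energyR_diff S V x : (S `<=` V)%fset ->
  `|energyR Phi V x - energyR Phi S x| <=
    (d.+1 * #|` (V `\` S)%fset| + bdS S)%:R * C.
Proof.
move=> SV; have cD (P : pred (Zd d)) :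
    (count (fun p => P p && (p \notin S)) V <= #|` (V `\` S)%fset|)%N.
  rewrite -size_filter.
  apply: uniq_leq_size; first by rewrite filter_uniq// fset_uniq.
  by move=> p; rewrite mem_filter inE => /andP[/andP[_ ->] ->].
have -> : energyR Phi V x - energyR Phi S x =
    \sum_(p <- V | p \notin S) site_energy Phi (shift_config p x) +
    \sum_(i < d) (\sum_(p <- V | (p + basis i \in V) && (p \notin S))
        edge_energy Phi i (shift_config p x) +
      \sum_(p <- S | (p + basis i \in V) && (p + basis i \notin S))
        edge_energy Phi i (shift_config p x)).
  have split (P : pred (Zd d)) (f : Zd d -> R) : \sum_(p <- V | P p) f p =
      \sum_(p <- S | P p) f p + \sum_(p <- V | P p && (p \notin S)) f p.
    rewrite (bigID (fun p => p \in S))/=; congr (_ + _).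
    rewrite -big_filter -[RHS]big_filter; apply/perm_big/uniq_perm.
    - by rewrite filter_uniq// fset_uniq.
    - by rewrite filter_uniq// fset_uniq.
    - move=> p; rewrite !mem_filter -andbA; congr (_ && _).
      by rewrite andb_idr// => /(fsubsetP SV).
  have e1 := split xpredT (fun p => site_energy Phi (shift_config p x)).
  rewrite /energyR e1 (_ : \sum_(i < d) \sum_(p <- V | _) _ =
    \sum_(i < d) \sum_(p <- S | p + basis i \in S) edge_energy Phi i (shift_config p x) +
    \sum_(i < d) (\sum_(p <- V | (p + basis i \in V) && (p \notin S))
        edge_energy Phi i (shift_config p x) +
      \sum_(p <- S | (p + basis i \in V) && (p + basis i \notin S))
        edge_energy Phi i (shift_config p x))); first by ring.
  rewrite -big_split /=; apply: eq_bigr => i _.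
  rewrite split (bigID (fun p => p + basis i \in S))/= -addrA; congr (_ + _).
    apply: eq_bigl => p; rewrite andb_idl// => /(fsubsetP SV).
    by [].
  by rewrite addrC.
rewrite (le_trans (ler_normD _ _))// mulSn -addnA natrD mulrDl; apply: lerD.
  rewrite (le_trans (ler_norm_sum_const _ (fun p _ => site_le _)))//.
  rewrite ler_wpM2r// ler_nat; apply: leq_trans (cD xpredT).
  by apply: sub_count => p /= ->.
have -> : (d * #|` (V `\` S)%fset| + bdS S)%:R * C =
    \sum_(i < d) (#|` (V `\` S)%fset|%:R * C + (boundary (basis i) S)%:R * C).
  rewrite big_split /= sumr_const card_ord -mulr_suml -natr_sum -/(bdS S).
  by rewrite natrD mulrDl natrM -mulrA mulr_natl.
rewrite (le_trans (ler_norm_sum _ _ _))//; apply: ler_sum => i _.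
rewrite (le_trans (ler_normD _ _))//; apply: lerD.
  rewrite (le_trans (ler_norm_sum_const _ (fun p _ => edge_le i _)))//.
  by rewrite ler_wpM2r// ler_nat.
rewrite (le_trans (ler_norm_sum_const _ (fun p _ => edge_le i _)))//.
rewrite ler_wpM2r// ler_nat -count_exit; apply: sub_count => p /=.
by case/andP.
Qed.

(** Stated with one shifted state per site for the sake of the finite-volume Gibbs distributions,
    which are not invariant. *)
Lemma expect_energyR (q : state R (Zd d) A) S :
  `|expect q S (energyR Phi S) +
    \sum_(p <- S) expect (shift_state p q) (A_range d) (A_PhiR Phi)| <= (bdS S)%:R * C.
Proof.
(* One window large enough for every term, so that the pointwise bound [energyR_A] can be
   averaged. *)
pose V := (S `|` \big[fsetU/fset0]_(p <- S) translate p (A_range d))%fset.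
rewrite -(expect_sub q (fsubsetUl S _ : (S `<=` V)%fset)); last exact: energyR_local.
have -> : \sum_(p <- S) expect (shift_state p q) (A_range d) (A_PhiR Phi) =
    \sum_(p <- S) expect q V (fun x => A_PhiR Phi (shift_config p x)).
  apply: eq_big_seq => p pS.
  rewrite (@expect_sub _ _ _ q (translate p (A_range d))).
  - rewrite expect_shift; apply: eq_psum => x; rewrite shift_configNK//.
  - apply/fsubsetP => j jp; rewrite inE; apply/orP; right.
    by apply/mem_bigfsetU; exists p.
  - by move=> x y xy; apply: A_PhiR_local; apply/agree_shift.
rewrite -expect_sum -expectD ler_norml; apply/andP; split.
  rewrite -[leLHS](expect_cst q V); apply: le_expect => x _.
  by have := energyR_A S x; rewrite ler_norml => /andP[].
rewrite -[leRHS](expect_cst q V); apply: le_expect => x _.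
by have := energyR_A S x; rewrite ler_norml => /andP[].
Qed.

Lemma sinv_expect_energyR (q : state R (Zd d) A) S : sinv q ->
  `|expect q S (energyR Phi S) +
    #|` S|%:R * expect q (A_range d) (A_PhiR Phi)| <= (bdS S)%:R * C.
Proof.
move=> hq; have := expect_energyR q S; congr (`|_ + _| <= _).
rewrite card_fset_sum1 natr_sum mulr_suml; apply: eq_bigr => p _.
rewrite mul1r; apply: eq_psum => x /=.
by rewrite /shift_state_fun hq shift_configNK.
Qed.

(** The Gibbs inequality against [weight] times [g]: [g = 1] bounds log Z from below, and a product
    of local perturbations will yield detailed balance. *)
Lemma gibbs_bound (q : state R (Zd d) A) S (g : config d A -> R) :
  (forall x, 0 < q S x -> admissible Phi S x) -> (forall x, 0 < g x) ->
  entropyS q S - expect q S (energyR Phi S) + expect q S (fun x => ln (g x)) <=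
  ln (psum S (fun x => weight Phi S x * g x)).
Proof.
move=> adm g0.
have h1 x : 0 <= weight Phi S x * g x by rewrite mulr_ge0 ?weight_ge0// ltW.
have h2 x : 0 < q S x -> 0 < weight Phi S x * g x.
  by move=> /adm ax; rewrite mulr_gt0// weight_gt0.
apply: le_trans (expect_gibbs h1 h2).
rewrite (_ : expect q S (fun x => ln (weight Phi S x * g x)) =
  expect q S (fun x => ln (g x)) - expect q S (energyR Phi S)).
  by rewrite addrC addrA addrAC.
rewrite -expectB; apply: eq_expect => x /adm ax.
by rewrite lnM ?posrE ?weight_gt0// ln_weight// addrC.
Qed.

End EnergyEstimates.

(** Only the limit 0 is delicate: there -t ln t <= 2 sqrt t, which is ln (1/s) < 1/s for s = sqrt
    t. *)
Lemma cvg_mul_ln (R : realType) (F : set_system nat) (FF : ProperFilter F)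
    (u : nat -> R) (t : R) :
  (forall n, 0 <= u n <= 1) -> u n @[n --> F] --> t ->
  u n * - ln (u n) @[n --> F] --> t * - ln t.
Proof.
move=> u01 ut; have t0 : 0 <= t.
  by apply: (cvgr_to_ge ut); apply: nearW => n; case/andP: (u01 n).
move: t0; rewrite le_eqVlt => /predU1P[t0|t0]; last first.
  apply: cvgM => //; apply: cvgN.
  by apply: (cvg_comp _ _ ut); exact: continuous_ln.
rewrite -t0 mul0r in ut *.
apply: (@squeeze_cvgr _ _ _ _ (fun=> 0) (fun n => 2 * Num.sqrt (u n))).
- apply: nearW => n; have /andP[un0 un1] := u01 n.
  rewrite mulr_ge0 ?oppr_ge0 ?ln_le0//=.
  move: un0; rewrite le_eqVlt => /predU1P[<-|un0].
    by rewrite mul0r mulr_ge0// sqrtr_ge0.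
  have s0 : 0 < Num.sqrt (u n) by rewrite sqrtr_gt0.
  have uE : u n = Num.sqrt (u n) ^+ 2 by rewrite sqr_sqrtr// ltW.
  set s := Num.sqrt (u n) in s0 uE *.
  rewrite uE lnXn// mulr2n.
  have : ln s^-1 < s^-1 by apply: ln_sublinear; rewrite invr_gt0.
  rewrite lnV ?posrE// => h.
  have : s ^+ 2 * (- ln s) <= s.
    rewrite expr2 -mulrA -[leRHS]mulr1 ler_pM2l// -ler_pdivlMl// mulr1.
    exact: ltW.
  by lra.
- exact: cvg_cst.
- rewrite -(mulr0 2) -(@sqrtr0 R); apply: cvgMr.
  by apply: (cvg_comp _ _ ut); exact: sqrt_continuous.
Qed.

Lemma big_fset_val (V : Type) (idx : V) (op : Monoid.com_law idx) (K : choiceType)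
    (S : {fset K}) (F : K -> V) :
  \big[op/idx]_(i : S) F (val i) = \big[op/idx]_(i <- S) F i.
Proof. by rewrite big_seq_fsetE. Qed.

(** * Finite-volume Gibbs distributions and their averages over translations *)

Section GibbsState.
Variables (R : realType) (d : nat) (A : alphabetType).
Variable Phi : nn_interaction R d A.
Implicit Types (S T V : {fset Zd d}) (x y : config d A) (p : Zd d) (i : 'I_d).

Section FixedVolume.
Variable B : {fset Zd d}.
Hypothesis Z0 : 0 < psum B (weight Phi B).
Hypothesis B0 : (0 < #|` B|)%N.

Let Z := psum B (weight Phi B).
Let c (w : {ffun B -> A}) := weight Phi B (extend w) / Z.

Let c0 w : 0 <= c w.
Proof. by rewrite divr_ge0 ?weight_ge0// ltW. Qed.

Let c1 : \sum_w c w = 1.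
Proof. by rewrite -mulr_suml divff// gt_eqF. Qed.

(** A mixture of point masses, each filled with the default symbol outside [B]. This arbitrary
    filling affects the averages below only through boundary terms. *)
Definition gibbs_state : state R (Zd d) A :=
  comb_state (fun w : {ffun B -> A} => dirac_state R (extend w)) c0 c1.

Lemma gibbs_stateE x : gibbs_state B x = weight Phi B x / Z.
Proof.
have h : localf B (fun x => weight Phi B x / Z).
  by move=> y z /weight_local ->.
rewrite -[RHS](psum_indic x h); apply: eq_bigr => w _ /=.
by rewrite mulrC.
Qed.

Lemma gibbs_state_gt0 T x : 0 < gibbs_state T x ->
  exists2 y, agree T x y & admissible Phi B y.
Proof.
move=> h; apply: contrapT => n; move: h; rewrite /= /comb_fun big1 ?ltxx// => w _.
rewrite /= /dirac_fun; case: (agreeP T x (extend w)) => [xw|_]; last by rewrite mulr0.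
rewrite mulr1 /c; have := weight_ge0 Phi B (extend w).
rewrite le_eqVlt weight_gt0 => /predU1P[<-|aw]; first by rewrite mul0r.
by exfalso; apply: n; exists (extend w).
Qed.

(** The equality case of the Gibbs inequality. *)
Lemma gibbs_state_entropy :
  entropyS gibbs_state B - expect gibbs_state B (energyR Phi B) = ln Z.
Proof.
rewrite /entropyS -expectB -[RHS](expect_cst gibbs_state B); apply: eq_expect => x.
rewrite gibbs_stateE => h.
have ax : admissible Phi B x.
  by rewrite -(@weight_gt0 R) -(pmulr_lgt0 _ (_ : 0 < Z^-1)) ?invr_gt0.
by rewrite ln_div ?posrE ?weight_gt0// ln_weight// opprB opprK addrK.
Qed.

Let k0 (p : B) : 0 <= (#|` B|%:R : R)^-1.
Proof. by rewrite invr_ge0. Qed.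

Let k1 : \sum_(p : B) (#|` B|%:R : R)^-1 = 1.
Proof.
rewrite sumr_const -[LHS]mulr_natr -cardfE mulVf//.
by rewrite pnatr_eq0 -lt0n.
Qed.

Definition avg_gibbs : state R (Zd d) A :=
  comb_state (fun p : B => shift_state (val p) gibbs_state) k0 k1.

Lemma avg_gibbsE S x : avg_gibbs S x =
  (\sum_(p <- B) gibbs_state (translate p S) (shift_config (- p) x)) / #|` B|%:R.
Proof.
rewrite /= /comb_fun -mulr_sumr mulrC; congr (_ / _).
by rewrite -big_fset_val.
Qed.

Lemma avg_gibbs_entropy S :
  (\sum_(p <- B) entropyS gibbs_state (translate p S)) / #|` B|%:R <=
  entropyS avg_gibbs S.
Proof.
have := @entropyS_concave _ _ _ _ _ (fun p : B => shift_state (val p) gibbs_state)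
  avg_gibbs S k0 (fun x => erefl).
rewrite -mulr_sumr mulrC; congr (_ / _ <= _); rewrite -big_fset_val.
by apply: eq_bigr => p _; rewrite entropyS_shift.
Qed.

Lemma avg_gibbs_expect S f : expect avg_gibbs S f =
  (\sum_(p <- B) expect (shift_state p gibbs_state) S f) / #|` B|%:R.
Proof.
rewrite expect_comb -mulr_sumr mulrC; congr (_ / _).
by rewrite -big_fset_val.
Qed.

(** Translating by [r] replaces the average over [B] by one over its translate; each new centre
    contributes a probability, at most 1. *)
Lemma avg_gibbs_shift r S x :
  avg_gibbs (translate r S) x - avg_gibbs S (shift_config r x) <=
  (boundary r B)%:R / #|` B|%:R.
Proof.
rewrite !avg_gibbsE -mulrBl ler_wpM2r ?invr_ge0//.
pose f p := gibbs_state (translate p S) (shift_config (r - p) x).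
have -> : \sum_(p <- B) gibbs_state (translate p (translate r S)) (shift_config (- p) x)
    = \sum_(p <- translate r B) f p.
  rewrite [RHS]big_imfset /=; last by move=> ? ? _ _; exact: addrI.
  apply: eq_bigr => p _; rewrite translate_translate /f opprD addrA subrr add0r.
  by rewrite addrC.
have -> : \sum_(p <- B) gibbs_state (translate p S) (shift_config (- p) (shift_config r x))
    = \sum_(p <- B) f p.
  by apply: eq_bigr => p _; rewrite shift_configD.
have f0 p : 0 <= f p by exact: state_ge0.
rewrite (big_fsetID _ (fun p => p \in B)) /=.
rewrite lerBlDl; apply: lerD.
  rewrite [leRHS](big_fsetID _ (fun p => p \in translate r B)) /=.
  rewrite (_ : [fset p in translate r B | p \in B]%fset =
    [fset p in B | p \in translate r B]%fset).
    by rewrite lerDl sumr_ge0.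
  by apply/fsetP => p; rewrite !inE andbC.
rewrite (_ : [fset p in translate r B | p \notin B]%fset = (translate r B `\` B)%fset).
  rewrite /boundary card_fset_sum1 natr_sum; apply: ler_sum => p _.
  exact: state_le1.
by apply/fsetP => p; rewrite !inE andbC.
Qed.

(** A forbidden edge has probability 0 at every translate that keeps both endpoints inside [B]; the
    other translates are counted by the two boundaries. *)
Lemma avg_gibbs_inadmissible p i x : ~~ edge_ok Phi i (shift_config p x) ->
  avg_gibbs (edge p i) x <=
  (boundary p B + boundary (p + basis i) B)%:R / #|` B|%:R.
Proof.
move=> nok; rewrite avg_gibbsE ler_wpM2r ?invr_ge0//.
have cntE r : (boundary r B)%:R = \sum_(p' <- B) (p' + r \notin B)%:R :> R.
  rewrite -count_exit -sum1_count natr_sum big_mkcond.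
  by apply: eq_bigr => p' _; case: ifP.
rewrite natrD !cntE -big_split; apply: ler_sum => p' _.
have [p1|p1] := boolP (p' + p \in B); rewrite [leRHS]/=; last first.
  by rewrite (le_trans (state_le1 _ _ _))// lerDl.
have [p2|p2] := boolP (p' + (p + basis i) \in B); rewrite [leRHS]/=; last first.
  by rewrite (le_trans (state_le1 _ _ _))// add0r.
rewrite addr0 leNgt; apply/negP => /gibbs_state_gt0[y xy /admissibleP ay].
move/negP: nok; apply; have := ay (p' + p) i p1.
rewrite -addrA => /(_ p2); rewrite -shift_configD.
suff -> : edge_ok Phi i (shift_config p (shift_config p' y)) =
  edge_ok Phi i (shift_config p x) by [].
apply: edge_ok_agree; apply: agree_sym; rewrite -[x](shift_configNK p').
exact/agree_shift.
Qed.

End FixedVolume.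

End GibbsState.

Lemma cvg_entropyS_lim (R : realType) (I : choiceType) (A : alphabetType)
    (G : set_system nat) (GF : UltraFilter G) (Q : nat -> state R I A) S :
  entropyS (Q n) S @[n --> G] --> entropyS (lim_state GF Q) S.
Proof.
apply: cvg_big => [|w _]; first by move=> ?; exact: add_continuous.
apply: cvg_mul_ln; last exact: cvg_lim_state.
by move=> n; rewrite state_ge0 state_le1.
Qed.

Section VariationalPrinciple.
Variables (R : realType) (d : nat) (A : alphabetType).
Variable Phi : nn_interaction R d A.
Implicit Types (S T V : {fset Zd d}) (x y : config d A) (p : Zd d) (i : 'I_d).
Implicit Types (mu : probability (config d A) R).

Definition mean_A (q : state R (Zd d) A) : R := expect q (A_range d) (A_PhiR Phi).

Lemma integral_A_Phi mu : msupport mu `<=` allowed Phi ->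
  (\int[mu]_x A_Phi Phi x = (mean_A (measure_state mu))%:E)%E.
Proof.
move=> sa; rewrite /mean_A -integral_local; last exact: A_PhiR_local.
have mS := measurable_msupport mu; have mS0 := msupportC0 mu.
rewrite (integral_full mS mS0) [RHS](integral_full mS mS0).
by apply: eq_integral => x; rewrite inE => /sa/A_PhiE.
Qed.

Definition free_energyR (q : state R (Zd d) A) : R := entropy_rate q + mean_A q.

Lemma free_energyE mu : shift_invariant mu -> msupport mu `<=` allowed Phi ->
  free_energy Phi mu = (free_energyR (measure_state mu))%:E.
Proof.
by move=> hmu sa; rewrite /free_energy integral_A_Phi// entropyE.
Qed.

Lemma measure_state_admissible mu S x : msupport mu `<=` allowed Phi ->
  0 < measure_state mu S x -> admissible Phi S x.
Proof.
move=> sa /msupport_cyl[y /sa/allowedP ay xy].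
by rewrite (admissible_local Phi xy).
Qed.

Definition Zbox n := psum (box d n) (weight Phi (box d n)).

Lemma psum_weight_gt0 S x : allowed Phi x -> 0 < psum S (weight Phi S).
Proof.
move=> /allowedP ax; rewrite /psum (bigD1 (window S x))//=.
rewrite ltr_wpDr ?sumr_ge0//; first by move=> w _; exact: weight_ge0.
by rewrite weight_gt0 (admissible_local Phi (extend_window (S:=S) x)).
Qed.

Section UpperBound.
Variables (x0 : config d A) (ax0 : allowed Phi x0).
Variables (G : set_system nat) (GF : UltraFilter G) (hG : \oo `<=` G).
Variables (c : R) (hc : \forall n \near G, c <= ln (Zbox n) / #|` box d n|%:R).

Let cvgG (u : nat -> R) (l : R) : u @ \oo --> l -> u @ G --> l.
Proof. by move=> h B /h/hG. Qed.

Let Z0 n : 0 < psum (box d n) (weight Phi (box d n)).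
Proof. exact: psum_weight_gt0 ax0. Qed.

Let Q n := avg_gibbs (Z0 n) (box_gt0 d n).
Let L := lim_state GF Q.

Let cvg_boundary p :
  (fun n => (boundary p (box d n))%:R / #|` box d n|%:R : R) @ G --> (0 : R).
Proof. by apply: cvgG; exact: (folner_box R d).2. Qed.

(* Applied to [- r] as well, this gives equality. *)
Let L_shift_le r S x : L (translate r S) x <= L S (shift_config r x).
Proof.
rewrite -subr_le0; apply: (ler_cvg_to _ (cvg_boundary r)).
  by apply: cvgB; [exact: cvg_lim_state|exact: cvg_lim_state].
by apply: nearW => n; exact: avg_gibbs_shift.
Qed.

Let L_sinv : sinv L.
Proof.
move=> r S x; apply/eqP; rewrite eq_le L_shift_le/=.
have := L_shift_le (- r) (translate r S) (shift_config r x).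
by rewrite translate_translate addNr translate0 shift_configK.
Qed.

Let L_inadmissible p i x : ~~ edge_ok Phi i (shift_config p x) -> L (edge p i) x = 0.
Proof.
move=> nok; apply/eqP; rewrite eq_le state_ge0 andbT.
have h : (fun n => (boundary p (box d n) + boundary (p + basis i) (box d n))%:R /
    #|` box d n|%:R : R) @ G --> (0 : R).
  under eq_fun do rewrite natrD mulrDl.
  by rewrite -(addr0 0); apply: cvgD.
apply: (ler_cvg_to (@cvg_lim_state _ _ _ G GF Q (edge p i) x) h).
by apply: nearW => n; exact: avg_gibbs_inadmissible.
Qed.

(** log Z_n is the entropy minus the mean energy of the Gibbs distribution. Shearer cuts its entropy
    into windows of radius [m], concavity passes to the averaged state [Q n], and the window being
    fixed, all terms converge along [G]. *)
Let L_bound m : c <= entropyS L (box d m) / #|` box d m|%:R + mean_A L.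
Proof.
have [C [C0 sC eC]] := energy_bound Phi.
pose err n := (#|` box d (n + m)| - #|` box d n|)%:R / #|` box d n|%:R * #|A|%:R +
  (bdS (box d n))%:R / #|` box d n|%:R * C.
have err0 : err @ G --> (0 : R).
  apply: cvgG; rewrite (_ : 0 = 0 * #|A|%:R + 0 * C); last by rewrite !mul0r addr0.
  apply: cvgD; apply: cvgMl; first exact: cvg_box_boundary.
  by apply: cvg_bdS; exact: folner_box.
have h : (fun n => entropyS (Q n) (box d m) / #|` box d m|%:R + mean_A (Q n) + err n)
    @ G --> entropyS L (box d m) / #|` box d m|%:R + mean_A L + 0.
  apply: cvgD => //; apply: cvgD; last exact: cvg_expect_lim.
  by apply: cvgMl; exact: cvg_entropyS_lim.
rewrite addr0 in h; apply: (cvgr_to_ge h); move: hc; apply: filterS => n cn.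
apply: le_trans cn _.
have b0 : 0 < #|` box d n|%:R :> R by rewrite ltr0n box_gt0.
have m0 : 0 < #|` box d m|%:R :> R by rewrite ltr0n box_gt0.
rewrite ler_pdivrMr// -(gibbs_state_entropy (Z0 n)).
set g := gibbs_state (Z0 n).
have h1 := entropyS_box_le g m n.
have h2 := avg_gibbs_entropy (Z0 n) (box_gt0 d n) (box d m).
have h3 := expect_energyR eC g (box d n).
have h4 := avg_gibbs_expect (Z0 n) (box_gt0 d n) (A_range d) (A_PhiR Phi).
rewrite -/(Q n) -/g -/(mean_A (Q n)) in h2 h4.
rewrite ler_pdivrMr// in h2.
set s := \sum_(p <- _) entropyS _ _ in h1 h2.
have h1' : entropyS g (box d n) <= s / #|` box d m|%:R +
    (#|` box d (n + m)| - #|` box d n|)%:R * #|A|%:R.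
  rewrite -(ler_pM2l m0); apply: le_trans h1 _.
  by rewrite le_eqVlt; apply/orP; left; apply/eqP; field; rewrite gt_eqF.
have -> : (entropyS (Q n) (box d m) / #|` box d m|%:R + mean_A (Q n) + err n) *
    #|` box d n|%:R = entropyS (Q n) (box d m) * #|` box d n|%:R / #|` box d m|%:R +
    \sum_(p <- box d n) expect (shift_state p g) (A_range d) (A_PhiR Phi) +
    ((#|` box d (n + m)| - #|` box d n|)%:R * #|A|%:R + (bdS (box d n))%:R * C).
  rewrite h4 /err; field; rewrite !gt_eqF//.
have h2' : s / #|` box d m|%:R <=
    entropyS (Q n) (box d m) * #|` box d n|%:R / #|` box d m|%:R.
  by rewrite ler_wpM2r ?invr_ge0.
move: h3; rewrite ler_norml => /andP[h3 _]; lra.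
Qed.

(** The limit gives probability 0 to each forbidden edge, so its support is allowed; letting the
    window grow in [L_bound] produces the entropy rate. *)
Lemma exists_free_energy_ge : exists mu, [/\ shift_invariant mu,
  msupport mu `<=` allowed Phi & c <= free_energyR (measure_state mu)].
Proof.
pose mu := state_prob L; exists mu.
have muE S x : measure_state mu S x = L S x by exact: state_prob_state.
have HE S : entropyS (measure_state mu) S = entropyS L S.
  by apply: eq_psum => x; rewrite muE.
have AE : mean_A (measure_state mu) = mean_A L.
  by apply: eq_psum => x; rewrite muE.
have sinvq : sinv (measure_state mu) by move=> p S x; rewrite !muE L_sinv.
split.
- exact: sinv_shift_invariant.
- move=> x sx; apply/allowedP => S; apply/admissibleP => p i _ _.
  apply: contrapT => /negP /L_inadmissible; rewrite -muE => L0.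
  have : 0 < measure_state mu (edge p i) x := sx (edge p i).
  by rewrite L0 ltxx.
rewrite /free_energyR AE.
have h : (fun m => entropyS (measure_state mu) (box d m) / #|` box d m|%:R + mean_A L)
    @ \oo --> entropy_rate (measure_state mu) + mean_A L.
  apply: cvgD; last exact: cvg_cst.
  apply: cvg_entropy_folner => //; exact: folner_box.
apply: (cvgr_to_ge h); apply: nearW => m; rewrite HE; exact: L_bound.
Qed.

End UpperBound.

Lemma ln_Zbox_ge (q : state R (Zd d) A) C : 0 <= C ->
  (forall x, `|site_energy Phi x| <= C) ->
  (forall i x, `|edge_energy Phi i x| <= C) -> sinv q ->
  (forall S x, 0 < q S x -> admissible Phi S x) -> forall S,
  #|` S|%:R * free_energyR q <=
    ln (psum S (weight Phi S)) + (bdS S)%:R * C.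
Proof.
move=> C0 sC eC hq adm S.
have := @gibbs_bound _ _ _ Phi q S (fun=> 1) (adm S) (fun=> ltr01).
under eq_psum do rewrite mulr1.
rewrite ln1 expect_cst addr0 => h1.
have := sinv_expect_energyR eC S hq; rewrite ler_norml => /andP[_ h2].
have h3 := entropy_rate_le hq S.
by rewrite /free_energyR /mean_A mulrDr; lra.
Qed.

Lemma cvg_ln_Zbox mu : equilibrium_state Phi mu ->
  (fun n => ln (Zbox n) / #|` box d n|%:R) @ \oo --> free_energyR (measure_state mu).
Proof.
move=> [hmu sa maxmu]; set P := free_energyR _.
have [C [C0 sC eC]] := energy_bound Phi.
have [x0 /sa ax0] := msupport_nonempty mu.
have err0 : (fun n => (bdS (box d n))%:R / #|` box d n|%:R * C : R) @ \oo --> (0 : R).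
  by rewrite -(mul0r C); apply: cvgMl; apply: cvg_bdS; exact: folner_box.
apply: cvgr_epsP => e e0.
have up : \forall n \near \oo, ln (Zbox n) / #|` box d n|%:R < P + e.
  apply: contrapT => nup.
  (* If the bound failed infinitely often, an ultrafilter containing these indices would produce an
     invariant measure of free energy at least [P + e], against the maximality of [mu]. *)
  pose E := [set n | P + e <= ln (Zbox n) / #|` box d n|%:R].
  have FE : ProperFilter (within E \oo).
    apply: Build_ProperFilter_ex => B [N _ NB].
    apply: contrapT => nB; apply: nup; exists N => // n Nn.
    rewrite /= ltNge; apply/negP => En; apply: nB; exists n.
    exact: NB.
  have [G [GF hG]] := ultraFilterLemma FE.
  have [||mu' [hmu' sa' cmu']] := @exists_free_energy_ge x0 ax0 G GF _ (P + e).
  - by move=> B hB; apply: hG; apply: filterS hB => n Bn _.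
  - by apply: hG; apply: withinT.
  have := maxmu mu' hmu' sa'; rewrite !free_energyE// lee_fin leNgt => /negP; apply.
  by apply: lt_le_trans cmu'; rewrite ltrDl.
near=> n.
have b0 : 0 < #|` box d n|%:R :> R by rewrite ltr0n box_gt0.
rewrite ler_distl; apply/andP; split; last by apply: ltW; near: n.
rewrite lerBlDr.
have h := @ln_Zbox_ge (measure_state mu) C C0 sC eC (measure_state_sinv hmu)
  (fun S x => @measure_state_admissible mu S x sa) (box d n).
apply: (@le_trans _ _ (ln (Zbox n) / #|` box d n|%:R +
   (bdS (box d n))%:R / #|` box d n|%:R * C)).
  rewrite [_ * C]mulrAC -mulrDl ler_pdivlMr// mulrC; exact: h.
rewrite lerD2l (le_trans (ler_norm _))// -[X in `|X|]subr0 distrC; near: n.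
by move/cvgrPdist_le : err0; apply.
Unshelve. all: by end_near. Qed.

Lemma pressureE mu : equilibrium_state Phi mu ->
  pressure Phi = (free_energyR (measure_state mu))%:E.
Proof.
move=> hmu; have [_ sa _] := hmu; have [x0 /sa ax0] := msupport_nonempty mu.
apply/cvg_lim => //.
rewrite (_ : (fun n => _) = (fun n => (ln (Zbox n) / #|` box d n|%:R)%:E)).
  apply: cvg_EFin; last exact: cvg_ln_Zbox.
  by apply: nearW.
apply/funext => n; rewrite partition_functionE lne_EFin; last first.
  exact: psum_weight_gt0 ax0.
by rewrite -EFinM mulrC.
Qed.

End VariationalPrinciple.

(** * Detailed balance for equilibrium states *)

(** From ln z <= z - 1 at z = 1 / (1 + y). The coefficient 2 is what makes the remainder
    [y ^+ 2 * (1 + 2 * y)] nonnegative down to y = -1/2. *)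
Lemma ln1D_ge (R : realType) (y : R) : - 2^-1 <= y -> y - 2 * y ^+ 2 <= ln (1 + y).
Proof.
move=> y2; have y1 : 0 < 1 + y by lra.
have h : ln (1 + y)^-1 <= (1 + y)^-1 - 1.
  have := @le_ln1Dx R ((1 + y)^-1 - 1); rewrite addrCA subrr addr0; apply.
  by rewrite ltrBrDl subrr invr_gt0.
rewrite lnV ?posrE// in h.
suff : y - 2 * y ^+ 2 <= 1 - (1 + y)^-1 by lra.
have -> : 1 - (1 + y)^-1 = y / (1 + y) by field; rewrite gt_eqF.
rewrite ler_pdivlMr// -subr_ge0.
have -> : y - (y - 2 * y ^+ 2) * (1 + y) = y ^+ 2 * (1 + 2 * y) by ring.
by rewrite mulr_ge0 ?sqr_ge0//; lra.
Qed.

Section LocalChange.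
Variables (R : realType) (d : nat) (A : alphabetType).
Variable Phi : nn_interaction R d A.
Implicit Types (S T V B L : {fset Zd d}) (x y : config d A) (p : Zd d) (i : 'I_d).

Lemma energyR_split T B x : (T `<=` B)%fset ->
  energyR Phi B x = energyR Phi T x +
    (\sum_(p <- B | p \notin T) site_energy Phi (shift_config p x) +
     \sum_(i < d) \sum_(p <- B | (p + basis i \in B) && ~~ (edge p i `<=` T)%fset)
        edge_energy Phi i (shift_config p x)).
Proof.
move=> TB; rewrite /energyR addrACA -big_split /=; congr (_ + _).
  rewrite (bigID (fun p => p \in T))/=; congr (_ + _).
  rewrite -big_filter; apply/perm_big/uniq_perm; rewrite ?filter_uniq ?fset_uniq// => p.
  by rewrite mem_filter andb_idr//; exact: (fsubsetP TB).
apply: eq_bigr => i _; rewrite (bigID (fun p => edge p i `<=` T)%fset)/=.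
congr (_ + _); rewrite -big_filter -[RHS]big_filter.
apply/perm_big/uniq_perm; rewrite ?filter_uniq ?fset_uniq// => p.
rewrite !mem_filter edge_sub; apply/idP/idP => [/andP[/andP[_ /andP[-> ->]]]//|].
by move=> /andP[pi pT]; rewrite pi pT !(fsubsetP TB).
Qed.

Definition interior_of L T := forall p, p \in L ->
  p \in T /\ forall i, p + basis i \in T /\ p - basis i \in T.

Definition agree_off L x y := forall p, p \notin L -> x p = y p.

Lemma agree_off_edge L T x y p i : interior_of L T -> agree_off L x y ->
  ~~ (edge p i `<=` T)%fset -> agree (edge p i) x y.
Proof.
move=> LT xy nT q; rewrite !inE => /orP[]/eqP ->; apply: xy.
  apply: contra nT => pL; rewrite edge_sub; have [-> h] := LT _ pL.
  by have [->] := h i.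
apply: contra nT => pL; rewrite edge_sub; have [-> h] := LT _ pL.
by have [_] := h i; rewrite addrK => ->.
Qed.

(** A vertex or edge of [B] not contained in [T] misses [L], so its energy and its admissibility are
    the same for [x] and [y]. *)
Lemma weight_change L T B x y : (T `<=` B)%fset -> interior_of L T ->
  agree_off L x y -> admissible Phi T x -> admissible Phi T y ->
  weight Phi B x * expR (energyR Phi T x) = weight Phi B y * expR (energyR Phi T y).
Proof.
move=> TB LT xy ax ay.
have adm u v : agree_off L u v -> admissible Phi T v ->
    admissible Phi B u -> admissible Phi B v.
  move=> uv /admissibleP av /admissibleP au; apply/admissibleP => p i pB piB.
  have [eT|eT] := boolP (edge p i `<=` T)%fset.
    by move: eT; rewrite edge_sub => /andP[pT piT]; exact: av.
  by rewrite -(edge_ok_agree Phi (agree_off_edge LT uv eT)); exact: au.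
have yx : agree_off L y x by move=> p /xy.
have admE : admissible Phi B x = admissible Phi B y.
  by apply/idP/idP; exact: adm.
rewrite /weight -admE; case: ifP => _; last by rewrite !mul0r.
rewrite -!expRD (energyR_split x TB) (energyR_split y TB).
set rx := (X in - (_ + X) + _); set ry := (X in _ = expR (- (_ + X) + _)).
suff -> : rx = ry by congr expR; ring.
congr (_ + _).
  apply: eq_bigr => p pT; apply: site_energy_agree; apply: xy.
  by apply: contra pT => /LT[].
apply: eq_bigr => i _; apply: eq_bigr => p /andP[_ eT].
by apply: edge_energy_agree; exact: agree_off_edge LT xy eT.
Qed.

Lemma energyR_translate j V x :
  energyR Phi (translate j V) x = energyR Phi V (shift_config j x).
Proof.
rewrite /energyR big_imfset /=; last by move=> ? ? _ _; exact: addrI.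
congr (_ + _).
  by apply: eq_bigr => p _; rewrite shift_configD.
apply: eq_bigr => i _; rewrite big_mkcond big_imfset /=; last first.
  by move=> ? ? _ _; exact: addrI.
rewrite [RHS]big_mkcond; apply: eq_bigr => p _.
by rewrite in_translate -(addrA j) (addrC j) addrK shift_configD.
Qed.

Lemma admissible_translate j V x :
  admissible Phi (translate j V) x = admissible Phi V (shift_config j x).
Proof.
apply/admissibleP/admissibleP => h p i pV piV.
  rewrite shift_configD; apply: h; rewrite in_translate.
    by rewrite addrAC subrr add0r.
  by rewrite -(addrA j) (addrC j) addrK.
have := h (p - j) i; rewrite shift_configD (addrC j) subrK; apply.
  by rewrite -in_translate.
by rewrite addrAC -in_translate.
Qed.

End LocalChange.

Lemma psum_cyl (R : realType) (I : choiceType) (A : alphabetType)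
    (T B : {fset I}) (c : I -> A) (h : (I -> A) -> R) : (T `<=` B)%fset ->
  psum B (fun x => (agreeb T c x)%:R * h x) =
  psum (B `\` T)%fset (fun y => h (splice T c y)).
Proof.
move=> TB; rewrite (psumU _ TB).
pose k x := psum (B `\` T)%fset (fun y => h (splice T x y)).
have lk : localf T k.
  move=> x x' xx'; apply: eq_psum => y; congr h; apply/funext => i.
  by rewrite /splice; case: ifPn => // /xx'.
rewrite -[RHS](psum_indic c lk); apply: eq_psum => x.
rewrite -psumZl; apply: eq_psum => y; congr (_%:R * _); congr nat_of_bool.
apply/agreeP/agreeP => cx i iT; have := cx i iT; by rewrite /splice iT.
Qed.

Section Perturbation.
Variables (R : realType) (d : nat) (A : alphabetType).
Variable Phi : nn_interaction R d A.
Variables (L V : {fset Zd d}) (LV : interior_of L V).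
Variables (a b : config d A) (ab : agree_off L a b).
Hypotheses (aa : admissible Phi V a) (ab' : admissible Phi V b).
Implicit Types (B : {fset Zd d}) (x y : config d A) (j p : Zd d).

Let alpha := expR (energyR Phi V a).
Let beta := expR (energyR Phi V b).

(* Under the Gibbs weights, this has conditional mean zero given the outside of [L]. *)
Definition tilt y : R := (agreeb V a y)%:R * alpha - (agreeb V b y)%:R * beta.

Lemma tilt_local : localf V tilt.
Proof.
have h c x y : agree V x y -> agreeb V c x = agreeb V c y.
  move=> xy; apply/agreeP/agreeP => cx; first exact: agree_trans cx xy.
  exact: agree_trans cx (agree_sym xy).
by move=> x y xy; rewrite /tilt !(h _ _ _ xy).
Qed.

(** The two indicators fix the pattern on the tile, leaving two sums over the same outside patterns;
    their terms agree by [weight_change], and [f] does not see the change. *)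
Lemma psum_tilt j B (f : config d A -> R) : (translate j V `<=` B)%fset ->
  (forall x y, agree_off (translate j L) x y -> f x = f y) ->
  psum B (fun x => weight Phi B x * (tilt (shift_config j x) * f x)) = 0.
Proof.
move=> TB fL; set T := translate j V in TB.
pose a' := shift_config (- j) a; pose b' := shift_config (- j) b.
have agE c x : agreeb V c (shift_config j x) = agreeb T (shift_config (- j) c) x.
  have h := agree_shift j V (shift_config (- j) c) x.
  rewrite shift_configNK in h.
  by apply/agreeP/agreeP => cx; [exact: h.1|exact: h.2].
have -> : (fun x => weight Phi B x * (tilt (shift_config j x) * f x)) =
  (fun x => (agreeb T a' x)%:R * (weight Phi B x * alpha * f x) -
            (agreeb T b' x)%:R * (weight Phi B x * beta * f x)).
  by apply/funext => x; rewrite /tilt !agE; ring.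
rewrite psumD psumN !psum_cyl// -psumN -psumD.
rewrite [RHS](_ : 0 = psum (B `\` T)%fset (fun _ : config d A => 0)); last first.
  by rewrite psum_const mulr0.
apply: eq_psum => y.
have off : agree_off (translate j L) (splice T a' y) (splice T b' y).
  move=> p pL; rewrite /splice; case: ifP => // _; apply: ab.
  by rewrite addrC -in_translate.
have eE c : energyR Phi T (splice T (shift_config (- j) c) y) = energyR Phi V c.
  by rewrite (energyR_local Phi (splice_agree _ _ _)) energyR_translate shift_configNK.
have aE c : admissible Phi T (splice T (shift_config (- j) c) y) = admissible Phi V c.
  by rewrite (admissible_local Phi (splice_agree _ _ _)) admissible_translate shift_configNK.
have LT : interior_of (translate j L) T.
  move=> p; rewrite in_translate => /LV[pV h]; rewrite in_translate; split=> // i.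
  by rewrite !in_translate (addrAC p) (addrAC p (- basis i)); exact: h.
have := weight_change (Phi := Phi) TB LT off; rewrite /a' /b' !aE !eE => /(_ aa ab') wE.
by rewrite (fL _ _ off) wE subrr.
Qed.

(** Tiles are disjoint, so the factors of the other tiles ignore a change inside one: expanding one
    factor at a time, every tilted term sums to 0 and the partition function is unchanged. *)
Lemma psum_tilts s (J : seq (Zd d)) B : uniq J ->
  (forall j, j \in J -> (translate j V `<=` B)%fset) ->
  (forall j k p, j \in J -> k \in J -> p \in translate j V ->
     p \in translate k V -> j = k) ->
  psum B (fun x => weight Phi B x *
    \prod_(j <- J) (1 + s * tilt (shift_config j x))) = psum B (weight Phi B).
Proof.
elim: J => [|j J IH] /=; first by move=> *; apply: eq_psum => x; rewrite big_nil mulr1.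
move=> /andP[jJ uJ] VB dis; rewrite -IH//; last 2 first.
- by move=> k kJ; apply: VB; rewrite inE kJ orbT.
- by move=> k l p kJ lJ; apply: dis; rewrite inE ?kJ ?lJ orbT.
pose f x := \prod_(k <- J) (1 + s * tilt (shift_config k x)).
have -> : (fun x => weight Phi B x *
    \prod_(k <- j :: J) (1 + s * tilt (shift_config k x))) =
  (fun x => weight Phi B x * f x +
     s * (weight Phi B x * (tilt (shift_config j x) * f x))).
  by apply/funext => x; rewrite big_cons /f; ring.
rewrite psumD psumZl psum_tilt ?mulr0 ?addr0//.
  by apply: VB; rewrite mem_head.
move=> x y xy; apply: eq_big_seq => k kJ; congr (1 + s * _).
apply: tilt_local; apply/agree_shift => p pk; apply: xy.
apply/negP; rewrite in_translate => /LV[+ _]; rewrite -in_translate => pj.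
have jk : j = k by apply: dis pj pk; rewrite inE ?eqxx// kJ orbT.
by rewrite jk kJ in jJ.
Qed.

Lemma tilt_bound y : `|tilt y| <= alpha + beta.
Proof.
rewrite (le_trans (ler_normB _ _))//; apply: lerD; rewrite normrM ger0_norm//.
  by rewrite ger0_norm ?expR_ge0// ler_piMl ?expR_ge0//; case: agreeb.
by rewrite ger0_norm ?expR_ge0// ler_piMl ?expR_ge0//; case: agreeb.
Qed.

(** The perturbed partition function equals the original one, while the left-hand side of the Gibbs
    inequality gains one identical expectation per tile. The bound 1/2 on the perturbation keeps its
    factors positive. *)
Lemma tilted_pressure (q : state R (Zd d) A) s (J : seq (Zd d)) B : sinv q ->
  (forall S x, 0 < q S x -> admissible Phi S x) ->
  `|s| * (alpha + beta) <= 2^-1 -> uniq J ->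
  (forall j, j \in J -> (translate j V `<=` B)%fset) ->
  (forall j k p, j \in J -> k \in J -> p \in translate j V ->
     p \in translate k V -> j = k) ->
  entropyS q B - expect q B (energyR Phi B) +
    (size J)%:R * expect q V (fun y => ln (1 + s * tilt y)) <= ln (psum B (weight Phi B)).
Proof.
move=> hq adm sle uJ VB dis.
have t0 y : 0 < 1 + s * tilt y.
  have : `|s * tilt y| <= 2^-1.
    by rewrite normrM (le_trans _ sle)// ler_wpM2l// tilt_bound.
  by rewrite ler_norml => /andP[h _]; lra.
rewrite -(psum_tilts s uJ VB dis).
apply: le_trans (gibbs_bound (adm B) _); last first.
  by move=> x; apply: prodr_gt0 => j _; exact: t0.
rewrite lerD2l.
have lnP x (K : seq (Zd d)) : ln (\prod_(j <- K) (1 + s * tilt (shift_config j x))) =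
    \sum_(j <- K) ln (1 + s * tilt (shift_config j x)).
  elim: K => [|j K IH]; first by rewrite !big_nil ln1.
  by rewrite !big_cons lnM ?posrE ?t0 ?IH// prodr_gt0.
have dE j : j \in J ->
    expect q B (fun x => ln (1 + s * tilt (shift_config j x))) =
    expect q V (fun y => ln (1 + s * tilt y)).
  move=> jJ; rewrite (@expect_sub _ _ _ q (translate j V) B).
  - exact: (@sinv_expect _ _ _ q j V (fun y => ln (1 + s * tilt y)) hq).
  - exact: VB.
  - move=> x y xy; rewrite (tilt_local (y := shift_config j y))//.
    exact/agree_shift.
have -> : (size J)%:R * expect q V (fun y => ln (1 + s * tilt y)) =
    \sum_(j <- J) expect q B (fun x => ln (1 + s * tilt (shift_config j x))).
  by rewrite (eq_big_seq _ dE) big_const_seq count_predT iter_addr addr0 mulr_natl.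
by rewrite -expect_sum; apply: le_expect => x _; rewrite lnP.
Qed.

End Perturbation.

(** * Tilings of boxes and the proof of detailed balance *)

Section Tiling.
Variable d : nat.
Implicit Types (p j k : Zd d) (V : {fset Zd d}).

Definition tile_centers r m : seq (Zd d) :=
  [seq k *+ r.*2.+1 | k <- (box d m : seq (Zd d))].

Lemma mulrn_coord k n i : (k *+ n) 0 i = k 0 i * n%:Z.
Proof. by rewrite mulmxnE -mulrzz pmulrn mulrzz. Qed.

Lemma tile_centers_uniq r m : uniq (tile_centers r m).
Proof.
rewrite map_inj_uniq ?fset_uniq// => k k' /rowP kk; apply/rowP => i.
by have := kk i; rewrite !mulrn_coord => /mulIf; apply.
Qed.

Lemma size_tile_centers r m : size (tile_centers r m) = #|` box d m|.
Proof. by rewrite size_map. Qed.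

Lemma tile_sub r m V j : (V `<=` box d r)%fset -> j \in tile_centers r m ->
  (translate j V `<=` box d (r + r.*2.+1 * m))%fset.
Proof.
move=> Vr /mapP[k km ->]; apply/fsubsetP => p; rewrite in_translate => pV.
rewrite -(subrK (k *+ r.*2.+1) p); apply: boxD; first exact: (fsubsetP Vr).
move: km; rewrite !in_box => /forallP km; apply/forallP => i.
by rewrite mulrn_coord normrM PoszM mulrC ler_pM.
Qed.

(** Distinct centres differ by at least 2r + 1 in some coordinate, while points of a box of radius
    [r] differ by at most 2r. *)
Lemma tile_disjoint r m V j j' p : (V `<=` box d r)%fset ->
  j \in tile_centers r m -> j' \in tile_centers r m ->
  p \in translate j V -> p \in translate j' V -> j = j'.
Proof.
move=> Vr /mapP[k _ ->] /mapP[k' _ ->]; rewrite !in_translate.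
move=> /(fsubsetP Vr) pk /(fsubsetP Vr) pk'.
have := boxB pk' pk; rewrite in_box => /forallP h.
congr (_ *+ _); apply/rowP => i; have := h i.
rewrite !mxE !mulrn_coord; set u := k 0 i; set v := k' 0 i; set w := p 0 i.
have -> : w - v * r.*2.+1%:Z - (w - u * r.*2.+1%:Z) = (u - v) * r.*2.+1%:Z by ring.
rewrite normrM => le_uv; apply/eqP; rewrite -subr_eq0; apply/negPn/negP => uv0.
have uv1 : 1 <= `|u - v| by rewrite -gtz0_ge1 normr_gt0.
have : r.*2.+1%:Z <= (r + r)%N%:Z.
  by apply: le_trans le_uv; rewrite ler_peMl.
by rewrite lez_nat; lia.
Qed.

(** The side lengths satisfy 2(r + (2r+1)m) + 1 = (2r+1)(2m+1): the tiles fill the box exactly. *)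
Lemma card_tiled_box r m :
  #|` box d (r + r.*2.+1 * m)| = (#|` box d r| * #|` box d m|)%N.
Proof. by rewrite !card_box -expnMn; congr (_ ^ _)%N; nia. Qed.

End Tiling.

Section DetailedBalance.
Variables (R : realType) (d : nat) (A : alphabetType).
Variable Phi : nn_interaction R d A.
Variable q : state R (Zd d) A.
Hypotheses (hq : sinv q) (adm : forall S x, 0 < q S x -> admissible Phi S x).
Hypothesis hP : (fun n => ln (Zbox Phi n) / #|` box d n|%:R) @ \oo -->
  free_energyR Phi q.

(** By [hP] and [entropy_rate_le], log Z exceeds entropy minus mean energy by at most o(volume),
    whereas [c] per tile is the fixed density [c] over the tile size. *)
Lemma tile_gain_le0 r c : (forall m, c * #|` box d m|%:R <=
    ln (Zbox Phi (r + r.*2.+1 * m)) - (entropyS q (box d (r + r.*2.+1 * m)) -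
      expect q (box d (r + r.*2.+1 * m)) (energyR Phi (box d (r + r.*2.+1 * m))))) ->
  c <= 0.
Proof.
move=> h; rewrite leNgt; apply/negP => c0.
have [C [C0 sC eC]] := energy_bound Phi.
have r0 : 0 < #|` box d r|%:R :> R by rewrite ltr0n box_gt0.
have e0 : 0 < c / #|` box d r|%:R by rewrite divr_gt0.
have : (fun n => ln (Zbox Phi n) / #|` box d n|%:R - free_energyR Phi q +
    (bdS (box d n))%:R / #|` box d n|%:R * C) @ \oo --> (0 : R).
  rewrite (_ : 0 = free_energyR Phi q - free_energyR Phi q + 0 * C); last first.
    by rewrite subrr mul0r addr0.
  apply: cvgD; first by apply: cvgB => //; exact: cvg_cst.
  by apply: cvgMl; apply: cvg_bdS; exact: folner_box.
move=> /cvgrPdist_lt/(_ _ e0)[m _ hm].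
have mN : (m <= r + r.*2.+1 * m)%N by nia.
have := hm _ mN; set N := (r + _)%N.
rewrite sub0r normrN => /ltr_normlW; apply/negP; rewrite -leNgt.
have N0 : 0 < #|` box d N|%:R :> R by rewrite ltr0n box_gt0.
have h1 := h m; rewrite -/N in h1.
have h2 := entropy_rate_le hq (box d N).
have := sinv_expect_energyR eC (box d N) hq; rewrite ler_norml => /andP[_ h3].
rewrite -(ler_pM2r N0).
have -> : c / #|` box d r|%:R * #|` box d N|%:R = c * #|` box d m|%:R.
  rewrite /N card_tiled_box natrM; field; rewrite gt_eqF//.
have -> : (ln (Zbox Phi N) / #|` box d N|%:R - free_energyR Phi q +
    (bdS (box d N))%:R / #|` box d N|%:R * C) * #|` box d N|%:R =
  ln (Zbox Phi N) - #|` box d N|%:R * entropy_rate q -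
  #|` box d N|%:R * mean_A Phi q + (bdS (box d N))%:R * C.
  by rewrite /free_energyR; field; rewrite gt_eqF.
rewrite /mean_A; lra.
Qed.

Lemma detailed_balance_le L V (a b : config d A) : interior_of L V ->
  agree_off L a b -> admissible Phi V a -> admissible Phi V b ->
  q V a * expR (energyR Phi V a) <= q V b * expR (energyR Phi V b).
Proof.
move=> LV ab aa ab'; rewrite leNgt; apply/negP => lt_ba.
set alpha := expR (energyR Phi V a) in lt_ba; set beta := expR _ in lt_ba.
have al0 : 0 < alpha by exact: expR_gt0.
have be0 : 0 < beta by exact: expR_gt0.
pose D := q V a * alpha - q V b * beta.
pose M := alpha + beta.
have D0 : 0 < D by rewrite subr_gt0.
have M0 : 0 < M by rewrite addr_gt0.
have DM : D <= M.
  have : q V a * alpha <= alpha by rewrite ler_piMl ?state_le1// ltW.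
  have : 0 <= q V b * beta by rewrite mulr_ge0 ?state_ge0// ltW.
  by rewrite /D /M; lra.
pose g := tilt Phi V a b.
have Eg : expect q V g = D.
  have E c u : expect q V (fun y => (agreeb V c y)%:R * u) = q V c * u.
    rewrite -(@psum_indic _ _ R V c (fun y => q V y * u)).
      by apply: eq_psum => y; rewrite mulrCA.
    by move=> x y /(state_local q) ->.
  by rewrite /g /tilt expectB !E.
have gM y : `|g y| <= M by exact: tilt_bound.
(* This maximizes the lower bound [t * D - 2 * (t * M) ^+ 2] of the gain per tile. *)
pose t := D / (4 * M ^+ 2).
have t0 : 0 < t by rewrite divr_gt0// mulr_gt0// exprn_gt0.
(* Since [D <= M]; this keeps every perturbation within the range -1/2 <= y of [ln1D_ge]. *)
have tM : t * M <= 4^-1.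
  have -> : t * M = D / M / 4 by rewrite /t; field; rewrite gt_eqF.
  by rewrite ler_pdivrMr// mulVf// ler_pdivrMr// mul1r.
have tE : D * t - 2 * (t * M) ^+ 2 = t * D / 2.
  by rewrite /t; field; rewrite gt_eqF.
have tD0 : 0 < t * D / 2 by rewrite divr_gt0// mulr_gt0.
have delta : t * D / 2 <= expect q V (fun y => ln (1 + t * g y)).
  rewrite -tE -Eg mulrC -expectZ -[2 * _](expect_cst q V) -expectB.
  apply: le_expect => y _.
  have tg : `|t * g y| <= t * M by rewrite normrM gtr0_norm// ler_pM2l.
  have h1 : t * g y - 2 * (t * g y) ^+ 2 <= ln (1 + t * g y).
    by apply: ln1D_ge; move: tg; rewrite ler_norml => /andP[]; lra.
  apply: le_trans h1; rewrite lerD2l lerN2 ler_pM2l//.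
  by rewrite -[leLHS]real_normK ?num_real// lerXn2r ?nnegrE// mulr_ge0// ltW.
have [r Vr] := box_exists V.
suff : t * D / 2 <= 0 by rewrite leNgt tD0.
apply: (@tile_gain_le0 r) => m; set B := box d (r + r.*2.+1 * m).
have tM2 : `|t| * (alpha + beta) <= 2^-1.
  by rewrite gtr0_norm//; apply: le_trans tM _; lra.
have := @tilted_pressure _ _ _ Phi L V LV a b ab aa ab' q t (tile_centers d r m) B
  hq adm tM2 (tile_centers_uniq d r m) (fun j => @tile_sub d r m V j Vr)
  (fun j k p => @tile_disjoint d r m V j k p Vr).
rewrite size_tile_centers -/g => h.
have : t * D / 2 * #|` box d m|%:R <=
    #|` box d m|%:R * expect q V (fun y => ln (1 + t * g y)).
  by rewrite mulrC ler_wpM2l.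
by rewrite /Zbox -/B; lra.
Qed.

End DetailedBalance.

(** * Consequences of the D-condition *)

Section Collar.
Variable d : nat.
Implicit Types (S T : {fset Zd d}).

Definition unit_steps : seq (Zd d) :=
  [seq basis i | i <- enum 'I_d] ++ [seq - basis i | i <- enum 'I_d].

(** With all nearest neighbours added, every interaction term touching [T] is contained in the
    collar. *)
Definition collar T : {fset Zd d} :=
  (T `|` \big[fsetU/fset0]_(p <- unit_steps) translate p T)%fset.

Lemma collar_interior T : interior_of T (collar T).
Proof.
have inE' p q : p \in T -> q \in unit_steps -> p + q \in collar T.
  move=> pT qs; rewrite inE; apply/orP; right; apply/mem_bigfsetU.
  by exists q => //; rewrite in_translate addrK.
move=> p pT; split; first by rewrite inE pT.
move=> i; split; apply: inE' => //; rewrite mem_cat.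
  by rewrite map_f ?mem_enum.
by apply/orP; right; apply/mapP; exists i; rewrite ?mem_enum.
Qed.

(** A translate of [T] consists of a translate of the difference of [T] and [S], of unchanged size,
    and a translate of [S], which leaves [S] only along its boundary. *)
Lemma card_collar_diff S T : (#|` (collar T `\` S)%fset| <=
  (size unit_steps).+1 * #|` (T `\` S)%fset| + \sum_(p <- unit_steps) boundary p S)%N.
Proof.
have sub : (collar T `\` S `<=` (T `\` S) `|` \big[fsetU/fset0]_(p <- unit_steps)
    (translate p (T `\` S) `|` (translate p S `\` S)))%fset.
  apply/fsubsetP => q; rewrite in_fsetD => /andP[qS]; rewrite /collar in_fsetU => /orP[qT|].
    by rewrite in_fsetU in_fsetD qS qT.
  move=> /mem_bigfsetU[p ps qT]; rewrite in_fsetU; apply/orP; right.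
  apply/mem_bigfsetU; exists p => //; move: qT.
  by rewrite !inE !in_translate !inE => ->; rewrite andbT qS /= orNb.
apply: leq_trans (fsubset_leq_card sub) _.
rewrite cardfsU (leq_trans (leq_subr _ _))// mulSn -addnA leq_add2l.
apply: leq_trans (card_bigfsetU _ _) _.
rewrite -sum1_size big_distrl /= -big_split /=; apply: leq_sum => p _.
rewrite cardfsU (leq_trans (leq_subr _ _))// mul1n leq_add2r card_translate.
by [].
Qed.

End Collar.

Section Comparison.
Variables (R : realType) (d : nat) (A : alphabetType).
Variable Phi : nn_interaction R d A.
Variables (mu : probability (config d A) R) (hmu : equilibrium_state Phi mu).
Variables (C : R) (C0 : 0 <= C).
Hypothesis site_le : forall x, `|site_energy Phi x| <= C.
Hypothesis edge_le : forall i x, `|edge_energy Phi i x| <= C.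
Implicit Types (S T : {fset Zd d}) (x y : config d A).

Local Notation X := (msupport mu).
Local Notation q := (measure_state mu).

(** For an exact Gibbs distribution on [S] this would be the constant -log Z; here it is constant on
    the support up to [comparison_error]. *)
Definition log_gibbs S x : R := ln (q S x) + energyR Phi S x.

Lemma log_gibbs_local S : localf S (log_gibbs S).
Proof.
by move=> x y xy; rewrite /log_gibbs (state_local q xy) (energyR_local Phi xy).
Qed.

(** The first term bounds the log of the number of patterns filling the collar outside [S]; the
    second is twice the energy change between [S] and the collar, once for each of the two points
    compared. *)
Definition comparison_error S T : R :=
  #|` (collar T `\` S)%fset|%:R * #|A|%:R +
  2 * ((d.+1 * #|` (collar T `\` S)%fset| + bdS S)%:R * C).

Lemma msupport_gt0 S x : X x -> 0 < q S x.
Proof. by move=> /msupportE. Qed.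

(* Sum over the patterns [z] on [V `\` S]: keep the restriction of [z] to the collar
   of [T], replace the pattern on [T] by one extending [y] on [S], which exists by the
   D-condition, and apply detailed balance. *)
Lemma log_gibbs_compare S T x y : (S `<=` T)%fset ->
  (forall U : {fset Zd d}, [disjoint U & T]%fset ->
     forall u v : pattern d A, language X U u -> language X S v ->
       (X `&` cylinder u) `&` (X `&` cylinder v) !=set0) ->
  X x -> X y -> log_gibbs S x <= log_gibbs S y + comparison_error S T.
Proof.
move=> ST hD Xx Xy; have [hsinv sa _] := hmu.
have hq := measure_state_sinv hsinv.
have adm U z := @measure_state_admissible _ _ _ Phi mu U z sa.
pose V := collar T; pose n := #|` (V `\` S)%fset|.
pose gam : R := (d.+1 * n + bdS S)%:R * C.
have TV : (T `<=` V)%fset by exact: fsubsetUl.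
have SV := fsubset_trans ST TV.
have qx := msupport_gt0 S Xx; have qy := msupport_gt0 S Xy.
have diff z : `|energyR Phi V z - energyR Phi S z| <= gam.
  exact: energyR_diff.
have diff1 z : energyR Phi V z <= energyR Phi S z + gam.
  by have := diff z; rewrite ler_norml => /andP[]; lra.
have diff2 z : energyR Phi S z - gam <= energyR Phi V z.
  by have := diff z; rewrite ler_norml => /andP[]; lra.
(* That is, [q S y] times e^(U_S(y) - U_S(x)), with one [gam] for each of the two passages between
   [S] and [V]. *)
pose K := expR (log_gibbs S y + 2 * gam - energyR Phi S x).
have bound z : q V (splice S x z) <= K.
  set a := splice S x z.
  have [qa|qa] := ltP 0 (q V a); last by apply: le_trans qa _; exact: expR_ge0.
  (* The D-condition speaks of patterns seen in [X]: [a'] certifies the part of [a] outside [T], and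
     [y'] then joins it to the pattern of [y] on [S]. *)
  have [a' Xa' aa'] := msupport_cyl qa.
  have dis : [disjoint (V `\` T) & T]%fset.
    by apply/fdisjointP => p; rewrite inE => /andP[].
  have lu : language X (V `\` T)%fset (restr a' (V `\` T)%fset) by exists a'.
  have lv : language X S (restr y S) by exists y.
  have [y' [[Xy' uy'] [_ vy']]] := hD _ dis _ _ lu lv.
  rewrite cylinderE in uy'; rewrite cylinderE in vy'.
  pose b := splice T y' a.
  have by' : agree V b y'.
    move=> p pV; rewrite /b /splice; case: ifPn => // pT.
    have pVT : p \in (V `\` T)%fset by rewrite in_fsetD pT pV.
    by rewrite -(uy' p pVT); exact: (aa' p pV).
  have qVb : q V b = q V y' by exact: state_local.
  have ab : agree_off T a b by move=> p pT; rewrite /b /splice (negbTE pT).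
  have DB := @detailed_balance_le _ _ _ Phi q hq adm (cvg_ln_Zbox hmu) T V a b
    (@collar_interior d T) ab (adm _ _ qa).
  have qb : 0 < q V b by rewrite qVb; exact: msupport_gt0.
  have {}DB := DB (adm _ _ qb).
  have qVy : q V b <= q S y.
    by rewrite qVb (state_local q (vy' : agree S y y')) state_le.
  have Ub : energyR Phi V b <= energyR Phi S y + gam.
    rewrite (energyR_local Phi by') (energyR_local Phi (vy' : agree S y y')).
    exact: diff1.
  have Ua : energyR Phi S x - gam <= energyR Phi V a.
    by rewrite -(energyR_local Phi (splice_agree S x z)); exact: diff2.
  rewrite -(@ler_pM2r _ (expR (energyR Phi V a))) ?expR_gt0//.
  apply: le_trans DB _.
  apply: (@le_trans _ _ (q S y * expR (energyR Phi S y + gam))).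
    by apply: ler_pM; rewrite ?state_ge0 ?expR_ge0// ler_expR.
  apply: (@le_trans _ _ (K * expR (energyR Phi S x - gam))).
    rewrite /K -expRD -[q S y]lnK ?posrE// -expRD ler_expR /log_gibbs; lra.
  by rewrite ler_wpM2l ?expR_ge0// ler_expR.
have sumb : q S x <= (#|A| ^ n)%:R * K.
  by rewrite (state_marg q x SV) -psum_const; exact: le_psum.
have A0 : (0 < #|A|)%N by apply/card_gt0P; exists point.
have : ln (q S x) <= ln ((#|A| ^ n)%:R * K).
  by rewrite ler_ln ?posrE// mulr_gt0 ?expR_gt0// ltr0n expn_gt0 A0.
rewrite lnM ?posrE ?expR_gt0 ?ltr0n ?expn_gt0 ?A0// expRK natrX lnXn ?ltr0n//.
have : ln #|A|%:R *+ n <= n%:R * #|A|%:R :> R.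
  by rewrite -[leLHS]mulr_natl ler_wpM2l//; apply/ltW/ln_sublinear; rewrite ltr0n.
move=> h1 h2; rewrite /comparison_error -/V -/n -/gam {1}/log_gibbs -lerBrDr.
apply: le_trans h2 _.
move: (ln #|A|%:R *+ n) h1 => u h1.
move: (n%:R * _) h1 (log_gibbs S y) (energyR Phi S x) (gam) => w h1 l e g.
rewrite (_ : l + (w + 2 * g) - e = w + (l + 2 * g - e)); last by ring.
by rewrite lerD2r.
Qed.

(** A function that varies by at most [comparison_error] on the support is that close to its
    [mu]-mean, which is mean energy minus entropy. *)
Lemma log_gibbs_mean S T x : (S `<=` T)%fset ->
  (forall U : {fset Zd d}, [disjoint U & T]%fset ->
     forall u v : pattern d A, language X U u -> language X S v ->
       (X `&` cylinder u) `&` (X `&` cylinder v) !=set0) ->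
  X x -> `|log_gibbs S x - (expect q S (energyR Phi S) - entropyS q S)| <=
    comparison_error S T.
Proof.
move=> ST hD Xx.
have -> : expect q S (energyR Phi S) - entropyS q S = expect q S (log_gibbs S).
  by rewrite /entropyS expectN opprK -expectD; apply: eq_psum => y; rewrite addrC.
have cmp := log_gibbs_compare ST hD.
rewrite ler_distl; apply/andP; split.
  rewrite lerBlDr -[leRHS](expect_cst q S); apply: le_expect => y /msupport_cyl[z Xz yz].
  by rewrite (log_gibbs_local yz); exact: cmp.
rewrite -lerBlDr -[leLHS](expect_cst q S); apply: le_expect => y /msupport_cyl[z Xz yz].
by rewrite (log_gibbs_local yz) lerBlDr; exact: cmp.
Qed.

End Comparison.

(** * Conditional information *)

Section Lex.
Variable d : nat.
Implicit Types (p q r : Zd d) (S : {fset Zd d}).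

Lemma lexP q p : reflect
  (exists i, q 0 i < p 0 i /\ forall j : 'I_d, (j < i)%N -> q 0 j = p 0 j) (lex q p).
Proof.
apply: (iffP existsP) => [[i /andP[qp /forallP h]]|[i [qp h]]].
  by exists i; split=> // j ji; have /implyP/(_ ji)/eqP := h j.
by exists i; rewrite qp; apply/forallP => j; apply/implyP => /h ->.
Qed.

Lemma lexxx p : lex p p = false.
Proof. by apply/negbTE/negP => h; have [i [+ _]] := lexP _ _ h; rewrite ltxx. Qed.

Lemma lex_trans q p r : lex p q -> lex q r -> lex p r.
Proof.
move=> /lexP[i [pi hi]] /lexP[j [qj hj]]; apply/lexP.
have [ij|ji|ij] := ltngtP i j.
- exists i; split=> [|k ki]; first by rewrite -hj.
  by rewrite hi// hj// (ltn_trans ki).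
- exists j; split=> [|k kj]; first by rewrite hi.
  by rewrite hi ?(ltn_trans kj)// hj.
- have {}ij : i = j by exact: val_inj.
  subst j; exists i; split=> [|k ki]; first exact: lt_trans qj.
  by rewrite hi// hj.
Qed.

Lemma lex_total p q : p != q -> lex p q \/ lex q p.
Proof.
move=> pq; have [i0 ni0] : exists i, p 0 i != q 0 i.
  apply/existsP; apply: contraNT pq => /existsPn h; apply/eqP/rowP => i.
  by apply/eqP; have := h i; rewrite negbK.
have [i ni hi] := @arg_minnP 'I_d i0 (fun i => p 0 i != q 0 i) val ni0.
have h (j : 'I_d) : (j < i)%N -> p 0 j = q 0 j.
  by apply: contraTeq => /hi; rewrite -leqNgt.
have [lt_pq|lt_qp|e] := ltgtP (p 0 i) (q 0 i).
- by left; apply/lexP; exists i.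
- by right; apply/lexP; exists i; split=> // j /h.
- by rewrite e eqxx in ni.
Qed.

Lemma lex_sub p q : lex (q - p) 0 = lex q p.
Proof.
apply/lexP/lexP => -[i [qp h]]; exists i; split=> [|j /h].
- by move: qp; rewrite !mxE subr_lt0.
- by rewrite !mxE => /eqP; rewrite subr_eq0 => /eqP.
- by rewrite !mxE subr_lt0.
- by rewrite !mxE => ->; rewrite subrr.
Qed.

Lemma lex_max S : S != fset0 ->
  exists2 m, m \in S & forall s, s \in S -> s != m -> lex s m.
Proof.
elim/fset1U_rect: S => [|i S iS IH _]; first by rewrite eqxx.
have [->|S0] := eqVneq (S : {fset Zd d}) fset0.
  exists i; first by rewrite fset1U1.
  by move=> s; rewrite !inE orbF => /eqP ->; rewrite eqxx.
have [m mS hm] := IH S0.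
have im : i != m by apply: contraNneq iS => ->.
have [im'|mi] := lex_total im.
  exists m; first by rewrite fset1Ur.
  by move=> s; rewrite !inE => /predU1P[->//|/hm].
exists i; first by rewrite fset1U1.
move=> s; rewrite !inE => /predU1P[->|sS _]; first by rewrite eqxx.
by have [->//|sm] := eqVneq s m; exact: lex_trans (hm _ sS sm) mi.
Qed.

Definition lower p S : {fset Zd d} := [fset s in S | lex s p]%fset.

(** [lower p S] as seen from [p]: a subset of the past of the origin, where (A2) and (A3) apply. *)
Definition past_window p S : {fset Zd d} := [fset b in translate (- p) S | lex b 0]%fset.

Lemma lower_window p S : lower p S = translate p (past_window p S).
Proof.
apply/fsetP => s; rewrite in_translate !inE /= in_translate opprK subrK.
by rewrite lex_sub.
Qed.

Lemma past_window_past p S : [set` past_window p S] `<=` past d.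
Proof. by move=> b /=; rewrite !inE => /andP[]. Qed.

End Lex.

Section ChainRule.
Variables (R : realType) (d : nat) (A : alphabetType).
Implicit Types (S : {fset Zd d}) (p : Zd d).

(** Peel off the lexicographic maximum of [S]: its lower set is all the rest, and it belongs to no
    other lower set. *)
Lemma ln_chain_rule (q : state R (Zd d) A) S x :
  ln (q S x) = \sum_(p <- S)
    (ln (q (p |` lower p S)%fset x) - ln (q (lower p S) x)).
Proof.
have [n nS] : exists n, (#|` S| <= n)%N by exists #|` S|.
elim: n S nS => [|n IH] S nS.
  have -> : S = fset0 by apply: cardfs0_eq; apply/eqP; rewrite -leqn0.
  by rewrite state0 ln1 big_seq_fset0.
have [->|S0] := eqVneq S fset0; first by rewrite state0 ln1 big_seq_fset0.
have [m mS hm] := lex_max S0.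
pose S' := (S `\ m)%fset.
have nS' : (#|` S'| <= n)%N by move: nS; rewrite (cardfsD1 m S) mS.
rewrite (big_fsetD1 m mS)/=.
have lm : lower m S = S'.
  apply/fsetP => s; rewrite !inE; have [->|sm] := eqVneq s m.
    by rewrite lexxx andbF.
  by apply: andb_idr => sS; exact: hm.
rewrite lm fsetD1K// -addrA -[LHS]addr0; congr (_ + _).
rewrite [X in _ + X](_ : _ = ln (q S' x)); first by rewrite addNr.
rewrite [RHS]IH//; apply: eq_big_seq => p pS'.
have -> // : lower p S = lower p S'.
apply/fsetP => s; rewrite !inE; have [->|//] := eqVneq s m.
apply/negP => /andP[_ mp]; move: pS'; rewrite !inE => /andP[pm pS].
by have := lex_trans (hm _ pS pm) mp; rewrite lexxx.
Qed.

Variable mu : probability (config d A) R.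
Hypothesis hmu : shift_invariant mu.

Lemma ln_chain_cond S x : msupport mu x -> ln (measure_state mu S x) =
  \sum_(p <- S) ln (cond_prob mu (past_window p S) (shift_config p x)).
Proof.
move=> sx; rewrite ln_chain_rule; apply: eq_bigr => p _.
have h := measure_state_sinv hmu.
have -> : (p |` lower p S)%fset = translate p (0 |` past_window p S)%fset.
  apply/fsetP => s; rewrite lower_window !(in_translate, in_fset1U) subr_eq0.
  by [].
have sp := msupport_shift p hmu sx.
by rewrite lower_window !h -ln_div// posrE; exact: sp.
Qed.

End ChainRule.

Lemma ln_dist (R : realType) (c a b : R) : 0 < c -> c <= a -> c <= b ->
  `|ln a - ln b| <= `|a - b| / c.
Proof.
move=> c0.
have h u v : c <= u -> c <= v -> ln u - ln v <= `|u - v| / c.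
  move=> cu cv; have u0 := lt_le_trans c0 cu; have v0 := lt_le_trans c0 cv.
  rewrite -ln_div ?posrE//.
  have := @le_ln1Dx R (u / v - 1); rewrite addrCA subrr addr0 => k.
  apply: le_trans (k _) _; first by rewrite ltrBrDl subrr divr_gt0.
  have -> : u / v - 1 = (u - v) / v by field; rewrite gt_eqF.
  apply: (@le_trans _ _ (`|u - v| / v)).
    by rewrite ler_wpM2r ?invr_ge0 ?ler_norm// ltW.
  by rewrite ler_wpM2l// lef_pV2// posrE.
move=> ca cb; rewrite ler_norml h// andbT lerNl opprB.
by rewrite distrC; exact: h.
Qed.

(** * Uniform control of the conditional information on the support of [nu] *)

Section Information.
Variables (R : realType) (d : nat) (A : alphabetType).
Variables (mu nu : probability (config d A) R).
Hypothesis hsupp : msupport nu `<=` msupport mu.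
Hypothesis A2 : cond_prob_cvg_uniform mu (msupport nu).
Hypothesis A3 : 0 < c_minus mu nu.
Implicit Types (W S : {fset Zd d}) (x y : config d A).

Local Notation D := (msupport nu).
Local Notation c := (c_minus mu nu).
Local Notation q := (measure_state mu).

Lemma cond_probE W x : cond_prob mu W x = q (0 |` W)%fset x / q W x.
Proof. by []. Qed.

Lemma cond_prob_local W : localf (0 |` W)%fset (cond_prob mu W).
Proof.
move=> x y xy; rewrite !cond_probE (state_local q xy).
by rewrite (state_local q (agree_sub (fsubsetUr _ _) xy)).
Qed.

Lemma cond_prob_le1 W x : cond_prob mu W x <= 1.
Proof.
rewrite cond_probE; have := state_ge0 q W x.
rewrite le_eqVlt => /predU1P[<-|q0]; first by rewrite invr0 mulr0.
by rewrite ler_pdivrMr// mul1r state_le// fsubsetUr.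
Qed.

Lemma c_minus_le W x : D x -> [set` W] `<=` past d -> c <= cond_prob mu W x.
Proof.
move=> Dx Wp; apply: ge_inf; last by exists x, W.
exists 0 => _ [y [S [_ _ ->]]]; rewrite cond_probE.
by rewrite divr_ge0 ?state_ge0.
Qed.

Lemma past_box_past n : [set` past_box d n] `<=` past d.
Proof. by move=> b /=; rewrite !inE => /andP[]. Qed.

Lemma past_box_mono m n : (m <= n)%N -> (past_box d m `<=` past_box d n)%fset.
Proof.
move=> mn; apply/fsubsetP => b; rewrite !inE => /andP[bm ->]; rewrite andbT.
exact: (fsubsetP (box_mono d mn)).
Qed.

Lemma cvg_cond_prob_past x : D x ->
  cond_prob mu (past_box d n) x @[n --> \oo] --> cond_prob_past mu x.
Proof.
move=> Dx; apply: cvgr_epsP => e e0; have [m hm] := A2 e0.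
exists m => // n /= mn; apply/ltW/hm => //; first exact: past_box_mono.
exact: past_box_past.
Qed.

Lemma cond_prob_past_ge x : D x -> c <= cond_prob_past mu x.
Proof.
move=> Dx; apply: (cvgr_to_ge (cvg_cond_prob_past Dx)); apply: nearW => n.
by apply: c_minus_le => //; exact: past_box_past.
Qed.

Lemma cond_prob_past_le1 x : D x -> cond_prob_past mu x <= 1.
Proof.
move=> Dx; apply: (cvgr_to_le (cvg_cond_prob_past Dx)); apply: nearW => n.
exact: cond_prob_le1.
Qed.

Definition infoR x : R := - ln (cond_prob_past mu x).

Lemma informationE x : D x -> information mu x = (infoR x)%:E.
Proof.
move=> Dx; rewrite /information lne_EFin//.
exact: lt_le_trans (cond_prob_past_ge Dx).
Qed.

Lemma info_dist W x e : D x -> [set` W] `<=` past d ->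
  `|cond_prob mu W x - cond_prob_past mu x| <= e ->
  `|- ln (cond_prob mu W x) - infoR x| <= e / c.
Proof.
move=> Dx Wp h; rewrite /infoR -opprD normrN.
apply: le_trans (ln_dist A3 (c_minus_le Dx Wp) (cond_prob_past_ge Dx)) _.
by rewrite ler_wpM2r// invr_ge0 ltW.
Qed.

Definition info_window W x : R := - ln (cond_prob mu W x).

Lemma info_window_local W : localf (0 |` W)%fset (info_window W).
Proof. by move=> x y /cond_prob_local xy; rewrite /info_window xy. Qed.

Let mD : measurable D := measurable_msupport nu.

(** On the support of [nu] it is a limit of functions of finitely many coordinates. *)
Lemma measurable_infoR : measurable_fun D infoR.
Proof.
apply: (@measurable_fun_cvg _ _ _ _ (fun n => info_window (past_box d n))).
  move=> n; apply: measurable_funTS.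
  have := measurable_int nu (integrable_local nu (@info_window_local (past_box d n))).
  by move/measurable_EFinP.
move=> x Dx; apply: cvgr_epsP => e e0.
(* The tolerance [e * c] on probabilities becomes [e] on logarithms, ln having Lipschitz constant
   [1 / c] above [c]. *)
have [m hm] := A2 (mulr_gt0 e0 A3); exists m => // n /= mn.
rewrite -[leRHS](mulfK (lt0r_neq0 A3)); apply: info_dist => //.
  exact: past_box_past.
by apply/ltW/hm => //; [exact: past_box_mono|exact: past_box_past].
Qed.

Lemma integrable_infoR : nu.-integrable D (EFin \o infoR).
Proof.
apply: measurable_bounded_integrable => //.
- by rewrite (le_lt_trans (probability_le1 _ _))// ltry.
- exact: measurable_infoR.
exists (- ln c); split; first exact: num_real.
move=> M cM x Dx /=; apply: ltW; apply: le_lt_trans cM.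
have p0 := lt_le_trans A3 (cond_prob_past_ge Dx).
rewrite /infoR ger0_norm ?oppr_ge0 ?ln_le0 ?cond_prob_past_le1//.
by rewrite lerN2 ler_ln ?posrE// cond_prob_past_ge.
Qed.

Definition mean_info : R := fine (\int[nu]_(x in D) (infoR x)%:E)%E.

Lemma mean_infoE : (\int[nu]_(x in D) (infoR x)%:E)%E = mean_info%:E.
Proof. by rewrite /mean_info fineK//; exact: integrable_fin_num integrable_infoR. Qed.

Lemma integral_local_support S (f : config d A -> R) : localf S f ->
  (\int[nu]_(x in D) (f x)%:E = (expect (measure_state nu) S f)%:E)%E.
Proof.
by move=> lf; rewrite -integral_local// [RHS](integral_full mD (msupportC0 nu)).
Qed.

Lemma integrable_local_support S (f : config d A -> R) : localf S f ->
  nu.-integrable D (EFin \o f).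
Proof.
move=> lf; apply: (@integrableS _ _ _ _ setT) => //.
exact: integrable_local lf.
Qed.

Lemma mean_info_window W e : [set` W] `<=` past d ->
  (forall x, D x -> `|cond_prob mu W x - cond_prob_past mu x| <= e) ->
  `|expect (measure_state nu) (0 |` W)%fset (info_window W) - mean_info| <= e / c.
Proof.
move=> Wp h; have lw := @info_window_local W; rewrite ler_distl.
have hD x : D x -> infoR x - e / c <= info_window W x <= infoR x + e / c.
  by move=> Dx; rewrite -ler_distl; apply: info_dist => //; exact: h.
have cl u : localf (0 |` W)%fset (fun x => info_window W x + u).
  by move=> x y /lw ->.
have shiftE u : (\int[nu]_(x in D) (info_window W x + u)%:E =
    (expect (measure_state nu) (0 |` W)%fset (info_window W) + u)%:E)%E.
  by rewrite (integral_local_support (cl u)) expectD expect_cst.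
apply/andP; split.
  rewrite lerBlDr -lee_fin -shiftE -mean_infoE; apply: le_integral => //.
  - exact: integrable_infoR.
  - exact: integrable_local_support (cl _).
  - by move=> x; rewrite inE => /hD/andP[+ _]; rewrite lee_fin lerBlDr.
rewrite -lerBlDr -lee_fin -shiftE -mean_infoE; apply: le_integral => //.
- exact: integrable_local_support (cl _).
- exact: integrable_infoR.
- by move=> x; rewrite inE => /hD/andP[_ +]; rewrite lee_fin lerBlDr.
Qed.

End Information.

(** * Averaging over the D-condition sets *)

Section DCondition.
Variables (R : realType) (d : nat).
Variables (S T : nat -> {fset Zd d}).
Hypothesis ST : forall n, (S n `<=` T n)%fset.
Hypothesis Soo : (fun n => #|` S n|%:R : R) @ \oo --> +oo.
Hypothesis Sinv : forall p : Zd d,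
  (fun n => #|` symdiff (S n) (translate p (S n))|%:R / #|` S n|%:R : R)
    @ \oo --> (0 : R).
Hypothesis TS1 : (fun n => #|` T n|%:R / #|` S n|%:R : R) @ \oo --> (1 : R).

Lemma D_condition_pos : \forall n \near \oo, (0 < #|` S n|)%N.
Proof.
move/cvgryPge : Soo => /(_ 1); apply: filterS => n h.
by rewrite -(ltr_nat R) (lt_le_trans _ h).
Qed.

Lemma D_condition_folner : folner R S.
Proof.
split=> [|p]; first exact: D_condition_pos.
apply: (@squeeze_cvgr _ _ _ _ (fun=> 0) _ _ _ _ _ (Sinv p)); last exact: cvg_cst.
apply: nearW => n; rewrite divr_ge0//= ler_wpM2r ?invr_ge0// ler_nat.
by rewrite fsubset_leq_card// fsubsetUr.
Qed.

Lemma D_condition_collar :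
  (fun n => #|` (collar (T n) `\` S n)%fset|%:R / #|` S n|%:R : R) @ \oo --> (0 : R).
Proof.
have TSD : (fun n => #|` (T n `\` S n)%fset|%:R / #|` S n|%:R : R) @ \oo --> (0 : R).
  have h : (fun n => #|` T n|%:R / #|` S n|%:R - 1 : R) @ \oo --> (0 : R).
    by rewrite -(subrr 1); apply: cvgB => //; exact: cvg_cst.
  apply: cvg_trans; last exact: h.
  apply: near_eq_cvg; move: D_condition_pos; apply: filterS => n Sn.
  rewrite (cardfsDS (ST n)) natrB ?fsubset_leq_card// mulrBl divff//.
  by rewrite pnatr_eq0 -lt0n.
pose k : R := (size (unit_steps d)).+1%:R.
apply: (@squeeze_cvgr _ _ _ _ (fun=> 0) (fun n =>
  k * (#|` (T n `\` S n)%fset|%:R / #|` S n|%:R) +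
  (\sum_(p <- unit_steps d) boundary p (S n))%:R / #|` S n|%:R)).
- apply: nearW => n; rewrite divr_ge0//= mulrA -mulrDl ler_wpM2r ?invr_ge0//.
  by rewrite -natrM -natrD ler_nat; exact: card_collar_diff.
- exact: cvg_cst.
- rewrite -(addr0 0) -{1}(mulr0 k); apply: cvgD; first exact: cvgMr.
  exact: folner_sum D_condition_folner.
Qed.

End DCondition.

(** Bookkeeping for one D-condition set: [s] is its size, [X] the [nu]-mean of -ln mu(x(S_n)), [I]
    the mean information, [H] the [mu]-entropy on the set, [rate] its limit density, [Um], [Un] the
    mean energies and [am], [an] the means of A_Phi under [mu] and [nu]. Errors: [v] counts the
    collar outside the set, [bd] its outgoing edges, [bs] its boundary along the past box. The 4 is
    2 from the comparison plus 1 from each energy estimate. *)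
Lemma free_energy_balance (R : realType) (s X I H Um Un am an rate e c bs v bd a k C : R) :
  0 < s -> 0 < c -> `|X - s * I| <= (s * (e * c) + bs) / c ->
  `|- X + Un - (Um - H)| <= v * a + 2 * ((k * v + bd) * C) ->
  `|Um + s * am| <= bd * C -> `|Un + s * an| <= bd * C ->
  `|rate + am - (I + an)| <=
    e + (bs / s / c + `|H / s - rate| + (v / s * (a + 2 * k * C) + bd / s * (4 * C))).
Proof.
move=> s0 c0; have -> : (s * (e * c) + bs) / c = s * e + bs / c.
  by field; rewrite gt_eqF.
have normMs u : `|u| * s = `|u * s| by rewrite normrM (gtr0_norm s0).
move=> h1 h2 h3 h4; rewrite -(ler_pM2r s0) normMs.
have -> : (e + (bs / s / c + `|H / s - rate| +
    (v / s * (a + 2 * k * C) + bd / s * (4 * C)))) * s =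
  s * e + bs / c + `|H / s - rate| * s + (v * (a + 2 * k * C) + bd * (4 * C)).
  by field; rewrite !gt_eqF.
rewrite normMs.
have -> : (H / s - rate) * s = H - rate * s by field; rewrite gt_eqF.
have -> : (rate + am - (I + an)) * s = - (H - rate * s) + (- X + Un - (Um - H)) +
  (Um + s * am) - (Un + s * an) + (X - s * I) by ring.
have n1 := ler_norm (H - rate * s); have n2 := ler_norm (- (H - rate * s)).
rewrite normrN in n2.
move: h1 h2 h3 h4; rewrite !ler_norml => /andP[a1 b1] /andP[a2 b2] /andP[a3 b3] /andP[a4 b4].
by apply/andP; split; lra.
Qed.

Section Averaging.
Variables (R : realType) (d : nat) (A : alphabetType).
Variable Phi : nn_interaction R d A.
Variables mu nu : probability (config d A) R.
Hypothesis hmu : equilibrium_state Phi mu.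
Hypothesis hnu : shift_invariant nu.
Hypothesis hsupp : msupport nu `<=` msupport mu.
Hypothesis A2 : cond_prob_cvg_uniform mu (msupport nu).
Hypothesis A3 : 0 < c_minus mu nu.
Implicit Types (W S T : {fset Zd d}) (x y : config d A).

Local Notation D := (msupport nu).
Local Notation c := (c_minus mu nu).
Local Notation q := (measure_state mu).
Local Notation qn := (measure_state nu).

Let smu : shift_invariant mu. Proof. by have [] := hmu. Qed.

(** Informations are those of [mu], averages those of [nu]; the invariance of [nu] brings each term
    back to the origin. *)
Lemma expect_ln_chain S : expect qn S (fun x => - ln (q S x)) =
  \sum_(p <- S) expect qn (0 |` past_window p S)%fset (info_window mu (past_window p S)).
Proof.
rewrite (@eq_expect _ _ _ _ _ _ (fun x =>
    \sum_(p <- S) info_window mu (past_window p S) (shift_config p x))).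
  rewrite expect_sum; apply: eq_big_seq => p pS.
  set W := (0 |` past_window p S)%fset.
  rewrite (@expect_sub _ _ _ qn (translate p W) S).
  - exact: (@sinv_expect _ _ _ qn p W (info_window mu (past_window p S))
      (measure_state_sinv hnu)).
  - apply/fsubsetP => s; rewrite in_translate !inE in_translate opprK subrK.
    by rewrite subr_eq0 => /orP[/eqP ->//|/andP[]].
  - move=> x y xy; apply: info_window_local; exact/agree_shift.
move=> x /msupport_cyl[y Dy xy].
have lhsE : q S x = q S y by exact: state_local.
rewrite lhsE (ln_chain_cond smu S (hsupp Dy)) -sumrN; apply: eq_big_seq => p pS.
apply: info_window_local => //; apply/agree_shift; apply: agree_sym.
apply: agree_sub xy; apply/fsubsetP => s.
rewrite in_translate !inE in_translate opprK subrK subr_eq0.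
by move=> /orP[/eqP ->//|/andP[]].
Qed.

(** If the past window of [p] contains [past_box d m], the error is at most [e]. Otherwise some
    [p + b] with [b] in that box lies outside [S], and the trivial bound 1 on a difference of
    probabilities is used; such pairs [p], [b] are counted by the boundaries of [S]. Dividing by [c]
    passes to logarithms. *)
Lemma mean_info_approx S (e : R) m : 0 <= e ->
  (forall x, D x -> forall W, (past_box d m `<=` W)%fset -> [set` W] `<=` past d ->
     `|cond_prob mu W x - cond_prob_past mu x| <= e) ->
  `|expect qn S (fun x => - ln (q S x)) - #|` S|%:R * mean_info mu nu| <=
    (#|` S|%:R * e + (\sum_(b <- past_box d m) boundary b S)%:R) / c.
Proof.
move=> e0 he; rewrite expect_ln_chain.
have -> : #|` S|%:R * mean_info mu nu = \sum_(p <- S) mean_info mu nu.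
  by rewrite big_const_seq count_predT iter_addr addr0 mulr_natl.
rewrite -sumrB (le_trans (ler_norm_sum _ _ _))//.
pose bad p := \sum_(b <- past_box d m) (p + b \notin S)%:R : R.
have -> : (#|` S|%:R * e + (\sum_(b <- past_box d m) boundary b S)%:R) / c =
    \sum_(p <- S) (e + bad p) / c.
  rewrite -mulr_suml big_split /=; congr ((_ + _) / _).
    by rewrite big_const_seq count_predT iter_addr addr0 mulr_natl.
  rewrite exchange_big natr_sum; apply: eq_bigr => b _.
  rewrite -count_exit -sum1_count natr_sum big_mkcond.
  by apply: eq_bigr => p' _; case: ifP.
apply: ler_sum => p _; apply: mean_info_window => //; first exact: past_window_past.
move=> x Dx; have bad0 : 0 <= bad p by apply: sumr_ge0.
have [mW|] := boolP (past_box d m `<=` past_window p S)%fset.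
  rewrite (le_trans (he x Dx _ mW (@past_window_past d p S)))// lerDl//.
case/fsubsetPn => b bm; rewrite !inE in_translate opprK => nb.
have bS : p + b \notin S.
  move: nb; rewrite negb_and addrC => /orP[//|].
  by have := past_box_past bm; rewrite /past /= => ->.
have bad1 : 1 <= bad p.
  by rewrite /bad (big_fsetD1 b bm)/= bS lerDl sumr_ge0.
apply: (@le_trans _ _ 1); last by lra.
have h1 := cond_prob_le1 mu (past_window p S) x.
have h2 := c_minus_le mu Dx (@past_window_past d p S).
have h3 := cond_prob_past_le1 A2 Dx.
have h4 := cond_prob_past_ge A2 Dx.
have {}h2 : 0 <= cond_prob mu (past_window p S) x := le_trans (ltW A3) h2.
have {}h4 : 0 <= cond_prob_past mu x := le_trans (ltW A3) h4.
rewrite ler_norml lerBrDl lerBlDr; apply/andP; split.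
  by rewrite (le_trans h3)// lerDr.
by rewrite lerBlDr (le_trans h1)// lerDl.
Qed.

Lemma free_energy_eq_mean : D_condition R (msupport mu) ->
  free_energyR Phi q = mean_info mu nu + mean_A Phi qn.
Proof.
move=> [S [T [ST Soo Sinv TS1 hD]]].
have hF := D_condition_folner Soo Sinv.
have hcol := D_condition_collar ST Soo Sinv TS1.
have [C [C0 sC eC]] := energy_bound Phi.
have qsinv := measure_state_sinv smu; have nsinv := measure_state_sinv hnu.
set P := free_energyR Phi q; set Q := _ + _.
suff main e : 0 < e -> `|P - Q| <= e.
  by apply/eqP; rewrite -subr_eq0 -normr_le0; apply/ler_addgt0Pl => e /main; rewrite addr0.
move=> e0; have ec0 : 0 < e * c by rewrite mulr_gt0.
have [m hm] := A2 ec0.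
pose err n : R := (\sum_(b <- past_box d m) boundary b (S n))%:R / #|` S n|%:R / c +
  `|entropyS q (S n) / #|` S n|%:R - entropy_rate q| +
  (#|` (collar (T n) `\` S n)%fset|%:R / #|` S n|%:R * (#|A|%:R + 2 * d.+1%:R * C) +
   (bdS (S n))%:R / #|` S n|%:R * (4 * C)).
have err0 : err n @[n --> \oo] --> (0 : R).
  rewrite (_ : 0 = 0 / c + 0 + (0 * (#|A|%:R + 2 * d.+1%:R * C) + 0 * (4 * C))); last first.
    by rewrite !mul0r !addr0.
  apply: cvgD; first apply: cvgD.
  - by apply: cvgMl; exact: folner_sum.
  - rewrite -(normr0 R) -(subrr (entropy_rate q)); apply: cvg_norm.
    apply: cvgB; last exact: cvg_cst.
    exact: cvg_entropy_folner.
  - by apply: cvgD; apply: cvgMl => //; exact: cvg_bdS.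
rewrite -[leRHS]addr0.
apply: (@cvgr_to_ge _ \oo _ R (fun n => e + err n)).
  by apply: cvgD => //; exact: cvg_cst.
near=> n; have s0 : 0 < #|` S n|%:R :> R.
  by rewrite ltr0n; near: n; exact: D_condition_pos Soo.
have h1 := @mean_info_approx (S n) (e * c) m (ltW ec0)
  (fun x Dx W mW Wp => ltW (hm x Dx W mW Wp)).
have h2 : `|expect qn (S n) (log_gibbs Phi mu (S n)) -
    (expect q (S n) (energyR Phi (S n)) - entropyS q (S n))| <=
    comparison_error A C (S n) (T n).
  (* [log_gibbs_mean] is centred at a [mu]-mean but holds at every point of the support of [mu]. A
     pattern charged by [nu] extends to such a point, so the bound survives averaging over [nu]. *)
  rewrite -[X in _ - X](expect_cst qn (S n)) -expectB ler_norml; apply/andP; split.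
    rewrite -[leLHS](expect_cst qn (S n)); apply: le_expect => x /msupport_cyl[y Dy xy].
    rewrite (log_gibbs_local _ _ xy).
    have := log_gibbs_mean hmu C0 sC eC (ST n) (hD n) (hsupp Dy).
    by rewrite ler_norml => /andP[].
  rewrite -[leRHS](expect_cst qn (S n)); apply: le_expect => x /msupport_cyl[y Dy xy].
  rewrite (log_gibbs_local _ _ xy).
  have := log_gibbs_mean hmu C0 sC eC (ST n) (hD n) (hsupp Dy).
  by rewrite ler_norml => /andP[].
have h3 := sinv_expect_energyR eC (S n) qsinv.
have h4 := sinv_expect_energyR eC (S n) nsinv.
have lgE : expect qn (S n) (log_gibbs Phi mu (S n)) =
    - expect qn (S n) (fun x => - ln (q (S n) x)) + expect qn (S n) (energyR Phi (S n)).
  by rewrite -expectN -expectD; apply: eq_psum => x; rewrite opprK.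
rewrite lgE /comparison_error natrD natrM in h2.
exact: free_energy_balance s0 A3 h1 h2 h3 h4.
Unshelve. all: by end_near. Qed.

End Averaging.

Theorem theorem7p1 (R : realType) (d : nat) (A : alphabetType)
    (Phi : nn_interaction R d A) (mu nu : probability (config d A) R)
    (hmu : equilibrium_state Phi mu)
    (hnu : shift_invariant nu)
    (hsupp : msupport nu `<=` msupport mu)
    (A1 : D_condition R (msupport mu))
    (A2 : cond_prob_cvg_uniform mu (msupport nu))
    (A3 : 0 < c_minus mu nu) :
  pressure Phi = (\int[nu]_x (information mu x + A_Phi Phi x))%E.
Proof.
have [_ sa _] := hmu; have sn := subset_trans hsupp sa.
have mD := measurable_msupport nu; have D0 := msupportC0 nu.
rewrite (pressureE hmu) (free_energy_eq_mean hmu hnu hsupp A2 A3 A1).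
(* On the support of [nu] both integrands are real-valued and integrable, so the extended integral
   splits. *)
rewrite (integral_full mD D0) EFinD -mean_infoE// /mean_A.
rewrite -(integral_local_support nu (@A_PhiR_local _ _ _ Phi)).
rewrite -integralD//; last 2 first.
- exact: integrable_infoR.
- exact: integrable_local_support (@A_PhiR_local _ _ _ Phi).
apply: eq_integral => x; rewrite inE => Dx.
by rewrite (informationE A2 A3 Dx) (A_PhiE (sn _ Dx)).
Qed.
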